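(* Let $\Sigma$ be a finite simplicial complex, viewed as a poset under inclusion. The morphism $\iota$ is an isomorphism of BDGAs between the singular cochain complex $C^\ast(\hat\Sigma)$ of the barycentric subdivision $\hat\Sigma$ of $\Sigma$ and the $S_\Sigma$-relative Hochschild cochain complex $C^\ast_{S_\Sigma}(I_\Sigma,I_\Sigma)$ of the incidence algebra $I_\Sigma$ of $\Sigma$. In particular, as the embedding $C^\ast_{S_\Sigma}(I_\Sigma,I_\Sigma)\hookrightarrow C^\ast(I_\Sigma,I_\Sigma)$ into the classical Hochschild cochain complex of $I_\Sigma$ is also a morphism of BDGAs, besides being a quasi-isomorphism, the cohomology comparison theorem of Gerstenhaber and Schack relating singular cohomology and Hochschild cohomology ($H^\ast(\hat\Sigma,\mathbb K)\cong HH^\ast(I_\Sigma,I_\Sigma)$) can be realized, at the cochain level, as a quasi-isomorphism of BDGAs $$C^\ast(\hat\Sigma)\xrightarrow{\ \iota\ }C^\ast_{S_\Sigma}(I_\Sigma,I_\Sigma)\hookrightarrow C^\ast(I_\Sigma,I_\Sigma).$$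
   Context: $\mathbb K$ is an arbitrary field. A finite simplicial complex is a set $\Sigma$ of subsets of a nonempty finite set such that, for every $\sigma\in\Sigma$, all nonempty subsets of $\sigma$ belong to $\Sigma$; it is ordered by inclusion. **BDGA.** A brace differential graded algebra (BDGA) is an associative differential graded algebra $A$, with product $\cdot$ and differential $\delta$ of degree $+1$, together with multilinear braces $v\{v_1,\dots,v_n\}$ ($n\ge1$) of degree $|v|+\sum_i(|v_i|-1)$ such that (with the convention that a brace with no entries is $v\{\emptyset\}=v$): (1) $(v\{v_1,\dots,v_m\})\{w_1,\dots,w_n\}=\sum_{0\le i_1\le j_1\le\dots\le i_m\le j_m\le n}(-1)^{\sum_{k=1}^m(|v_k|-1)\sum_{l=1}^{i_k}(|w_l|-1)}\,v\{w_1,\dots,w_{i_1},v_1\{w_{i_1+1},\dots,w_{j_1}\},w_{j_1+1},\dots,v_m\{w_{i_m+1},\dots,w_{j_m}\},w_{j_m+1},\dots,w_n\}$; (2) $(v\cdot w)\{v_1,\dots,v_n\}=\sum_{k=0}^n(-1)^{|w|\sum_{p=1}^k(|v_p|-1)}v\{v_1,\dots,v_k\}\cdot w\{v_{k+1},\dots,v_n\}$; (3) $\delta(v\{v_1,\dots,v_n\})-(\delta v)\{v_1,\dots,v_n\}+\sum_{i=1}^n(-1)^{|v|+|v_1|+\dots+|v_{i-1}|-i+1}v\{v_1,\dots,\delta v_i,\dots,v_n\}=(-1)^{|v|(|v_1|-1)}v_1\cdot(v\{v_2,\dots,v_n\})-\sum_{i=1}^{n-1}(-1)^{|v|+|v_1|+\dots+|v_i|-i-1}v\{v_1,\dots,v_i\cdot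 v_{i+1},\dots,v_n\}+(-1)^{|v|+|v_1|+\dots+|v_{n-1}|-n}(v\{v_1,\dots,v_{n-1}\})\cdot v_n$. A morphism of BDGAs is a degree $0$ linear map commuting with $\delta$, $\cdot$ and all braces. **Hochschild BDGA.** For an associative unital algebra $A$, $C^n(A,A)=\mathrm{Hom}_{\mathbb K}(A^{\otimes n},A)$. The braces are, with $m=|x|+\sum_k(|x_k|-1)$, $$x\{x_1,\dots,x_n\}(a_1,\dots,a_m)=\sum(-1)^{\sum_{k=1}^n i_k(|x_k|-1)}x(a_1,\dots,a_{i_1},x_1(a_{i_1+1},\dots,a_{i_1+|x_1|}),\dots,a_{i_n},x_n(a_{i_n+1},\dots,a_{i_n+|x_n|}),\dots,a_m),$$ summed over $0\le i_1\le i_1+|x_1|\le i_2\le\dots\le i_n+|x_n|\le m$. The differential $\delta$ and the product $\cdot$ are, respectively, the Hochschild coboundary, $\delta x(a_1,\dots,a_{n+1})=a_1x(a_2,\dots,a_{n+1})+\sum_{i=1}^n(-1)^ix(a_1,\dots,a_ia_{i+1},\dots,a_{n+1})+(-1)^{n+1}x(a_1,\dots,a_n)a_{n+1}$ for $|x|=n$, and the cup product, $(x\cdot y)(a_1,\dots,a_{p+q})=x(a_1,\dots,a_p)\,y(a_{p+1},\dots,a_{p+q})$ for $|x|=p$, $|y|=q$. **Relative Hochschild complex.** $I_\Sigma$ is the unital algebra with basis the pairs $(\sigma,\sigma')$, $\sigma\le\sigma'$ in $\Sigma$, with $(\sigma,\sigma')(\beta,\beta')=(\sigma,\beta')$ if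 $\sigma'=\beta$ and $0$ otherwise; $S_\Sigma$ is the subalgebra generated by the $(\sigma,\sigma)$. $C^n_{S_\Sigma}(I_\Sigma,I_\Sigma)$ is the space of $S_\Sigma$-bimodule morphisms $I_\Sigma^{\otimes_{S_\Sigma}n}\to I_\Sigma$ (with $I_\Sigma^{\otimes_{S_\Sigma}0}:=S_\Sigma$). It embeds in $C^n(I_\Sigma,I_\Sigma)$ by composition with the projection $I_\Sigma^{\otimes n}\to I_\Sigma^{\otimes_{S_\Sigma}n}$ (for $n=0$, by $f\mapsto f(1)$), and this embedding induces its BDGA structure. **Simplicial cochains.** $\hat\Sigma$ is the nerve of the poset $\Sigma$ (the barycentric subdivision): its $n$-simplices are the weakly increasing sequences $(\sigma_0\le\dots\le\sigma_n)$, with faces $d_i^n$ omitting $\sigma_i$. $C^n(\hat\Sigma)$ is the space of functions $\hat\Sigma_n\to\mathbb K$. Its BDGA structure is given by the simplicial coboundary $\delta f=\sum_{i=0}^{n+1}(-1)^if\circ d_i^{n+1}$ for $f\in C^n(\hat\Sigma)$; the cup product $(f\cdot g)(\sigma_0\le\dots\le\sigma_{p+q})=f(\sigma_0\le\dots\le\sigma_p)\,g(\sigma_p\le\dots\le\sigma_{p+q})$ for $f\in C^p(\hat\Sigma)$, $g\in C^q(\hat\Sigma)$; and the braces $$f\{f_1,\dots,f_r\}(\sigma_0\le\dots\le\sigma_m)=\sum(-1)^{\sum_{k=1}^r(b_k-b_k')b_k'}f(\sigma_0,\dots,\sigma_{b_1'},\sigma_{b_1},\sigma_{b_1+1},\dots,\sigma_{b_2'},\sigma_{b_2},\dots,\sigma_{b_r'},\sigma_{b_r},\dots,\sigma_m)\prod_{k=1}^rf_k(\sigma_{b_k'},\dots,\sigma_{b_k}),$$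 where $m=|f|+\sum_k(|f_k|-1)$ and the sum is over $0\le b_1'\le b_1\le b_2'\le\dots\le b_r'\le b_r\le m$ with $b_k-b_k'=|f_k|$ for all $k$ (the other terms vanish for degree reasons). **The map $\iota$.** For $f\in C^n(\hat\Sigma)$, $\iota(f)((\sigma_0,\sigma_1)\otimes_{S_\Sigma}\cdots\otimes_{S_\Sigma}(\sigma_{n-1},\sigma_n))=f(\sigma_0\le\dots\le\sigma_n)\cdot(\sigma_0,\sigma_n)$, and for $n=0$, $\iota(f)((\sigma,\sigma))=f(\sigma)\cdot(\sigma,\sigma)$.
   Formalization: The simplicial brace sign uses (b_k−b'_k−1)b'_k instead of (b_k−b'_k)b'_k, and the BDGA axioms are asserted after multiplying δv by (−1)^(|v|+1) and v·w by (−1)^(|v||w|); with the printed signs the claim fails in characteristic ≠ 2. *)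

(* Defs.v *)
From HB Require Import structures.
From mathcomp Require Import all_boot all_order all_algebra.
(* [functions] provides the pointwise module structure on function types. *)
From mathcomp Require Import boolp functions.

Set Implicit Arguments.
Unset Strict Implicit.
Unset Printing Implicit Defensive.

Import GRing.Theory.
Local Open Scope ring_scope.

(* The entries w_{p+1}, ..., w_q of w = (w_1, ..., w_n). *)
Definition slice (T : Type) (w : seq T) (p q : nat) : seq T := drop p (take q w).

(* j_{k-1} when the j's are numbered from 0, and 0 for k = 0. *)
Definition prev_cut (j : nat -> nat) (k : nat) : nat :=
  if k is k'.+1 then j k' else 0%N.

(* The sum of F i j over 0 <= i_1 <= j_1 <= i_2 <= ... <= i_r <= j_r <= n; the
   cut points are passed to F as functions of k, numbered from 0. *)
Definition sum_cuts (V : nmodType) (r n : nat)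
    (F : (nat -> nat) -> (nat -> nat) -> V) : V :=
  \sum_(t : r.*2.-tuple 'I_n.+1 | sorted leq [seq val x | x <- t])
    F (fun k => nth 0%N [seq val x | x <- t] k.*2)
      (fun k => nth 0%N [seq val x | x <- t] k.*2.+1).

(* w_1,..,w_{i_1}, b_1, w_{j_1+1},..,w_{i_2}, b_2, ..., b_r, w_{j_r+1},..,w_n *)
Definition splice (T : Type) (w : seq T) (r : nat) (i j : nat -> nat)
    (b : nat -> T) : seq T :=
  flatten [seq rcons (slice w (prev_cut j k) (i k)) (b k) | k <- iota 0 r]
  ++ drop (prev_cut j r) w.

Definition sgn (K : fieldType) (n : int) : K := (-1) ^ n.

(* A graded vector space is given by subspaces A^n of an ambient module (their
   relative position in it is irrelevant).  Homogeneous elements are pairs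
   (degree, vector), and the operations are only meaningful on such pairs with
   the vector in the corresponding A^n. *)
Record bdga_data (K : fieldType) := BDGAData {
  ambient :> lmodType K;
  graded : int -> ambient -> Prop;
  dif : int * ambient -> ambient;
  mul : int * ambient -> int * ambient -> ambient;
  brace : int * ambient -> seq (int * ambient) -> ambient
}.

Section BDGA.
Variables (K : fieldType) (X : bdga_data K).
Implicit Types (v w : int * X) (vs ws : seq (int * X)).

Definition homog v : Prop := graded v.1 v.2.
Definition all_homog vs : Prop := forall v, v \in vs -> homog v.

Definition sdeg vs : int := \sum_(v <- vs) (v.1 - 1).

Definition hdif v : int * X := (v.1 + 1, dif v).
Definition hmul v w : int * X := (v.1 + w.1, mul v w).
Definition hbrace v vs : int * X := (v.1 + sdeg vs, brace v vs).

(* Entries are numbered from 0, so that for instance the exponent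
   |v| + |v_1| + ... + |v_{i-1}| - i + 1 reads v.1 + sdeg (take k vs) with
   k = i - 1. *)
Record is_bdga : Prop := IsBDGA {
  graded0 : forall n : int, @graded K X n 0;
  gradedP : forall (n : int) (k : K) (x y : X),
    graded n x -> graded n y -> graded n (k *: x + y);
  dif_homog : forall v, homog v -> homog (hdif v);
  dif_linear : forall (n : int) (k : K) (x y : X), graded n x -> graded n y ->
    dif (n, k *: x + y) = k *: dif (n, x) + dif (n, y);
  dif_dif : forall v, homog v -> dif (hdif v) = 0;
  mul_homog : forall v w, homog v -> homog w -> homog (hmul v w);
  mul_linearl : forall (n : int) (k : K) (x y : X) w,
    graded n x -> graded n y -> homog w ->
    mul (n, k *: x + y) w = k *: mul (n, x) w + mul (n, y) w;
  mul_linearr : forall v (n : int) (k : K) (x y : X),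
    homog v -> graded n x -> graded n y ->
    mul v (n, k *: x + y) = k *: mul v (n, x) + mul v (n, y);
  mul_assoc : forall u v w, homog u -> homog v -> homog w ->
    mul (hmul u v) w = mul u (hmul v w);
  dif_mul : forall v w, homog v -> homog w ->
    dif (hmul v w) = mul (hdif v) w + sgn K v.1 *: mul v (hdif w);
  brace_homog : forall v vs, homog v -> all_homog vs -> homog (hbrace v vs);
  brace_linearl : forall (n : int) (k : K) (x y : X) vs,
    graded n x -> graded n y -> all_homog vs ->
    brace (n, k *: x + y) vs = k *: brace (n, x) vs + brace (n, y) vs;
  brace_linearr : forall v us (n : int) (k : K) (x y : X) ws,
    homog v -> all_homog us -> graded n x -> graded n y -> all_homog ws ->
    brace v (us ++ (n, k *: x + y) :: ws)
    = k *: brace v (us ++ (n, x) :: ws) + brace v (us ++ (n, y) :: ws);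
  brace_nil : forall v, homog v -> brace v [::] = v.2;
  brace_brace : forall v vs ws, homog v -> all_homog vs -> all_homog ws ->
    brace (hbrace v vs) ws
    = sum_cuts (size vs) (size ws) (fun i j =>
        sgn K (\sum_(k < size vs) ((vs`_k).1 - 1) * sdeg (take (i k) ws))
        *: brace v (splice ws (size vs) i j
                      (fun k => hbrace vs`_k (slice ws (i k) (j k)))));
  brace_mul : forall v w vs, homog v -> homog w -> all_homog vs ->
    brace (hmul v w) vs
    = \sum_(k < (size vs).+1)
        sgn K (w.1 * sdeg (take k vs))
        *: mul (hbrace v (take k vs)) (hbrace w (drop k vs));
  brace_dif : forall v vs, homog v -> all_homog vs -> (0 < size vs)%N ->
    dif (hbrace v vs) - brace (hdif v) vs
    + \sum_(k < size vs)
        sgn K (v.1 + sdeg (take k vs))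
        *: brace v (take k vs ++ hdif vs`_k :: drop k.+1 vs)
    = sgn K (v.1 * ((vs`_0).1 - 1)) *: mul vs`_0 (hbrace v (behead vs))
      - \sum_(k < (size vs).-1)
          sgn K (v.1 + sdeg (take k.+1 vs) - 1)
          *: brace v (take k vs ++ hmul vs`_k vs`_k.+1 :: drop k.+2 vs)
      + sgn K (v.1 + sdeg (take (size vs).-1 vs) - 1)
        *: mul (hbrace v (take (size vs).-1 vs)) vs`_(size vs).-1
}.

(* The Hochschild coboundary and the cup product satisfy the brace identities
   above only after multiplication by (-1)^(|v|+1), resp. (-1)^(|v||w|)
   (Gerstenhaber-Voronov).  As these signs depend on degrees only, passing from
   X to [normalize] changes neither the morphisms nor the cohomology. *)
Definition normalize : bdga_data K :=
  @BDGAData K X (@graded K X)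
    (fun v => sgn K (v.1 + 1) *: dif v)
    (fun v w => sgn K (v.1 * w.1) *: mul v w)
    (@brace K X).

Definition cocycle (n : int) (x : X) : Prop := graded n x /\ dif (n, x) = 0.

Definition coboundary (n : int) (x : X) : Prop :=
  exists2 y : X, graded (n - 1) y & x = dif (n - 1, y).

Definition coh_class (n : int) (z : X) : X -> Prop :=
  fun x => cocycle n x /\ coboundary n (x - z).

(* H^n(X), as the set of cohomology classes. *)
Definition cohomology (n : int) : Type :=
  {c : X -> Prop | exists2 z : X, cocycle n z & c = coh_class n z}.

End BDGA.

Section Morphisms.
Variables (K : fieldType) (X Y : bdga_data K).

Definition on_vec (f : X -> Y) (v : int * X) : int * Y := (v.1, f v.2).

Record bdga_morphism (f : X -> Y) : Prop := BDGAMorphism {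
  morph_graded : forall (n : int) x, graded n x -> graded n (f x);
  morph_linear : forall (n : int) (k : K) x y, graded n x -> graded n y ->
    f (k *: x + y) = k *: f x + f y;
  morph_dif : forall v, homog v -> f (dif v) = dif (on_vec f v);
  morph_mul : forall v w, homog v -> homog w ->
    f (mul v w) = mul (on_vec f v) (on_vec f w);
  morph_brace : forall v vs, homog v -> all_homog vs ->
    f (brace v vs) = brace (on_vec f v) [seq on_vec f w | w <- vs]
}.

(* f is a chain map inducing isomorphisms H^n(X) -> H^n(Y), [z] |-> [f z]. *)
Definition quasi_iso (f : X -> Y) : Prop :=
  [/\ forall (n : int) x, graded n x -> graded n (f x),
      forall v, homog v -> f (dif v) = dif (on_vec f v)
    & forall n : int, exists2 phi : cohomology X n -> cohomology Y n,
        bijective phi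
      & forall (c : cohomology X n) z,
          cocycle n z -> sval c = coh_class n z ->
          sval (phi c) = coh_class n (f z)].

End Morphisms.

Definition bdga_iso (K : fieldType) (X Y : bdga_data K) (f : X -> Y) : Prop :=
  bdga_morphism f /\
  exists2 g : Y -> X, bdga_morphism g &
    (forall (n : int) x, graded n x -> g (f x) = x) /\
    (forall (n : int) y, graded n y -> f (g y) = y).

Definition simplicial_complex (T : finType) (Sigma : {set {set T}}) : Prop :=
  forall s t : {set T}, s \in Sigma -> t \subset s -> t != set0 -> t \in Sigma.

Section Complex.
Variables (K : fieldType) (T : finType) (Sigma : {set {set T}}).

Definition face : Type := {s : {set T} | s \in Sigma}.
HB.instance Definition _ := Finite.on face.

Definition face_le : rel face := fun s t => val s \subset val t.

Lemma face_le_refl : reflexive face_le.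
Proof. by move=> s; apply: subxx. Qed.

Lemma face_le_trans : transitive face_le.
Proof. by move=> t s u; apply: subset_trans. Qed.

Definition interval : Type := {p : face * face | face_le p.1 p.2}.
HB.instance Definition _ := Finite.on interval.

Definition incidence : Type := {ffun interval -> K^o}.
HB.instance Definition _ := GRing.Lmodule.on incidence.

(* The coefficient of x on (s, t), extended by 0 when s is not below t. *)
Definition coef (x : incidence) (s t : face) : K :=
  if insub (s, t) is Some p then x p else 0.

(* The basis element (s, t); it is 0 when s is not below t. *)
Definition basis_elt (s t : face) : incidence :=
  [ffun p : interval => (val p == (s, t))%:R].

Definition inc_one : incidence := \sum_(s : face) basis_elt s s.

Definition inc_mul (x y : incidence) : incidence :=
  [ffun p : interval => \sum_(u : face) coef x (val p).1 u * coef y u (val p).2].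

Lemma coefE (x : incidence) (p : interval) : x p = coef x (val p).1 (val p).2.
Proof. by rewrite /coef -surjective_pairing valK. Qed.

Lemma coef_out (x : incidence) s t : ~~ face_le s t -> coef x s t = 0.
Proof. by move=> st; rewrite /coef insubF //; apply: negbTE. Qed.

Lemma incidenceP (x y : incidence) :
  (forall s t, face_le s t -> coef x s t = coef y s t) -> x = y.
Proof. by move=> xy; apply/ffunP => p; rewrite !coefE xy // (valP p). Qed.

Lemma coef_ffun (F : face -> face -> K) s t : face_le s t ->
  coef [ffun p : interval => F (val p).1 (val p).2] s t = F s t.
Proof. by move=> st; rewrite /coef insubT ffunE. Qed.

Lemma coefD (x y : incidence) s t : coef (x + y) s t = coef x s t + coef y s t.
Proof. by rewrite /coef; case: insub => [p|]; rewrite ?ffunE ?addr0. Qed.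

Lemma coefZ k (x : incidence) s t : coef (k *: x) s t = k * coef x s t.
Proof. by rewrite /coef; case: insub => [p|]; rewrite ?ffunE ?mulr0. Qed.

Lemma coef0 s t : coef 0 s t = 0.
Proof. by rewrite /coef; case: insub => [p|]; rewrite ?ffunE. Qed.

Lemma coef_basis s t u v :
  coef (basis_elt s t) u v = ((u == s) && (v == t) && face_le s t)%:R.
Proof.
have [uv|uv] := boolP (face_le u v).
  rewrite /coef insubT ffunE /= xpair_eqE.
  by case: eqP => // <-; case: eqP => // <-; rewrite uv.
rewrite coef_out //; case: eqP => // us; case: eqP => // vt.
by rewrite -us -vt (negbTE uv).
Qed.

Lemma coef_one s t : coef inc_one s t = (s == t)%:R.
Proof.
have -> : coef inc_one s t = \sum_u coef (basis_elt u u) s t.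
  by apply: (big_morph (fun x => coef x s t)) => [x y|]; rewrite ?coefD ?coef0.
rewrite (bigD1 s) //= big1 => [|u us].
  by rewrite coef_basis eqxx face_le_refl andbT addr0 eq_sym.
by rewrite coef_basis eq_sym (negbTE us).
Qed.

Lemma coef_mul x y s t : coef (inc_mul x y) s t = \sum_u coef x s u * coef y u t.
Proof.
have [st|st] := boolP (face_le s t).
  exact: (coef_ffun (fun s t => \sum_u coef x s u * coef y u t)).
rewrite coef_out // big1 // => u _.
have [su|su] := boolP (face_le s u); last by rewrite coef_out ?mul0r.
rewrite (@coef_out y) ?mulr0 //; apply: contra st; exact: face_le_trans.
Qed.

Lemma inc_mulA : associative inc_mul.
Proof.
move=> x y z; apply: incidenceP => s t _; rewrite !coef_mul.
under eq_bigr => u _ do rewrite coef_mul mulr_sumr.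
rewrite exchange_big; apply: eq_bigr => v _.
rewrite coef_mul mulr_suml; apply: eq_bigr => u _; exact: mulrA.
Qed.

Lemma inc_mul1 : left_id inc_one inc_mul.
Proof.
move=> x; apply: incidenceP => s t _; rewrite coef_mul (bigD1 s) //= coef_one.
rewrite eqxx mul1r big1 ?addr0 // => u us.
by rewrite coef_one eq_sym (negbTE us) mul0r.
Qed.

Lemma inc_mulr1 : right_id inc_one inc_mul.
Proof.
move=> x; apply: incidenceP => s t _; rewrite coef_mul (bigD1 t) //= coef_one.
by rewrite eqxx mulr1 big1 ?addr0 // => u ut; rewrite coef_one (negbTE ut) mulr0.
Qed.

Lemma inc_mulDl : left_distributive inc_mul +%R.
Proof.
move=> x y z; apply: incidenceP => s t _; rewrite coefD !coef_mul -big_split.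
by apply: eq_bigr => u _; rewrite coefD mulrDl.
Qed.

Lemma inc_mulDr : right_distributive inc_mul +%R.
Proof.
move=> x y z; apply: incidenceP => s t _; rewrite coefD !coef_mul -big_split.
by apply: eq_bigr => u _; rewrite coefD mulrDr.
Qed.

(* MathComp's [algType] excludes the zero ring, which is the incidence algebra
   of the empty complex; the compatibility with scalars is therefore given by
   the two lemmas below instead of an instance. *)
HB.instance Definition _ := GRing.Zmodule_isPzRing.Build incidence
  inc_mulA inc_mul1 inc_mulr1 inc_mulDl inc_mulDr.

Lemma inc_scaleAl (k : K) (x y : incidence) : k *: (x * y) = (k *: x) * y.
Proof.
apply: incidenceP => s t _; rewrite coefZ !coef_mul mulr_sumr.
by apply: eq_bigr => u _; rewrite coefZ mulrA.
Qed.

Lemma inc_scaleAr (k : K) (x y : incidence) : k *: (x * y) = x * (k *: y).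
Proof.
apply: incidenceP => s t _; rewrite coefZ !coef_mul mulr_sumr.
by apply: eq_bigr => u _; rewrite coefZ mulrCA.
Qed.

Lemma basis_elt_mul s s' t t' : face_le s s' -> face_le t t' ->
  basis_elt s s' * basis_elt t t' = if s' == t then basis_elt s t' else 0.
Proof.
move=> ss' tt'; apply: incidenceP => u v _; rewrite coef_mul (bigD1 t) //=.
rewrite big1 => [|w wt]; last by rewrite (coef_basis t) (negbTE wt) mulr0.
rewrite !coef_basis eqxx ss' tt' !andbT addr0 [t == s']eq_sym.
have [e|_] := eqVneq s' t; last by rewrite andbF mul0r coef0.
rewrite coef_basis (face_le_trans ss') ?e // !andbT.
by case: (u == s); case: (v == t'); rewrite ?mulr1 ?mulr0.
Qed.

End Complex.

Arguments basis_elt K {T Sigma} s t.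

Section Hochschild.
Variables (K : fieldType) (T : finType) (Sigma : {set {set T}}).
Local Notation A := (incidence K Sigma).

(* An n-cochain is a multilinear map A^n -> A, encoded as a function on all
   sequences that vanishes on those whose length is not n. *)
Definition hoch_graded (n : int) (x : seq A -> A) : Prop :=
  (forall a, (size a)%:Z <> n -> x a = 0) /\
  (forall l r (k : K) (b c : A),
    x (l ++ (k *: b + c) :: r) = k *: x (l ++ b :: r) + x (l ++ c :: r)).

Definition hoch_dif (x : int * (seq A -> A)) : seq A -> A := fun a =>
  let n := `|x.1|%N in
  if (size a)%:Z == x.1 + 1 then
    a`_0 * x.2 (behead a)
    + \sum_(1 <= i < n.+1)
        (-1) ^+ i *: x.2 (take i.-1 a ++ a`_i.-1 * a`_i :: drop i.+1 a)
    + (-1) ^+ n.+1 *: (x.2 (take n a) * a`_n)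
  else 0.

Definition hoch_mul (x y : int * (seq A -> A)) : seq A -> A := fun a =>
  if (size a)%:Z == x.1 + y.1 then
    x.2 (take `|x.1|%N a) * y.2 (drop `|x.1|%N a)
  else 0.

Definition hoch_brace (x : int * (seq A -> A)) (xs : seq (int * (seq A -> A))) :
    seq A -> A := fun a =>
  if (size a)%:Z == x.1 + \sum_(y <- xs) (y.1 - 1) then
    sum_cuts (size xs) (size a) (fun i j =>
      if [forall k : 'I_(size xs), (j k)%:Z == (i k)%:Z + (xs`_k).1] then
        sgn K (\sum_(k < size xs) (i k)%:Z * ((xs`_k).1 - 1))
        *: x.2 (splice a (size xs) i j
                  (fun k => (xs`_k).2 (slice a (i k) (j k))))
      else 0)
  else 0.

Definition hochschild : bdga_data K :=
  @BDGAData K (seq A -> A) hoch_graded hoch_dif hoch_mul hoch_brace.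

(* S_Sigma: the smallest subalgebra containing the (s, s). *)
Definition in_S (x : A) : Prop :=
  forall P : A -> Prop,
    P 1 ->
    (forall (k : K) u v, P u -> P v -> P (k *: u + v)) ->
    (forall u v, P u -> P v -> P (u * v)) ->
    (forall s : face Sigma, P (basis_elt K s s)) ->
    P x.

Lemma in_S1 : in_S 1.
Proof. by move=> P. Qed.

Definition bimodule_morphism (g : {s : A | in_S s} -> A) : Prop :=
  (forall (k : K) r s t, sval r = k *: sval s + sval t -> g r = k *: g s + g t) /\
  (forall r s t, sval r = sval s * sval t ->
     g r = sval s * g t /\ g r = g s * sval t).

(* Multilinear maps on A^n satisfying this are the S-bimodule morphisms out of
   the n-fold tensor product of A over S, for n >= 1. *)
Definition bimodule_balanced (x : seq A -> A) : Prop :=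
  [/\ forall s b r, in_S s -> x (s * b :: r) = s * x (b :: r),
      forall s l b, in_S s -> x (rcons l (b * s)) = x (rcons l b) * s
    & forall s l b c r, in_S s -> x (l ++ b * s :: c :: r) = x (l ++ b :: s * c :: r)].

(* Degree 0 cochains (bimodule morphisms S -> A) live in the first component,
   positive degree cochains in the second one. *)
Definition rel_ambient : Type := (({s : A | in_S s} -> A) * (seq A -> A))%type.
HB.instance Definition _ := GRing.Lmodule.on rel_ambient.

Definition rel_graded (n : int) (x : rel_ambient) : Prop :=
  if n == 0 then bimodule_morphism x.1 /\ x.2 = 0
  else [/\ x.1 = 0, hoch_graded n x.2 & bimodule_balanced x.2].

Definition rel_embed (x : rel_ambient) : seq A -> A := fun a =>
  if a is [::] then x.1 (exist _ 1 in_S1) else x.2 a.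

(* The inverse of [rel_embed] on its image, used to transport the operations. *)
Definition rel_lift (x : seq A -> A) : rel_ambient :=
  (fun s => sval s * x [::], fun a => if a is [::] then 0 else x a).

Definition rel_arg (x : int * rel_ambient) : int * (seq A -> A) :=
  (x.1, rel_embed x.2).

Definition relative_hochschild : bdga_data K :=
  @BDGAData K rel_ambient rel_graded
    (fun x => rel_lift (hoch_dif (rel_arg x)))
    (fun x y => rel_lift (hoch_mul (rel_arg x) (rel_arg y)))
    (fun x xs => rel_lift (hoch_brace (rel_arg x) [seq rel_arg y | y <- xs])).

End Hochschild.

Section Simplicial.
Variables (K : fieldType) (T : finType) (Sigma : {set {set T}}).
Local Notation face := (face Sigma).

(* n-simplices of the nerve are weakly increasing sequences of n+1 faces. *)
Definition simplex (c : seq face) : bool := (0 < size c)%N && sorted (@face_le T Sigma) c.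

(* An n-cochain is encoded as a function on all sequences of faces that
   vanishes on those which are not n-simplices. *)
Definition simp_graded (n : int) (f : seq face -> K^o) : Prop :=
  forall c, ~~ (simplex c && ((size c)%:Z == n + 1)) -> f c = 0.

Definition simp_dif (f : int * (seq face -> K^o)) : seq face -> K^o := fun c =>
  if simplex c && ((size c)%:Z == f.1 + 2) then
    \sum_(i < size c) (-1) ^+ i * f.2 (take i c ++ drop i.+1 c)
  else 0.

Definition simp_mul (f g : int * (seq face -> K^o)) : seq face -> K^o := fun c =>
  if simplex c && ((size c)%:Z == f.1 + g.1 + 1) then
    f.2 (take `|f.1|%N.+1 c) * g.2 (drop `|f.1|%N c)
  else 0.

(* Here i k and j k are b'_k and b_k.  The sign exponent is
   (b_k - b'_k - 1) b'_k = (|f_k| - 1) b'_k, as for the Hochschild braces; with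
   (b_k - b'_k) b'_k the first brace identity would fail. *)
Definition simp_brace (f : int * (seq face -> K^o))
    (fs : seq (int * (seq face -> K^o))) : seq face -> K^o := fun c =>
  if simplex c && ((size c)%:Z == f.1 + \sum_(g <- fs) (g.1 - 1) + 1) then
    sum_cuts (size fs) (size c).-1 (fun i j =>
      if [forall k : 'I_(size fs), (j k)%:Z - (i k)%:Z == (fs`_k).1] then
        sgn K (\sum_(k < size fs) ((j k)%:Z - (i k)%:Z - 1) * (i k)%:Z)
        * f.2 (flatten [seq slice c (prev_cut j k) (i k).+1
                         | k <- iota 0 (size fs)]
               ++ drop (prev_cut j (size fs)) c)
        * \prod_(k < size fs) (fs`_k).2 (slice c (i k) (j k).+1)
      else 0)
  else 0.

Definition simplicial_cochains : bdga_data K :=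
  @BDGAData K (seq face -> K^o) simp_graded simp_dif simp_mul simp_brace.

(* The second component is the multilinear extension of the prescribed values
   on tensors of basis elements (s_0, s_1), ..., (s_(n-1), s_n), n = size a. *)
Definition iota_map (f : simplicial_cochains) : relative_hochschild K Sigma :=
  (fun x => \sum_(s : face) (f [:: s] * coef (sval x) s s) *: basis_elt K s s,
   fun a => if a is [::] then 0 else
     \sum_(s : face) \sum_(p : (size a).-tuple face | path (@face_le T Sigma) s p)
       (f (s :: p) * \prod_(z <- zip a (zip (s :: p) p)) coef z.1 z.2.1 z.2.2)
       *: basis_elt K s (last s p)).

End Simplicial.

(* Main.v *)
Require Import Defs.
From mathcomp Require Import all_boot all_order all_algebra.
From mathcomp Require Import boolp functions.
From mathcomp Require Import zify ring.

Set Implicit Arguments.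
Unset Strict Implicit.
Unset Printing Implicit Defensive.

Import GRing.Theory.
Local Open Scope ring_scope.

(** Everything follows from two facts about inserting operations into words.
    Let a letter have degree -1 and an n-cochain degree n - 1.  The brace
    x{x_1, ..., x_r} evaluated at a word a is x applied to the sum of all words
    obtained from a by replacing r disjoint consecutive factors, in order, by
    their images under x_1, ..., x_r; all signs are then Koszul signs
    ([insert], [hoch_braceE]).  Insertion is compatible with deconcatenation of
    words ([insert_comult]), and inserting ws and then vs is the same as
    inserting the words obtained by inserting ws, as letters, into the factors
    of the word vs ([insert_comp]).  The first fact is the identity for the
    brace of a product, the second one is the identity for an iterated brace.

    Let mu be the multiplication, viewed as a 2-cochain.  Up to signs the
    product of x and y is mu{x, y} and the differential of x is
    mu{x} + x{mu}.  The remaining identities of Hochschild cochains are thus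
    consequences of the two facts above, mu{v_1, ..., v_r} = 0 for r > 2, and
    associativity ([hochschild_brace_dif], [hochschild_is_bdga]).

    A simplicial cochain f extends to a multilinear cochain on the incidence
    algebra: the coefficient on (s, t) of its value at (a_1, ..., a_n) is the
    sum of f over the paths of faces from s to t, weighted by the product of
    the coefficients of the a_i on the steps ([cochain_ext]).  Since the
    coefficients of a product are themselves sums over paths, sums over paths
    turn concatenation of words into concatenation of paths, and the extension
    commutes with all operations ([ext_morphism]).  It is injective because
    f(s_0, ..., s_n) is a coefficient of its value at the basis elements
    (s_0, s_1), ..., (s_(n-1), s_n) ([coef_ext_chain]).  A cochain balanced
    over the span S of the idempotents (s, s) is the extension of its values on
    such chains of basis elements: in a product over S, the only nonzero
    monomials in basis elements are these chains ([ext_chain_values_rel]).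
    Hence the extension factors as iota, which is bijective, followed by the
    embedding of the relative complex ([iotaE]), and both complexes inherit the
    identities of Hochschild cochains ([pullback_bdga]).

    Restriction to chains of basis elements is a retraction of the extension
    ([chain_values]).  The composite in the other order is homotopic to the
    identity through a prism operator, which replaces more and more letters of
    a word, starting from the right, by basis elements ([prism_homotopy]).  The
    coboundary squares to zero, so the homotopy identity also shows that this
    composite commutes with the coboundary; the extension being injective, so
    does the restriction ([chain_values_cochain_map]).  The embedding and its
    composite with iota are therefore quasi-isomorphisms. *)

(** * Signs *)

(** Signs depend on integer degrees only through their parity; [sgn_oddz] and
    [parity_tac] reduce every comparison of signs to a boolean identity. *)
Definition oddz (n : int) : bool := odd `|n|%N.

Lemma oddzD m n : oddz (m + n) = oddz m (+) oddz n.
Proof. rewrite /oddz; lia. Qed.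

Lemma oddzM m n : oddz (m * n) = oddz m && oddz n.
Proof. by rewrite /oddz abszM oddM. Qed.

Lemma oddzN n : oddz (- n) = oddz n.
Proof. by rewrite /oddz abszN. Qed.

Lemma oddz1 : oddz 1 = true.
Proof. by []. Qed.

Definition oddzE := (oddzD, oddzM, oddzN, oddz1).

Lemma sgn_oddz (K : fieldType) n : sgn K n = (-1) ^+ oddz n.
Proof.
rewrite /sgn /oddz; case: n => n; first by rewrite -exprnP signr_odd.
rewrite -[LHS]/((-1) ^- n.+1) signr_odd.
by rewrite -exprVn invrN invr1.
Qed.

Lemma eq_sgn (K : fieldType) m n : oddz m = oddz n -> sgn K m = sgn K n.
Proof. by rewrite !sgn_oddz => ->. Qed.

Lemma sgnD (K : fieldType) m n : sgn K (m + n) = sgn K m * sgn K n.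
Proof. by rewrite !sgn_oddz oddzD signr_addb. Qed.

Lemma sgn0 (K : fieldType) : sgn K 0 = 1.
Proof. by []. Qed.

Lemma sgn_sq (K : fieldType) m : sgn K m * sgn K m = 1.
Proof. by rewrite -sgnD -[RHS](sgn0 K); apply: eq_sgn; rewrite oddzD addbb. Qed.

Ltac parity_tac :=
  rewrite ?oddzE; repeat match goal with
  | |- context [oddz ?x] => case: (oddz x)
  | |- context [odd ?x] => case: (odd x)
  end; by [].

(** * Sums over the decompositions of a word *)

Section CutSum.
Variable T : Type.

(** The pairing of H with the deconcatenation coproduct of the word a.  The
    recursive form makes the inductions on words structural. *)
Fixpoint cutsum (V : nmodType) (a : seq T) (H : seq T -> seq T -> V) : V :=
  H [::] a + if a is b :: a' then cutsum a' (fun l r => H (b :: l) r) else 0.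

Lemma cutsumE (V : nmodType) a (H : seq T -> seq T -> V) :
  cutsum a H = \sum_(k < (size a).+1) H (take k a) (drop k a).
Proof.
elim: a H => [|b a IH] H /=; first by rewrite big_ord_recl big_ord0.
by rewrite big_ord_recl IH take0 drop0.
Qed.

Lemma eq_cutsum (V : nmodType) a (H H' : seq T -> seq T -> V) :
  (forall l r, a = l ++ r -> H l r = H' l r) -> cutsum a H = cutsum a H'.
Proof.
by move=> eqH; rewrite !cutsumE; apply: eq_bigr => k _; apply: eqH; rewrite cat_take_drop.
Qed.

Lemma cutsum0 (V : nmodType) a : cutsum a (fun _ _ => 0 : V) = 0.
Proof. by rewrite cutsumE big1. Qed.

Lemma cutsumD (V : nmodType) a (H H' : seq T -> seq T -> V) :
  cutsum a (fun l r => H l r + H' l r) = cutsum a H + cutsum a H'.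
Proof. by rewrite !cutsumE big_split. Qed.

Lemma cutsumZ (K : fieldType) (V : lmodType K) k a (H : seq T -> seq T -> V) :
  cutsum a (fun l r => k *: H l r) = k *: cutsum a H.
Proof. by rewrite !cutsumE scaler_sumr. Qed.

Lemma cutsum_sum (V : nmodType) (I : Type) (s : seq I) (P : pred I) a
    (H : I -> seq T -> seq T -> V) :
  cutsum a (fun l r => \sum_(i <- s | P i) H i l r)
  = \sum_(i <- s | P i) cutsum a (H i).
Proof.
rewrite cutsumE exchange_big; apply: eq_bigr => i _; by rewrite cutsumE.
Qed.

(** Coassociativity of deconcatenation. *)
Lemma cutsum_cut (V : nmodType) a (H : seq T -> seq T -> seq T -> V) :
  cutsum a (fun l r => cutsum r (H l))
  = cutsum a (fun l r => cutsum l (fun p q => H p q r)).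
Proof.
elim: a H => [|b a IH] H //=.
by rewrite addr0 cutsumD (IH (fun l => H (b :: l))) !addrA.
Qed.

(** Coassociativity for cuts into four factors. *)
Lemma cutsum_cut3 (V : nmodType) a (X : seq T -> seq T -> seq T -> seq T -> V) :
  cutsum a (fun d0 d1 => cutsum d0 (fun a0 r => cutsum r (fun a1 c0 => X a0 a1 c0 d1)))
  = cutsum a (fun a0 r => cutsum r (fun a1 s => cutsum s (fun c0 d1 => X a0 a1 c0 d1))).
Proof.
rewrite -(cutsum_cut a (fun p q r => cutsum q (fun a1 c0 => X p a1 c0 r))).
by apply: eq_cutsum => a0 r _; rewrite (cutsum_cut r (X a0)).
Qed.

(** A cut of l ++ y :: r lies either before or after the letter y. *)
Lemma cutsum_cat (V : nmodType) l y r (H : seq T -> seq T -> V) :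
  cutsum (l ++ y :: r) H
  = cutsum l (fun p q => H p (q ++ y :: r)) + cutsum r (fun p q => H (l ++ y :: p) q).
Proof. by elim: l H => [|b l IH] H /=; rewrite ?addr0 // IH addrA. Qed.

Lemma cutsum_rcons (V : nmodType) l y (H : seq T -> seq T -> V) :
  cutsum (rcons l y) H = cutsum l (fun p q => H p (rcons q y)) + H (rcons l y) [::].
Proof.
rewrite -cats1 cutsum_cat /= addr0; congr (_ + _).
by apply: eq_cutsum => p q _; rewrite cats1.
Qed.

End CutSum.

Lemma cutsum_first (T : Type) (V : nmodType) (a : seq T) (H : seq T -> seq T -> V) :
  (forall b p q, H (b :: p) q = 0) -> cutsum a H = H [::] a.
Proof.
move=> H0; case: a => [|b a] /=; rewrite ?addr0 // -[RHS]addr0; congr (_ + _).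
by rewrite -[RHS](cutsum0 V a); apply: eq_cutsum => l r _; apply: H0.
Qed.

Lemma cutsum_last (T : Type) (V : nmodType) (a : seq T) (H : seq T -> seq T -> V) :
  (forall b p q, H p (b :: q) = 0) -> cutsum a H = H a [::].
Proof.
move=> H0; elim: a H H0 => [|b a IH] H H0 /=; first by rewrite addr0.
by rewrite H0 add0r IH.
Qed.

Lemma cutsum_size (T : Type) (V : nmodType) (a : seq T) n (H : seq T -> seq T -> V) :
  (forall p q, size p != n -> H p q = 0) ->
  cutsum a H = if (n <= size a)%N then H (take n a) (drop n a) else 0.
Proof.
move=> H0; rewrite cutsumE; case: leqP => na.
  rewrite (bigD1 (Ordinal (na : (n < (size a).+1)%N))) //= big1 ?addr0 // => i.
  rewrite -val_eqE /= => ni; rewrite H0 // size_takel //; by rewrite -ltnS.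
apply: big1 => i _; rewrite H0 // size_takel; last by rewrite -ltnS.
by have := ltn_ord i; lia.
Qed.

Lemma cutsum_pick (T : Type) (V : nmodType) (a : seq T) x0 (H : seq T -> T -> seq T -> V) :
  cutsum a (fun l r => if r is x :: r' then H l x r' else 0)
  = \sum_(k < size a) H (take k a) (nth x0 a k) (drop k.+1 a).
Proof.
elim: a H => [|x a IH] H /=; first by rewrite big_ord0 addr0.
by rewrite big_ord_recl /= drop0 (IH (fun l => H (x :: l))).
Qed.

Lemma cutsum_pick2 (T : Type) (V : nmodType) (a : seq T) x0
    (H : seq T -> T -> T -> seq T -> V) :
  cutsum a (fun l r => if r is x :: y :: r' then H l x y r' else 0)
  = \sum_(k < (size a).-1) H (take k a) (nth x0 a k) (nth x0 a k.+1) (drop k.+2 a).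
Proof.
elim: a H => [|x [|y a] IH] H; rewrite ?big_ord0 /= ?addr0 //.
by rewrite big_ord_recl /= drop0; congr (_ + _); apply: (IH (fun l => H (x :: l))).
Qed.

Lemma cutsum_exch (V : nmodType) S T (a : seq S) (b : seq T)
    (H : seq S -> seq S -> seq T -> seq T -> V) :
  cutsum a (fun l r => cutsum b (H l r))
  = cutsum b (fun p q => cutsum a (fun l r => H l r p q)).
Proof.
rewrite cutsumE; under eq_bigr do rewrite cutsumE.
by rewrite exchange_big cutsumE; apply: eq_bigr => k _; rewrite cutsumE.
Qed.

(** * Insertions into words *)

Definition weight (T : Type) (w : T -> int) (a : seq T) : int := \sum_(x <- a) w x.

Lemma weight_nil (T : Type) (w : T -> int) : weight w [::] = 0.
Proof. exact: big_nil. Qed.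

Lemma weight_cons (T : Type) (w : T -> int) x a : weight w (x :: a) = w x + weight w a.
Proof. exact: big_cons. Qed.

Lemma weight_cat (T : Type) (w : T -> int) a b : weight w (a ++ b) = weight w a + weight w b.
Proof. exact: big_cat. Qed.

Definition weightE := (weight_cat, weight_cons, weight_nil).

Lemma weight_const (T : Type) (c : int) (a : seq T) : weight (fun _ => c) a = c * (size a)%:Z.
Proof. by elim: a => [|x a IH]; rewrite !weightE ?mulr0 //= IH; lia. Qed.

Section Insertion.
Variables (K : fieldType) (E L : Type) (we : E -> int) (wl : L -> int).
Variables (ok : pred int) (act : E -> seq L -> L).

(** The Koszul rule gives the sign.  The operations xs start to the left of the
    word; x passes the factor a0, and the operations that follow x pass both a0
    and the factor a1 that x consumes.  The predicate [ok] on the degree of the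
    result selects the factors to which x applies. *)
Fixpoint insert (V : lmodType K) (xs : seq E) (a : seq L) (F : seq L -> V) : V :=
  if xs is x :: xs' then
    cutsum a (fun a0 r => cutsum r (fun a1 a2 =>
      if ok (we x + weight wl a1) then
        sgn K (weight wl a0 * (we x + weight we xs') + weight wl a1 * weight we xs')
        *: insert xs' a2 (fun l => F (a0 ++ act x a1 :: l))
      else 0))
  else F a.

Lemma eq_insert (V : lmodType K) xs a (F G : seq L -> V) :
  (forall b, F b = G b) -> insert xs a F = insert xs a G.
Proof. by move=> /funext->. Qed.

(** Insertion is a linear combination of words that depends neither on the
    function evaluated on these words nor on its codomain.  Linearity and the
    exchange with finite sums and with other insertions follow at once. *)
Lemma insert_terms xs a : exists ts : seq (K * seq L),
  forall (V : lmodType K) (F : seq L -> V), insert xs a F = \sum_(t <- ts) t.1 *: F t.2.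
Proof.
elim: xs a => [|x xs IH] a /=.
  by exists [:: (1, a)] => V F; rewrite big_seq1 scale1r.
have cut_terms (c : seq L) (P : seq L -> seq L -> seq (K * seq L)) :
    exists ts : seq (K * seq L), forall (V : lmodType K) (F : seq L -> V),
    cutsum c (fun l r => \sum_(t <- P l r) t.1 *: F t.2) = \sum_(t <- ts) t.1 *: F t.2.
  elim: c P => [|b c IHc] P /=; first by exists (P [::] [::]) => V F; rewrite addr0.
  have [ts tsE] := IHc (fun l r => P (b :: l) r).
  by exists (P [::] (b :: c) ++ ts) => V F; rewrite big_cat tsE.
have /choice [q qE] a0 : exists q : seq L -> seq L -> seq (K * seq L),
    forall a1 a2 (V : lmodType K) (F : seq L -> V),
    (if ok (we x + weight wl a1) then
        sgn K (weight wl a0 * (we x + weight we xs) + weight wl a1 * weight we xs)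
        *: insert xs a2 (fun l => F (a0 ++ act x a1 :: l)) else 0)
    = \sum_(t <- q a1 a2) t.1 *: F t.2.
  have /choice [ts tsE] a2 := IH a2.
  exists (fun a1 a2 => if ok (we x + weight wl a1) then
    [seq (sgn K (weight wl a0 * (we x + weight we xs) + weight wl a1 * weight we xs) * t.1,
          a0 ++ act x a1 :: t.2) | t <- ts a2] else [::]) => a1 a2 V F.
  case: ifP => _; last by rewrite big_nil.
  rewrite tsE big_map scaler_sumr; apply: eq_bigr => t _; by rewrite scalerA.
have /choice [q' q'E] a0 : exists q' : seq L -> seq (K * seq L),
    forall r (V : lmodType K) (F : seq L -> V),
    cutsum r (fun a1 a2 => \sum_(t <- q a0 a1 a2) t.1 *: F t.2)
    = \sum_(t <- q' r) t.1 *: F t.2.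
  have /choice [q' q'E] r := cut_terms r (q a0).
  by exists q'.
have [ts tsE] := cut_terms a q'.
exists ts => V F; rewrite -tsE; apply: eq_cutsum => a0 r _.
by rewrite -q'E; apply: eq_cutsum => a1 a2 _; exact: qE.
Qed.

Lemma insert_linearP (V : lmodType K) xs a k (F G : seq L -> V) :
  insert xs a (fun b => k *: F b + G b) = k *: insert xs a F + insert xs a G.
Proof.
have [ts tsE] := insert_terms xs a; rewrite !tsE scaler_sumr -big_split /=.
by apply: eq_bigr => t _; rewrite scalerDr !scalerA mulrC.
Qed.

Lemma insertZ (V : lmodType K) xs a k (F : seq L -> V) :
  insert xs a (fun b => k *: F b) = k *: insert xs a F.
Proof.
have [ts tsE] := insert_terms xs a; rewrite !tsE scaler_sumr.
by apply: eq_bigr => t _; rewrite !scalerA mulrC.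
Qed.

Lemma insert0 (V : lmodType K) xs a : insert xs a (fun _ => 0 : V) = 0.
Proof. by have [ts ->] := insert_terms xs a; rewrite big1 // => t _; rewrite scaler0. Qed.

Lemma insertD (V : lmodType K) xs a (F G : seq L -> V) :
  insert xs a (fun b => F b + G b) = insert xs a F + insert xs a G.
Proof.
rewrite -[X in _ = X + _]scale1r -insert_linearP; apply: eq_insert => b; by rewrite scale1r.
Qed.

Lemma insert_sum (V : lmodType K) (I : Type) (s : seq I) (P : pred I) xs a
    (F : I -> seq L -> V) :
  insert xs a (fun b => \sum_(i <- s | P i) F i b) = \sum_(i <- s | P i) insert xs a (F i).
Proof.
have [ts tsE] := insert_terms xs a; rewrite !tsE.
under eq_bigr do rewrite scaler_sumr.
by rewrite exchange_big; apply: eq_bigr => i _; rewrite tsE.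
Qed.

Lemma insert_cutsum (V : lmodType K) T xs a (c : seq T) (H : seq L -> seq T -> seq T -> V) :
  insert xs a (fun b => cutsum c (H b)) = cutsum c (fun l r => insert xs a (fun b => H b l r)).
Proof.
have [ts tsE] := insert_terms xs a; rewrite !tsE.
under eq_bigr do rewrite -cutsumZ.
by rewrite -cutsum_sum; apply: eq_cutsum => l r _; rewrite tsE.
Qed.

Lemma insert_if (V : lmodType K) xs a (c : bool) (F : seq L -> V) :
  insert xs a (fun b => if c then F b else 0) = if c then insert xs a F else 0.
Proof. by case: c => //; rewrite insert0. Qed.

(** The first operation either consumes a factor starting at the first letter or
    passes that letter. *)
Lemma insert_cons (V : lmodType K) x xs b a (F : seq L -> V) :
  insert (x :: xs) (b :: a) F
  = cutsum (b :: a) (fun a1 a2 => if ok (we x + weight wl a1) then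
      sgn K (weight wl a1 * weight we xs) *: insert xs a2 (fun l => F (act x a1 :: l)) else 0)
    + sgn K (wl b * (we x + weight we xs)) *: insert (x :: xs) a (fun l => F (b :: l)).
Proof.
pose G a0 r : V := cutsum r (fun a1 a2 => if ok (we x + weight wl a1) then
  sgn K (weight wl a0 * (we x + weight we xs) + weight wl a1 * weight we xs)
  *: insert xs a2 (fun l => F (a0 ++ act x a1 :: l)) else 0).
have -> : insert (x :: xs) (b :: a) F = G [::] (b :: a) + cutsum a (fun l r => G (b :: l) r).
  by [].
congr (_ + _); first by apply: eq_cutsum => a1 a2 _; rewrite weight_nil mul0r add0r.
rewrite -cutsumZ; apply: eq_cutsum => p q _.
rewrite -cutsumZ; apply: eq_cutsum => a1 a2 _; case: ifP => _; last by rewrite scaler0.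
by rewrite scalerA -sgnD weight_cons; congr (sgn K _ *: _); ring.
Qed.

Hypothesis act_wt : forall x a, ok (we x + weight wl a) -> wl (act x a) = we x + weight wl a.

(** Insertion preserves the total degree, so F only matters on words of that
    degree. *)
Lemma eq_insert_weight (V : lmodType K) xs a (F G : seq L -> V) :
  (forall b, weight wl b = weight we xs + weight wl a -> (size xs <= size b)%N -> F b = G b) ->
  insert xs a F = insert xs a G.
Proof.
elim: xs a F G => [|x xs IH] a F G eqFG /=.
  by rewrite eqFG ?weightE ?add0r.
apply: eq_cutsum => a0 r aE; apply: eq_cutsum => a1 a2 rE; case: ifP => // okx.
congr (_ *: _); apply: IH => b bE sz; apply: eqFG.
  by rewrite aE rE !weightE bE act_wt //; lia.
by rewrite size_cat /=; lia.
Qed.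

(** After the insertion, a cut of the word separates the inserted operations into
    an initial and a final part, and lifts to a cut of the original word, since
    it never falls inside a factor that an operation has consumed.  The sign
    comes from the operations w1 passing the letters a0. *)
Lemma insert_comult (V : lmodType K) ws a (H : seq L -> seq L -> V) :
  insert ws a (fun b => cutsum b H)
  = cutsum ws (fun w0 w1 => cutsum a (fun a0 a1 =>
      sgn K (weight wl a0 * weight we w1) *: insert w0 a0 (fun b0 => insert w1 a1 (H b0)))).
Proof.
elim: ws a H => [|w ws IH] a H /=.
  by rewrite addr0; apply: eq_cutsum => l r _; rewrite weightE mulr0 scale1r.
pose P1 a0 a1 a2 p q : V := if ok (we w + weight wl a1) then
  sgn K (weight wl a0 * (we w + weight we ws) + weight wl a1 * weight we ws)
  *: insert ws a2 (fun l => H p (q ++ act w a1 :: l)) else 0.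
pose P2 a0 a1 a2 : V := if ok (we w + weight wl a1) then
  sgn K (weight wl a0 * (we w + weight we ws) + weight wl a1 * weight we ws)
  *: insert ws a2 (fun l => cutsum l (fun p q => H (a0 ++ act w a1 :: p) q)) else 0.
transitivity (cutsum a (fun a0 r => cutsum r (fun a1 a2 => cutsum a0 (P1 a0 a1 a2)))
            + cutsum a (fun a0 r => cutsum r (fun a1 a2 => P2 a0 a1 a2))).
  rewrite -cutsumD; apply: eq_cutsum => a0 r _.
  rewrite -cutsumD; apply: eq_cutsum => a1 a2 _.
  rewrite /P1 /P2; case: ifP => _; last by rewrite cutsum0 addr0.
  rewrite cutsumZ -scalerDr; congr (_ *: _); rewrite -insert_cutsum -insertD.
  by apply: eq_insert => l; rewrite cutsum_cat.
congr (_ + _).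
  transitivity (cutsum a (fun p r => cutsum r (fun q r' =>
      cutsum r' (fun a1 a2 => P1 (p ++ q) a1 a2 p q)))).
    rewrite (cutsum_cut a (fun p q r => cutsum r (fun a1 a2 => P1 (p ++ q) a1 a2 p q))).
    apply: eq_cutsum => a0 r _; rewrite cutsum_exch.
    by apply: eq_cutsum => p q ->.
  apply: eq_cutsum => p r _; rewrite -cutsumZ.
  apply: eq_cutsum => q r' _; rewrite -cutsumZ.
  apply: eq_cutsum => a1 a2 _; rewrite /P1; case: ifP => _; last by rewrite scaler0.
  by rewrite scalerA -sgnD !weightE; congr (sgn K _ *: _); ring.
pose X w0 w1 a0 a1 c0 d1 : V := if ok (we w + weight wl a1) then
  sgn K (weight wl (a0 ++ a1 ++ c0) * weight we w1
         + (weight wl a0 * (we w + weight we w0) + weight wl a1 * weight we w0))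
  *: insert w0 c0 (fun l => insert w1 d1 (H (a0 ++ act w a1 :: l))) else 0.
transitivity (cutsum ws (fun w0 w1 => cutsum a (fun a0 r => cutsum r (fun a1 s =>
    cutsum s (fun c0 d1 => X w0 w1 a0 a1 c0 d1))))).
  rewrite cutsum_exch; apply: eq_cutsum => a0 r _.
  rewrite cutsum_exch; apply: eq_cutsum => a1 a2 _.
  rewrite /P2 /X; case: ifP => _; last first.
    by under [RHS]eq_cutsum do rewrite cutsum0; rewrite cutsum0.
  rewrite (IH a2 (fun p => H (a0 ++ act w a1 :: p))) -cutsumZ.
  apply: eq_cutsum => w0 w1 ->; rewrite -cutsumZ; apply: eq_cutsum => c0 d1 _.
  by rewrite scalerA -sgnD !weightE; congr (sgn K _ *: _); ring.
apply: eq_cutsum => w0 w1 _; rewrite -cutsum_cut3; apply: eq_cutsum => d0 d1 _.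
rewrite -cutsumZ; apply: eq_cutsum => a0 r d0E; rewrite -cutsumZ.
apply: eq_cutsum => a1 c0 rE; rewrite /X; case: ifP => _; last by rewrite scaler0.
by rewrite scalerA -sgnD d0E rE.
Qed.

(** The word is cut around the factor consumed by one chosen operation x; the
    operations before and after x act independently on the two sides. *)
Lemma insert_cat_cons (V : lmodType K) w0 x l a (F : seq L -> V) :
  insert (w0 ++ x :: l) a F
  = cutsum a (fun a0 r => cutsum r (fun a1 a2 =>
      if ok (we x + weight wl a1) then
        sgn K (weight wl a0 * (we x + weight we l) + weight wl a1 * weight we l)
        *: insert w0 a0 (fun b0 => insert l a2 (fun m => F (b0 ++ act x a1 :: m)))
      else 0)).
Proof.
elim: w0 a F => [|y w0 IH] a F //=.
pose X c0 c1 d a1 a2 : V := if ok (we y + weight wl c1) && ok (we x + weight wl a1) then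
  sgn K (weight wl c0 * (we y + weight we (w0 ++ x :: l)) + weight wl c1 * weight we (w0 ++ x :: l)
         + (weight wl d * (we x + weight we l) + weight wl a1 * weight we l))
  *: insert w0 d (fun b0 => insert l a2 (fun m => F (c0 ++ act y c1 :: b0 ++ act x a1 :: m)))
  else 0.
transitivity (cutsum a (fun c0 r => cutsum r (fun c1 s => cutsum s (fun d t =>
    cutsum t (fun a1 a2 => X c0 c1 d a1 a2))))).
  apply: eq_cutsum => c0 r _; apply: eq_cutsum => c1 s _; rewrite /X.
  case: ifP => _ /=; last by under [RHS]eq_cutsum do rewrite cutsum0; rewrite cutsum0.
  rewrite IH -cutsumZ; apply: eq_cutsum => d t _.
  rewrite -cutsumZ; apply: eq_cutsum => a1 a2 _.
  case: ifP => _; last by rewrite scaler0.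
  by rewrite scalerA -sgnD.
rewrite -(cutsum_cut3 a (fun c0 c1 d t => cutsum t (fun a1 a2 => X c0 c1 d a1 a2))).
apply: eq_cutsum => a0 r _.
transitivity (cutsum r (fun a1 a2 => cutsum a0 (fun c0 s => cutsum s (fun c1 d =>
    X c0 c1 d a1 a2)))).
  rewrite [RHS]cutsum_exch; apply: eq_cutsum => c0 s _; exact: cutsum_exch.
apply: eq_cutsum => a1 a2 _; rewrite /X.
have [_|_] := boolP (ok (we x + weight wl a1)); last first.
  under eq_cutsum => ? ? _ do (under eq_cutsum => ? ? _ do rewrite andbF; rewrite cutsum0).
  by rewrite cutsum0.
rewrite -cutsumZ; apply: eq_cutsum => c0 s a0E; rewrite -cutsumZ.
apply: eq_cutsum => c1 d sE; rewrite andbT; case: ifP => _; last by rewrite scaler0.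
rewrite scalerA -sgnD a0E sE !weightE; congr (_ *: _); last first.
  by apply: eq_insert => b0; apply: eq_insert => m; rewrite -catA.
by congr (sgn K _); ring.
Qed.
End Insertion.
Arguments insert_terms {K E L} we wl ok act xs a.

(** * Multilinear functions and composition of insertions *)

(** Insertions into two different words are independent. *)
Lemma insert_exch (K : fieldType) (E L E' L' : Type) (we : E -> int) (wl : L -> int)
    (ok : pred int) (act : E -> seq L -> L) (we' : E' -> int) (wl' : L' -> int)
    (ok' : pred int) (act' : E' -> seq L' -> L') (V : lmodType K) xs a ys c
    (H : seq L -> seq L' -> V) :
  insert we wl ok act xs a (fun b => insert we' wl' ok' act' ys c (H b))
  = insert we' wl' ok' act' ys c (fun d => insert we wl ok act xs a (fun b => H b d)).
Proof.
have [ts tsE] := insert_terms (K := K) we' wl' ok' act' ys c.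
under eq_insert => b do rewrite tsE.
rewrite insert_sum tsE; apply: eq_bigr => t _; exact: insertZ.
Qed.

Lemma scaler_swap (K : fieldType) (V : lmodType K) (k s : K) (x : V) :
  k *: (s *: x) = s *: (k *: x).
Proof. by rewrite !scalerA mulrC. Qed.

Section Multilinear.
Variables (K : fieldType) (A : lmodType K).

Definition multilinear (V : lmodType K) (F : seq A -> V) : Prop :=
  forall l r k b c, F (l ++ (k *: b + c) :: r) = k *: F (l ++ b :: r) + F (l ++ c :: r).

Variables (V : lmodType K) (F : seq A -> V).
Hypothesis Flin : multilinear F.

Lemma multilinear_cat_cons l y : multilinear (fun m => F (l ++ y :: m)).
Proof. by move=> m r k b c; rewrite -!cat_cons !catA Flin. Qed.

Lemma multilinear_cons y : multilinear (fun m => F (y :: m)).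
Proof. exact: (multilinear_cat_cons [::]). Qed.

Lemma multilinear0 l r : F (l ++ 0 :: r) = 0.
Proof.
have := Flin l r (-1) 0 0; rewrite scaler0 addr0 scaleN1r => ->; exact: addNr.
Qed.

Lemma multilinearZ l r k b : F (l ++ (k *: b) :: r) = k *: F (l ++ b :: r).
Proof. by rewrite -[k *: b]addr0 Flin multilinear0 addr0. Qed.

Lemma multilinearD l r b c : F (l ++ (b + c) :: r) = F (l ++ b :: r) + F (l ++ c :: r).
Proof. by rewrite -[b in LHS]scale1r Flin scale1r. Qed.

Lemma multilinear_sum (I : Type) (s : seq I) (P : pred I) l r (G : I -> A) :
  F (l ++ (\sum_(i <- s | P i) G i) :: r) = \sum_(i <- s | P i) F (l ++ G i :: r).
Proof.
apply: (big_morph (fun b => F (l ++ b :: r))) => [b c|]; [exact: multilinearD|exact: multilinear0].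
Qed.

Lemma multilinear_insert (E L : Type) (we : E -> int) (wl : L -> int) (ok : pred int)
    (act : E -> seq L -> L) l r xs a (G : seq L -> A) :
  F (l ++ insert we wl ok act xs a G :: r)
  = insert we wl ok act xs a (fun b => F (l ++ G b :: r)).
Proof.
have [ts tsE] := insert_terms (K := K) we wl ok act xs a.
by rewrite !tsE multilinear_sum; apply: eq_bigr => t _; rewrite multilinearZ.
Qed.

End Multilinear.

Section Composition.
Variables (K : fieldType) (A : lmodType K) (E : Type).
Variables (we : E -> int) (wl : A -> int) (ok : pred int).
Variables (act : E -> seq A -> A) (hb : E -> seq E -> E).
Local Notation star := (insert we we xpredT hb).
Local Notation insert := (insert we wl ok act).
Hypothesis act_wt : forall x a, ok (we x + weight wl a) -> wl (act x a) = we x + weight wl a.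
Hypothesis hb_wt : forall v ws, we (hb v ws) = we v + weight we ws.
Hypothesis hb_act : forall v ws a, act (hb v ws) a = insert ws a (act v).

(** In the two-step insertion, the factor that an operation v consumes contains
    letters produced by some consecutive operations w1 of ws; consuming it is
    the same as inserting the composite of v with w1.  On the right-hand side
    these composites are formed first, by inserting ws, as a word of operations,
    into the factors vs.  The proof isolates the first operation of vs, cuts ws
    and a around its factor, and identifies both sides with the same sum X. *)
Lemma insert_comp (V : lmodType K) vs ws a (F : seq A -> V) : multilinear F ->
  insert ws a (fun b => insert vs b F) = star vs ws (fun xs => insert xs a F).
Proof.
elim: vs ws a F => [|v vs IH] ws a F Flin //.
(* The total sign: v passes a0 and the operations w0, the operations vs pass
     in addition a1 and w1, and w1, w2 pass the letters to their left. *)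
pose S w0 w1 w2 a0 a1 : int := weight wl a0 * (weight we w1 + weight we w2) + weight wl a1 * weight we w2
  + (weight wl a0 + weight we w0) * (we v + weight we vs) + (weight wl a1 + weight we w1) * weight we vs.
pose X w0 w1 w2 a0 a1 a2 : V := if ok (we v + weight we w1 + weight wl a1) then
  sgn K (S w0 w1 w2 a0 a1) *: insert w0 a0 (fun b0 => insert w1 a1 (fun b1 =>
    star vs w2 (fun l => insert l a2 (fun m => F (b0 ++ act v b1 :: m))))) else 0.
transitivity (cutsum ws (fun w0 wr => cutsum wr (fun w1 w2 => cutsum a (fun a0 ar =>
    cutsum ar (fun a1 a2 => X w0 w1 w2 a0 a1 a2))))).
  rewrite /= insert_comult //; apply: eq_cutsum => w0 wr _.
  rewrite [RHS]cutsum_exch; apply: eq_cutsum => a0 ar _.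
  under eq_insert => b0 do rewrite insert_comult //.
  rewrite insert_cutsum -cutsumZ; apply: eq_cutsum => w1 w2 wrE.
  rewrite insert_cutsum -cutsumZ; apply: eq_cutsum => a1 a2 _.
  rewrite insertZ scalerA.
  transitivity ((sgn K (weight wl a0 * weight we wr) * sgn K (weight wl a1 * weight we w2)) *:
     (if ok (we v + weight we w1 + weight wl a1) then
        sgn K ((weight wl a0 + weight we w0) * (we v + weight we vs) + (weight wl a1 + weight we w1) * weight we vs)
        *: insert w0 a0 (fun b0 => insert w1 a1 (fun b1 => insert w2 a2 (fun b2 =>
             insert vs b2 (fun l => F (b0 ++ act v b1 :: l))))) else 0)).
    congr (_ *: _); rewrite -insertZ -insert_if; apply: eq_insert_weight => // b0 b0E _.
    rewrite -insertZ -insert_if; apply: eq_insert_weight => // b1 b1E _.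
    rewrite -insertZ -insert_if; apply: eq_insert => b2.
    rewrite b1E b0E addrA.
    case: ifP => // _; congr (sgn K _ *: _); ring.
  rewrite /X; case: ifP => _; last by rewrite scaler0.
  rewrite scalerA -!sgnD; congr (sgn K _ *: _).
    rewrite /S wrE !weightE; ring.
  apply: eq_insert => b0; apply: eq_insert => b1; apply: IH; exact: multilinear_cat_cons.
rewrite /=; apply: eq_cutsum => w0 wr _; apply: eq_cutsum => w1 w2 _.
under [in RHS]eq_insert => l do rewrite insert_cat_cons.
rewrite insert_cutsum -cutsumZ; apply: eq_cutsum => a0 ar _.
rewrite insert_cutsum -cutsumZ; apply: eq_cutsum => a1 a2 _.
rewrite hb_wt insert_if /X; case: ifP => _; last by rewrite scaler0.
transitivity (sgn K (weight we w0 * (we v + weight we vs) + weight we w1 * weight we vs) *: star vs w2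
    (fun l => sgn K (weight wl a0 * (we v + weight we w1 + (weight we vs + weight we w2))
                     + weight wl a1 * (weight we vs + weight we w2))
      *: insert w0 a0 (fun b0 => insert l a2 (fun m =>
           insert w1 a1 (fun b1 => F (b0 ++ act v b1 :: m)))))); last first.
  congr (_ *: _); apply: eq_insert_weight => // l -> _; congr (_ *: _).
  apply: eq_insert => b0; apply: eq_insert => m; by rewrite hb_act (multilinear_insert Flin).
rewrite insertZ scalerA -sgnD; congr (sgn K _ *: _); first by rewrite /S; ring.
rewrite [RHS]insert_exch; apply: eq_insert => b0.
under [RHS]eq_insert => l do rewrite insert_exch.
by rewrite [RHS]insert_exch.
Qed.

End Composition.

(** * Insertions as sums over cut points *)

(** The sum over weakly increasing sequences of q cut points, parametrized by the
    first one and the increments; this form follows the recursion of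
    [insert]. *)
Fixpoint cuts (V : nmodType) (q n : nat) (F : seq nat -> V) : V :=
  if q is q'.+1 then
    \sum_(i < n.+1) cuts q' (n - i) (fun u => F (val i :: [seq (i + k)%N | k <- u]))
  else F [::].

Lemma eq_cuts (V : nmodType) q n (F G : seq nat -> V) :
  (forall u, size u = q -> sorted leq u -> all (fun k => (k <= n)%N) u -> F u = G u) ->
  cuts q n F = cuts q n G.
Proof.
elim: q n F G => [|q IH] n F G eqFG /=; first by apply: eqFG.
apply: eq_bigr => i _; apply: IH => u su ou au; apply: eqFG.
- by rewrite /= size_map su.
- rewrite /= path_sortedE; last exact: leq_trans.
  rewrite (homo_sorted (e := leq)) ?andbT //; last by move=> x y; rewrite leq_add2l.
  by apply/allP => _ /mapP [k _ ->]; rewrite leq_addr.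
- rewrite /= -ltnS ltn_ord /=; apply/allP => _ /mapP [k ku ->].
  by have := allP au k ku; have := ltn_ord i; lia.
Qed.

(** The induction needs sequences bounded below by an arbitrary m: removing the
    first cut point replaces m by it. *)
Lemma tuple_cuts (V : nmodType) q n m (F : seq nat -> V) : (m <= n)%N ->
  \sum_(t : q.-tuple 'I_n.+1 | path leq m [seq val x | x <- t]) F [seq val x | x <- t]
  = cuts q (n - m) (fun u => F [seq (m + k)%N | k <- u]).
Proof.
elim: q m F => [|q IH] m F mn /=.
  by rewrite (big_pred1 [tuple]) //= => t; rewrite tuple0 /=; apply/esym/eqP.
rewrite (reindex (fun p : 'I_n.+1 * q.-tuple 'I_n.+1 => cons_tuple p.1 p.2)) /=; last first.
  exists (fun t => (thead t, behead_tuple t)) => [[x t] _|t _] /=.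
    by congr (_, _); apply: val_inj.
  by rewrite [RHS]tuple_eta; apply: val_inj.
rewrite -(pair_big_dep (fun i : 'I_n.+1 => m <= i)%N
  (fun i t => path leq i [seq val x | x <- tval t])
  (fun i (t : q.-tuple 'I_n.+1) => F (val i :: [seq val x | x <- t]))) /=.
under eq_bigr => i _ do rewrite (IH i (fun u => F (val i :: u))) -1?ltnS //.
rewrite -(big_mkord (fun i => m <= i)%N
  (fun i => cuts q (n - i) (fun u => F (i :: [seq (i + k)%N | k <- u])))).
rewrite -(big_nat_widenl m 0 n.+1 xpredT) // -[m in X in X = _]add0n big_addn subSn //.
rewrite big_mkord; apply: eq_bigr => i _.
rewrite subnDA subnAC; apply: eq_cuts => u _ _ _.
by rewrite addnC -map_comp; congr (F (_ :: _)); apply: eq_map => k /=; rewrite addnA.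
Qed.

Lemma sum_cutsE (V : nmodType) r n (F : (nat -> nat) -> (nat -> nat) -> V) :
  sum_cuts r n F
  = cuts r.*2 n (fun u => F (fun k => nth 0%N u k.*2) (fun k => nth 0%N u k.*2.+1)).
Proof.
rewrite /sum_cuts (eq_bigl (fun t : r.*2.-tuple 'I_n.+1 => path leq 0 [seq val x | x <- t])).
  rewrite (tuple_cuts _ (fun u => F (fun k => nth 0%N u k.*2) (fun k => nth 0%N u k.*2.+1))) //.
  rewrite subn0; apply: eq_cuts => u _ _ _.
  by rewrite (eq_map (add0n : _ =1 id)) map_id.
by move=> t; case: (tval t).
Qed.

Lemma eq_sum_cuts (V : nmodType) r n (F G : (nat -> nat) -> (nat -> nat) -> V) :
  (forall i j : nat -> nat,
     (forall k, (k < r)%N -> [/\ (prev_cut j k <= i k)%N, (i k <= j k)%N & (j k <= n)%N]) ->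
     F i j = G i j) ->
  sum_cuts r n F = sum_cuts r n G.
Proof.
move=> eqFG; rewrite !sum_cutsE; apply: eq_cuts => u su ou au; apply: eqFG => k kr.
have u_le i j : (i <= j < r.*2)%N -> (nth 0%N u i <= nth 0%N u j)%N.
  by move=> /andP [ij jr]; apply: (sorted_leq_nth leq_trans leqnn 0%N ou); rewrite ?inE //; lia.
split.
- by case: k kr => [|k] kr //=; apply: u_le; lia.
- by apply: u_le; lia.
- by move/(all_nthP 0%N): au; apply; lia.
Qed.

Lemma slice_addl (T : Type) (w : seq T) c p q :
  slice w (c + p) (c + q) = slice (drop c w) p q.
Proof. by rewrite /slice addnC -drop_drop [(c + q)%N]addnC take_drop. Qed.

Lemma splice_rec (T : Type) (w : seq T) r i j b c i' j' b' :
  j 0%N = c -> (forall k, (k < r)%N -> i k.+1 = (c + i' k)%N) ->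
  (forall k, (k < r)%N -> j k.+1 = (c + j' k)%N) ->
  (forall k, (k < r)%N -> b k.+1 = b' k :> T) ->
  splice w r.+1 i j b = take (i 0%N) w ++ b 0%N :: splice (drop c w) r i' j' b'.
Proof.
move=> j0 iE jE bE; rewrite /splice /= {1}/slice drop0 cat_rcons -!catA /=.
have pE k : (k <= r)%N -> prev_cut j k.+1 = (c + prev_cut j' k)%N.
  by case: k => [|k] kr /=; rewrite ?j0 ?addn0 // jE.
rewrite -[1%N]add1n iotaDl -map_comp; congr (_ ++ _ :: _ ++ _).
  congr flatten; apply/eq_in_map => k; rewrite mem_iota add0n /= => kr.
  by rewrite add1n -[j k]/(prev_cut j k.+1) pE 1?ltnW // iE // bE // slice_addl.
by rewrite -[LHS]/(drop (prev_cut j r.+1) w) pE // drop_drop addnC.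
Qed.

Lemma forall_ordS r (P : nat -> bool) :
  [forall k : 'I_r.+1, P k] = P 0%N && [forall k : 'I_r, P k.+1].
Proof.
apply/forallP/andP => [Pk|[P0 /forallP Pk] [[|k] kr]] //.
  by split; [exact: (Pk ord0)|apply/forallP => k; exact: (Pk (lift ord0 k))].
exact: (Pk (Ordinal (kr : (k < r)%N))).
Qed.

Section SumCuts.
Variables (K : fieldType) (E L : Type) (we : E -> int) (wl : L -> int).
Variables (ok : pred int) (act : E -> seq L -> L).

Lemma weight_nth x0 (xs : seq E) : weight we xs = \sum_(k < size xs) we (nth x0 xs k).
Proof. by rewrite /weight (big_nth x0) big_mkord. Qed.

(** The recursion of [insert] chooses the length of the passed factor and of the
    consumed factor, that is, the increments of the cut points; summing over the
    positions themselves amounts to the same after translating the later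
    positions.  In the sign, the translation accounts for the letters a0 and a1
    that the operations after the first one have passed. *)
Lemma sum_cuts_insert (V : lmodType K) x0 xs a (F : seq L -> V) :
  sum_cuts (size xs) (size a) (fun i j =>
    if [forall k : 'I_(size xs), ok (we (nth x0 xs k) + weight wl (slice a (i k) (j k)))] then
      sgn K (\sum_(k < size xs) we (nth x0 xs k) * weight wl (take (i k) a))
      *: F (splice a (size xs) i j (fun k => act (nth x0 xs k) (slice a (i k) (j k))))
    else 0)
  = insert we wl ok act xs a F.
Proof.
rewrite sum_cutsE; elim: xs a F => [|x xs IH] a F.
  rewrite /= big_ord0 scale1r /splice /= drop0 ifT //; by apply/forallP => -[].
rewrite [LHS]/= [RHS]/= cutsumE; apply: eq_bigr => i _.
rewrite cutsumE size_drop; apply: eq_bigr => d _.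
set a0 := take i a; set a1 := take d _; set a2 := drop d _.
have a2E : a2 = drop (i + d) a by rewrite /a2 drop_drop addnC.
have <- : size a2 = (size a - i - d)%N by rewrite !size_drop.
case: ifP => okx; last first.
  transitivity (cuts (size xs).*2 (size a2) (fun _ => 0 : V)).
    apply: eq_cuts => u _ _ _; rewrite ifF //; apply/negbTE/forallPn.
    exists ord0; rewrite /=.
    by rewrite -[X in slice a X _]addn0 slice_addl /(slice _ 0 d) drop0 okx.
  by elim: (_.*2) (size a2) => //= q IHq n; rewrite big1.
rewrite -IH.
have scal_cuts q n k (G : seq nat -> V) : k *: cuts q n G = cuts q n (fun u => k *: G u).
  by elim: q n G => //= q IHq n G; rewrite scaler_sumr; apply: eq_bigr => e _; rewrite IHq.
rewrite scal_cuts; apply: eq_cuts => u su _ _.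
rewrite (forall_ordS _ (fun k => ok (we (nth x0 (x :: xs) k)
  + weight wl (slice a (nth 0%N (val i :: [seq (i + k)%N | k <- val d :: [seq (d + k)%N | k <- u]]) k.*2)
                   (nth 0%N (val i :: [seq (i + k)%N | k <- val d :: [seq (d + k)%N | k <- u]]) k.*2.+1))))).
rewrite /= -[X in slice a X _]addn0 slice_addl.
rewrite /(slice _ 0 d) drop0 okx /=.
set u1 := map _ u; set u2 := map _ u1.
have nu k : (k < size u)%N -> nth 0%N u2 k = (i + d + nth 0%N u k)%N.
  by move=> ku; rewrite /u2 /u1 -map_comp (nth_map 0%N) //= addnA.
have ni k : (k < size xs)%N -> nth 0%N u2 k.*2 = (i + d + nth 0%N u k.*2)%N.
  by move=> kx; rewrite nu // su; lia.
have nj k : (k < size xs)%N -> nth 0%N u2 k.*2.+1 = (i + d + nth 0%N u k.*2.+1)%N.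
  by move=> kx; rewrite nu // su; lia.
have eqs k : (k < size xs)%N ->
    slice a (nth 0%N u2 k.*2) (nth 0%N u2 k.*2.+1)
    = slice a2 (nth 0%N u k.*2) (nth 0%N u k.*2.+1).
  by move=> kx; rewrite ni // nj // slice_addl a2E.
have -> : [forall k : 'I_(size xs), ok (we (nth x0 xs k)
             + weight wl (slice a (nth 0%N u2 k.*2) (nth 0%N u2 k.*2.+1)))]
    = [forall k : 'I_(size xs), ok (we (nth x0 xs k)
             + weight wl (slice a2 (nth 0%N u k.*2) (nth 0%N u k.*2.+1)))].
  by apply: eq_forallb => k; rewrite eqs.
case: ifP => _; last by rewrite scaler0.
rewrite scalerA -sgnD; congr (sgn K _ *: F _).
  rewrite big_ord_recl /= -/a0.
  have -> : \sum_(k < size xs) we (nth x0 xs k) * weight wl (take (nth 0%N u2 k.*2) a)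
      = \sum_(k < size xs) we (nth x0 xs k) * (weight wl a0 + weight wl a1)
        + \sum_(k < size xs) we (nth x0 xs k) * weight wl (take (nth 0%N u k.*2) a2).
    rewrite -big_split; apply: eq_bigr => k _ /=; rewrite ni // !takeD !weightE a2E.
    by rewrite -/a0 -/a1 mulrDr.
  rewrite -mulr_suml -weight_nth; ring.
have := @splice_rec L a (size xs)
  (fun k => nth 0%N [:: val i, (i + d)%N & u2] k.*2)
  (fun k => nth 0%N [:: val i, (i + d)%N & u2] k.*2.+1)
  (fun k => act (nth x0 (x :: xs) k) (slice a (nth 0%N [:: val i, (i + d)%N & u2] k.*2)
                                             (nth 0%N [:: val i, (i + d)%N & u2] k.*2.+1)))
  (i + d)%N (fun k => nth 0%N u k.*2) (fun k => nth 0%N u k.*2.+1)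
  (fun k => act (nth x0 xs k) (slice a2 (nth 0%N u k.*2) (nth 0%N u k.*2.+1)))
  erefl ni nj.
move=> ->; last by move=> k kx /=; rewrite eqs.
rewrite -a2E /=; congr (_ ++ _ :: _).
by rewrite -[X in slice a X _]addn0 slice_addl /slice drop0.
Qed.

End SumCuts.

Section MultilinearInsertion.
Variables (K : fieldType) (A : lmodType K) (E : Type).
Variables (we : E -> int) (ok : pred int) (act : E -> seq A -> A).
Local Notation insert := (insert we (fun=> -1) ok act).

(** A letter of the word is either kept, and then an argument of F, or consumed,
    and then an argument of one of the inserted operations.  All letters have the
    same degree, so changing one letter does not change the signs. *)
Lemma insert_multilinear (V : lmodType K) xs (F : seq A -> V) : multilinear F ->
  (forall k, (k < size xs)%N -> forall x0, multilinear (act (nth x0 xs k))) ->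
  multilinear (fun a => insert xs a F).
Proof.
elim: xs F => [|x xs IH] F Flin xslin //= l r k b c.
have xlin : multilinear (act x) := xslin 0%N (ltn0Sn _) x.
have {}IH (F' : seq A -> V) : multilinear F' -> multilinear (fun a => insert xs a F').
  by move=> F'lin; apply: (IH F' F'lin) => i ixs x0; apply: (xslin i.+1).
rewrite !cutsum_cat scalerDr addrACA; congr (_ + _); last first.
  rewrite -cutsumZ -cutsumD; apply: eq_cutsum => p q _.
  rewrite -cutsumZ -cutsumD; apply: eq_cutsum => a1 a2 _.
  case: ifP => _; last by rewrite scaler0 addr0.
  rewrite !weight_const !size_cat /= scaler_swap -scalerDr -insert_linearP.
  congr (_ *: _); apply: eq_insert => m.
  by rewrite -!catA !cat_cons Flin.
rewrite -cutsumZ -cutsumD; apply: eq_cutsum => p q _.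
rewrite !cutsum_cat scalerDr addrACA; congr (_ + _); last first.
  rewrite -cutsumZ -cutsumD; apply: eq_cutsum => a1 a2 _.
  rewrite !weight_const !size_cat /=.
  case: ifP => _; last by rewrite scaler0 addr0.
  rewrite scaler_swap -scalerDr -insert_linearP; congr (_ *: _).
  by apply: eq_insert => m; rewrite xlin Flin.
rewrite -cutsumZ -cutsumD; apply: eq_cutsum => a1 a2 _.
case: ifP => _; last by rewrite scaler0 addr0.
rewrite scaler_swap -scalerDr; congr (_ *: _).
by apply: (IH (fun m => F (p ++ act x a1 :: m))); apply: multilinear_cat_cons.
Qed.

Lemma insert_evaluate_linear (V : lmodType K) us x y z ws a k (F : seq A -> V) : multilinear F ->
  we x = we y -> we x = we z -> (forall b, act x b = k *: act y b + act z b) ->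
  insert (us ++ x :: ws) a F = k *: insert (us ++ y :: ws) a F + insert (us ++ z :: ws) a F.
Proof.
move=> Flin xy xz actx; rewrite !insert_cat_cons -!xy -!xz.
rewrite -cutsumZ -cutsumD; apply: eq_cutsum => p q _.
rewrite -cutsumZ -cutsumD; apply: eq_cutsum => a1 a2 _.
case: ifP => _; last by rewrite scaler0 addr0.
rewrite scaler_swap -scalerDr -insert_linearP; congr (_ *: _).
apply: eq_insert => b0; rewrite -insert_linearP; apply: eq_insert => m.
by rewrite actx Flin.
Qed.

Lemma insert_act0 (V : lmodType K) us x ws a (F : seq A -> V) : multilinear F ->
  (forall b, act x b = 0) -> insert (us ++ x :: ws) a F = 0.
Proof.
move=> Flin actx0.
have := @insert_evaluate_linear V us x x x ws a (-1) F Flin erefl erefl.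
rewrite scaleN1r addNr; apply=> b; by rewrite actx0 scaler0 addr0.
Qed.

End MultilinearInsertion.

(** * Graded structures and their morphisms *)

Lemma eq_splice (T : Type) (w : seq T) r i j (b b' : nat -> T) :
  (forall k, (k < r)%N -> b k = b' k) -> splice w r i j b = splice w r i j b'.
Proof.
move=> bb'; rewrite /splice; congr (flatten _ ++ _); apply/eq_in_map => k.
by rewrite mem_iota add0n /= => kr; rewrite bb'.
Qed.

Lemma map_slice (T U : Type) (g : T -> U) w p q : map g (slice w p q) = slice (map g w) p q.
Proof. by rewrite /slice map_drop map_take. Qed.

Lemma map_splice (T U : Type) (g : T -> U) w r i j b :
  map g (splice w r i j b) = splice (map g w) r i j (fun k => g (b k)).
Proof.
rewrite /splice map_cat map_flatten -map_comp map_drop; congr (flatten _ ++ _).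
by apply: eq_map => k /=; rewrite map_rcons map_slice.
Qed.

Lemma sum_cuts_fct (U : Type) (V : nmodType) r n (F : (nat -> nat) -> (nat -> nat) -> U -> V) u :
  sum_cuts r n F u = sum_cuts r n (fun i j => F i j u).
Proof. by rewrite /sum_cuts fct_sumE. Qed.

Section HomogeneousLists.
Variables (K : fieldType) (X : bdga_data K).
Implicit Types (v w : int * X) (vs ws : seq (int * X)).

Lemma all_homog_cons v vs : all_homog (v :: vs) <-> homog v /\ all_homog vs.
Proof.
split=> [h|[hv hvs] w]; last by rewrite inE => /predU1P [->//|]; apply: hvs.
by split=> [|w wvs]; apply: h; rewrite inE ?eqxx // wvs orbT.
Qed.

Lemma all_homog_cat vs ws : all_homog (vs ++ ws) <-> all_homog vs /\ all_homog ws.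
Proof.
elim: vs => [|v vs IH] /=.
  by split=> [h|[]]; first by split.
by rewrite !all_homog_cons IH; split=> [[? []]|[[]]].
Qed.

Lemma all_homog_take k vs : all_homog vs -> all_homog (take k vs).
Proof. by rewrite -{1}(cat_take_drop k vs) all_homog_cat => -[]. Qed.

Lemma all_homog_drop k vs : all_homog vs -> all_homog (drop k vs).
Proof. by rewrite -{1}(cat_take_drop k vs) all_homog_cat => -[]. Qed.

Lemma all_homog_slice vs p q : all_homog vs -> all_homog (slice vs p q).
Proof. by move=> hvs; apply: all_homog_drop; apply: all_homog_take. Qed.

Lemma all_homog_splice vs r i j b : all_homog vs -> (forall k, (k < r)%N -> homog (b k)) ->
  all_homog (splice vs r i j b).
Proof.
move=> hvs hb; rewrite /splice all_homog_cat; split; last exact: all_homog_drop.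
move=> w /flatten_mapP [k]; rewrite mem_iota add0n /= => kr.
rewrite mem_rcons inE => /predU1P [->|]; [exact: hb|exact: all_homog_slice].
Qed.
End HomogeneousLists.

(** The part of the axioms that concerns only the degrees; it does not follow
    from an embedding into another structure. *)
Record homogeneous_ops (K : fieldType) (X : bdga_data K) : Prop := HomogeneousOps {
  ops_graded0 : forall n : int, @graded K X n 0;
  ops_gradedP : forall (n : int) (k : K) (x y : X),
    graded n x -> graded n y -> graded n (k *: x + y);
  ops_dif : forall v : int * X, homog v -> homog (hdif v);
  ops_mul : forall v w : int * X, homog v -> homog w -> homog (hmul v w);
  ops_brace : forall (v : int * X) vs, homog v -> all_homog vs -> homog (hbrace v vs)
}.

Section Pullback.
Variables (K : fieldType) (X Y : bdga_data K) (f : X -> Y) (H : X -> Prop).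
Hypothesis flin : forall (k : K) x y, f (k *: x + y) = k *: f x + f y.
Hypothesis H0 : H 0.
Hypothesis HP : forall (k : K) x y, H x -> H y -> H (k *: x + y).
Hypothesis graded_H : forall n x, graded n x -> H x.
Hypothesis f_inj : forall x y, H x -> H y -> f x = f y -> x = y.
Hypothesis opsX : homogeneous_ops X.
Hypothesis fM : bdga_morphism f.
Implicit Types (v w : int * X) (vs ws : seq (int * X)).
Local Notation NX := (normalize X).
Local Notation NY := (normalize Y).
Local Notation fv := (@on_vec K X Y f).

Let f0 : f 0 = 0.
Proof. by have := flin (-1) 0 0; rewrite scaler0 addr0 scaleN1r addNr. Qed.

Let fZ k x : f (k *: x) = k *: f x.
Proof. by rewrite -[k *: x]addr0 flin f0 addr0. Qed.

Let fD x y : f (x + y) = f x + f y.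
Proof. by rewrite -[x]scale1r flin !scale1r. Qed.

Let fN x : f (- x) = - f x.
Proof. by rewrite -scaleN1r fZ scaleN1r. Qed.

Let fsum (I : Type) (s : seq I) (P : pred I) (F : I -> X) :
  f (\sum_(i <- s | P i) F i) = \sum_(i <- s | P i) f (F i).
Proof. by apply: (big_morph f) => //; exact: fD. Qed.

Let HZ k x : H x -> H (k *: x).
Proof. by move=> hx; rewrite -[_ *: _]addr0; apply: HP. Qed.

Let HD x y : H x -> H y -> H (x + y).
Proof. by move=> hx hy; rewrite -[x]scale1r; apply: HP. Qed.

Let HN x : H x -> H (- x).
Proof. by move=> hx; rewrite -scaleN1r; apply: HZ. Qed.

Let Hsum (I : Type) (s : seq I) (P : pred I) (F : I -> X) :
  (forall i, P i -> H (F i)) -> H (\sum_(i <- s | P i) F i).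
Proof. by move=> HF; apply: big_ind. Qed.

Let gZ n k (x : X) : graded n x -> graded n (k *: x).
Proof. by move=> gx; rewrite -[_ *: _]addr0; apply: ops_gradedP => //; apply: ops_graded0. Qed.

Let hmul' v w : homog v -> homog w -> homog (@hmul K NX v w : int * X).
Proof. by move=> hv hw; apply: gZ; exact: (ops_mul opsX hv hw). Qed.

Let hdif' v : homog v -> homog (@hdif K NX v : int * X).
Proof. by move=> hv; apply: gZ; exact: (ops_dif opsX hv). Qed.

Let hbrace' v vs : homog v -> all_homog vs -> homog (@hbrace K NX v vs : int * X).
Proof. exact: ops_brace. Qed.

Let fhomog v : homog v -> @homog K Y (fv v).
Proof. exact: morph_graded. Qed.

Let fall vs : all_homog vs -> @all_homog K Y (map fv vs).
Proof. by move=> hvs w /mapP [v vvs ->]; apply: fhomog; apply: hvs. Qed.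

Let fdif v : homog v -> f (@dif K NX v) = @dif K NY (fv v).
Proof. by move=> hv; rewrite fZ; congr (_ *: _); apply: morph_dif. Qed.

Let fmul v w : homog v -> homog w -> f (@Defs.mul K NX v w) = @Defs.mul K NY (fv v) (fv w).
Proof. by move=> hv hw; rewrite fZ; congr (_ *: _); apply: morph_mul. Qed.

Let fbrace v vs : homog v -> all_homog vs ->
  f (@brace K NX v vs) = @brace K NY (fv v) (map fv vs).
Proof. exact: morph_brace. Qed.

Let fZmul k v w : homog v -> homog w ->
  f (k *: @Defs.mul K NX v w) = k *: @Defs.mul K NY (fv v) (fv w).
Proof. by move=> hv hw; rewrite fZ fmul. Qed.

Let fZbrace k v vs : homog v -> all_homog vs ->
  f (k *: @brace K NX v vs) = k *: @brace K NY (fv v) (map fv vs).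
Proof. by move=> hv hvs; rewrite fZ fbrace. Qed.

Let sdegf vs : @sdeg K NY (map fv vs) = @sdeg K NX vs.
Proof. by rewrite /sdeg big_map. Qed.

Let fhdif v : homog v -> fv (@hdif K NX v) = @hdif K NY (fv v).
Proof. by move=> hv; congr (_, _); apply: fdif. Qed.

Let fhmul v w : homog v -> homog w -> fv (@hmul K NX v w) = @hmul K NY (fv v) (fv w).
Proof. by move=> hv hw; congr (_, _); apply: fmul. Qed.

Let fhbrace v vs : homog v -> all_homog vs ->
  fv (@hbrace K NX v vs) = @hbrace K NY (fv v) (map fv vs).
Proof.
move=> hv hvs; congr (_, _); last exact: fbrace.
by rewrite -[RHS]/(v.1 + @sdeg K NY (map fv vs)) sdegf.
Qed.

Let Hh v : homog v -> H v.2.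
Proof. exact: graded_H. Qed.

Let fv_lin n k x y : fv (n, k *: x + y) = (n, k *: f x + f y).
Proof. by rewrite /on_vec flin. Qed.

Let fv_nth vs k : (k < size vs)%N -> (map fv vs)`_k = fv vs`_k.
Proof. exact: nth_map. Qed.

Let hnth vs k : all_homog vs -> (k < size vs)%N -> homog vs`_k.
Proof. by move=> hvs ks; apply: hvs; apply: mem_nth. Qed.

(** Each identity holds after applying f, hence holds.  The map f is injective
    only on the subspace H, not on the ambient space; a common subspace H for all
    degrees is used because the two sides of an identity have degrees that agree
    only up to arithmetic. *)
Lemma pullback_bdga : is_bdga NY -> is_bdga NX.
Proof.
case=> _ _ _ dlin dd _ mll mlr mA dm _ bll blr b0 bb bm bd.
split.
- exact: (ops_graded0 opsX).
- exact: (ops_gradedP opsX).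
- exact: hdif'.
- move=> n k x y gx gy; have gxy := ops_gradedP opsX k gx gy.
  have hx := @hdif' (n, x) gx; have hy := @hdif' (n, y) gy.
  apply: f_inj; [exact: (Hh (@hdif' (n, _) gxy))|by apply: HP; [exact: Hh hx|exact: Hh hy]|].
  rewrite flin !fdif // fv_lin; apply: dlin; exact: (morph_graded fM).
- move=> v hv; apply: f_inj => //; first exact: (Hh (hdif' (hdif' hv))).
  by rewrite fdif ?fhdif ?f0 ?dd //; [exact: fhomog|exact: hdif'].
- exact: hmul'.
- move=> n k x y w gx gy hw; have gxy := ops_gradedP opsX k gx gy.
  apply: f_inj; [exact: (Hh (@hmul' (n, _) w gxy hw))| |].
    by apply: HP; [exact: (Hh (@hmul' (n, x) w gx hw))|exact: (Hh (@hmul' (n, y) w gy hw))].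
  rewrite flin !fmul // fv_lin; apply: mll; by [exact: (morph_graded fM)|exact: fhomog].
- move=> w n k x y hw gx gy; have gxy := ops_gradedP opsX k gx gy.
  apply: f_inj; [exact: (Hh (@hmul' w (n, _) hw gxy))| |].
    by apply: HP; [exact: (Hh (@hmul' w (n, x) hw gx))|exact: (Hh (@hmul' w (n, y) hw gy))].
  rewrite flin !fmul // fv_lin; apply: mlr; by [exact: (morph_graded fM)|exact: fhomog].
- move=> u v w hu hv hw; have huv := hmul' hu hv; have hvw := hmul' hv hw.
  apply: f_inj; [exact: (Hh (hmul' huv hw))|exact: (Hh (hmul' hu hvw))|].
  by rewrite !fmul // !fhmul //; apply: mA; exact: fhomog.
- move=> v w hv hw; have hvw := hmul' hv hw; have hdv := hdif' hv; have hdw := hdif' hw.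
  apply: f_inj; first exact: (Hh (hdif' hvw)).
    by apply: HD; [exact: (Hh (hmul' hdv hw))|apply: HZ; exact: (Hh (hmul' hv hdw))].
  rewrite fdif // fD fZmul // fmul // fhmul // !fhdif //; apply: dm; exact: fhomog.
- exact: hbrace'.
- move=> n k x y vs gx gy hvs; have gxy := ops_gradedP opsX k gx gy.
  apply: f_inj; [exact: (Hh (@hbrace' (n, _) vs gxy hvs))| |].
    by apply: HP; [exact: (Hh (@hbrace' (n, x) vs gx hvs))|exact: (Hh (@hbrace' (n, y) vs gy hvs))].
  rewrite flin !fbrace // fv_lin; apply: bll; by [exact: (morph_graded fM)|exact: fall].
- move=> v us n k x y ws hv hus gx gy hws; have gxy := ops_gradedP opsX k gx gy.
  have hh z : graded n z -> all_homog (us ++ (n, z) :: ws).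
    by move=> gz; rewrite all_homog_cat all_homog_cons.
  apply: f_inj; [exact: (Hh (hbrace' hv (hh _ gxy)))| |].
    by apply: HP; [exact: (Hh (hbrace' hv (hh _ gx)))|exact: (Hh (hbrace' hv (hh _ gy)))].
  rewrite flin !fbrace //; try exact: hh.
  rewrite !map_cat /= fv_lin; apply: blr;
    by [exact: fall|exact: fhomog|exact: (morph_graded fM)].
- move=> v hv; apply: f_inj; [exact: (Hh (hbrace' hv (fun w => _)))|exact: Hh|].
  by rewrite fbrace //; apply: b0; exact: fhomog.
- move=> v vs ws hv hvs hws.
  have hsp i j : all_homog (splice ws (size vs) i j
      (fun k => @hbrace K NX vs`_k (slice ws (i k) (j k)))).
    apply: all_homog_splice => // k kr; apply: hbrace'; first exact: hnth.
    exact: all_homog_slice.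
  apply: f_inj; first exact: (Hh (hbrace' (hbrace' hv hvs) hws)).
    apply: Hsum => t _; apply: HZ; exact: (Hh (hbrace' hv (hsp _ _))).
  rewrite fbrace ?fhbrace //; last exact: hbrace'.
  rewrite bb; [|exact: fhomog|exact: fall|exact: fall].
  rewrite !size_map fsum; apply: eq_bigr => t _.
  rewrite (fZbrace _ hv (hsp _ _)) map_splice; congr (sgn K _ *: _).
    by apply: eq_bigr => k _; rewrite fv_nth // -map_take sdegf.
  congr (brace _ _); apply: eq_splice => k kr; rewrite fhbrace ?fv_nth ?map_slice //.
    exact: hnth.
  exact: all_homog_slice.
- move=> v w vs hv hw hvs; have hvw := hmul' hv hw.
  have h1 k := hbrace' hv (@all_homog_take K X k _ hvs).
  have h2 k := hbrace' hw (@all_homog_drop K X k _ hvs).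
  apply: f_inj; first exact: (Hh (hbrace' hvw hvs)).
    apply: Hsum => k _; apply: HZ; exact: (Hh (hmul' (h1 k) (h2 k))).
  rewrite fbrace // fhmul // bm; [|exact: fhomog|exact: fhomog|exact: fall].
  rewrite size_map fsum; apply: eq_bigr => k _.
  rewrite fZmul // !fhbrace //; try exact: all_homog_take; try exact: all_homog_drop.
  by rewrite -map_take sdegf map_drop.
- move=> v vs hv hvs vs0.
  have h1 k : (k < size vs)%N ->
      all_homog (take k vs ++ @hdif K NX vs`_k :: drop k.+1 vs).
    move=> ks; rewrite all_homog_cat all_homog_cons; split; first exact: all_homog_take.
    by split; [apply: hdif'; exact: hnth|exact: all_homog_drop].
  have h2 k : (k < (size vs).-1)%N ->
      all_homog (take k vs ++ @hmul K NX vs`_k vs`_k.+1 :: drop k.+2 vs).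
    move=> ks; rewrite all_homog_cat all_homog_cons; split; first exact: all_homog_take.
    split; last exact: all_homog_drop.
    rewrite ltn_predRL in ks.
    by apply: hmul'; [exact: hnth hvs (ltnW ks)|exact: hnth hvs ks].
  have hvvs := hbrace' hv hvs; have hdv := hdif' hv.
  have hb1 : @homog K X (@hbrace K NX v (behead vs)).
    by apply: hbrace' => //; rewrite -drop1; exact: all_homog_drop.
  have hb2 : @homog K X (@hbrace K NX v (take (size vs).-1 vs)).
    by apply: hbrace' => //; exact: all_homog_take.
  have hv0 : homog vs`_0 by exact: hnth.
  have hvl : homog vs`_(size vs).-1 by apply: hnth => //; rewrite ltn_predL.
  apply: f_inj.
  + apply: HD; first by apply: HD; [exact: (Hh (hdif' hvvs))|apply: HN; exact: (Hh (hbrace' hdv hvs))].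
    by apply: Hsum => k _; apply: HZ; apply: (Hh (hbrace' hv (h1 k _))).
  + apply: HD; last by apply: HZ; exact: (Hh (hmul' hb2 hvl)).
    apply: HD; first by apply: HZ; exact: (Hh (hmul' hv0 hb1)).
    by apply: HN; apply: Hsum => k _; apply: HZ; apply: (Hh (hbrace' hv (h2 k _))).
  rewrite !fD !fN !fsum fdif // fhbrace // fbrace // fhdif // !fZmul //.
  rewrite !fhbrace //; [|exact: all_homog_take|by rewrite -drop1; exact: all_homog_drop].
  have tE k : @sdeg K NX (take k vs) = @sdeg K NY (take k (map fv vs)).
    by rewrite -map_take sdegf.
  have s1 : \sum_(k < size vs) f (sgn K (v.1 + @sdeg K NX (take k vs))
        *: @brace K NX v (take k vs ++ @hdif K NX vs`_k :: drop k.+1 vs))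
      = \sum_(k < size vs) sgn K (v.1 + @sdeg K NY (take k (map fv vs)))
        *: @brace K NY (fv v) (take k (map fv vs)
             ++ @hdif K NY (map fv vs)`_k :: drop k.+1 (map fv vs)).
    apply: eq_bigr => k _; rewrite (fZbrace _ hv (h1 k (ltn_ord k))) tE.
    rewrite map_cat map_cons map_take map_drop fhdif ?fv_nth //.
    exact: hnth.
  have s2 : \sum_(k < (size vs).-1) f (sgn K (v.1 + @sdeg K NX (take k.+1 vs) - 1)
        *: @brace K NX v (take k vs ++ @hmul K NX vs`_k vs`_k.+1 :: drop k.+2 vs))
      = \sum_(k < (size vs).-1) sgn K (v.1 + @sdeg K NY (take k.+1 (map fv vs)) - 1)
        *: @brace K NY (fv v) (take k (map fv vs)
             ++ @hmul K NY (map fv vs)`_k (map fv vs)`_k.+1 :: drop k.+2 (map fv vs)).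
    apply: eq_bigr => k _; rewrite (fZbrace _ hv (h2 k (ltn_ord k))) tE.
    have kr : (k.+1 < size vs)%N by rewrite -ltn_predRL.
    rewrite map_cat map_cons map_take map_drop fhmul ?fv_nth ?(ltnW kr) //.
      exact: hnth hvs (ltnW kr).
    exact: hnth hvs kr.
  rewrite s1 s2 tE -!fv_nth ?ltn_predL // -behead_map map_take.
  have := bd (fv v) (map fv vs) (fhomog hv) (fall hvs).
  rewrite size_map => /(_ vs0) ->.
  by rewrite fv_nth.
Qed.
End Pullback.

Lemma comp_morphism (K : fieldType) (X Y Z : bdga_data K) (f : X -> Y) (g : Y -> Z) :
  bdga_morphism f -> bdga_morphism g -> bdga_morphism (g \o f).
Proof.
move=> fM gM.
have fh v : homog v -> homog (on_vec f v) by exact: (morph_graded fM).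
split=> [n x gx|n k x y gx gy|v hv|v w hv hw|v vs hv hvs] /=.
- by apply: (morph_graded gM); apply: (morph_graded fM).
- rewrite (morph_linear fM k gx gy).
  exact: (morph_linear gM k (morph_graded fM gx) (morph_graded fM gy)).
- by rewrite (morph_dif fM hv) (morph_dif gM (fh v hv)).
- by rewrite (morph_mul fM hv hw) (morph_mul gM (fh v hv) (fh w hw)).
- rewrite (morph_brace fM hv hvs) (morph_brace gM (fh v hv)) -?map_comp //.
  by move=> _ /mapP [w wvs ->]; apply: fh; apply: hvs.
Qed.

Lemma inverse_morphism (K : fieldType) (X Y : bdga_data K) (f : X -> Y) (g : Y -> X) :
  homogeneous_ops X -> bdga_morphism f ->
  (forall (n : int) y, graded n y -> graded n (g y)) ->
  (forall (n : int) x, graded n x -> g (f x) = x) ->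
  (forall (n : int) y, graded n y -> f (g y) = y) ->
  bdga_morphism g.
Proof.
move=> opsX fM gg gf fg.
have gh v : homog v -> homog (on_vec g v) by exact: gg.
have fgv v : homog v -> on_vec f (on_vec g v) = v.
  by case: v => n y hv; rewrite /on_vec /= (fg n).
split=> [|n k x y gx gy|v hv|v w hv hw|v vs hv hvs].
- exact: gg.
- rewrite -[in LHS](fg n x gx) -[in LHS](fg n y gy) -(morph_linear fM k (gg n x gx) (gg n y gy)).
  by rewrite (gf n) //; apply: (ops_gradedP opsX); apply: gg.
- rewrite -[in LHS](fgv v hv) -(morph_dif fM (gh v hv)).
  exact: gf (ops_dif opsX (gh v hv)).
- rewrite -[in LHS](fgv v hv) -[in LHS](fgv w hw) -(morph_mul fM (gh v hv) (gh w hw)).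
  exact: gf (ops_mul opsX (gh v hv) (gh w hw)).
have ghs : all_homog [seq on_vec g w | w <- vs].
  by move=> _ /mapP [w wvs ->]; apply: gh; apply: hvs.
have fgvs : [seq on_vec f w | w <- [seq on_vec g w | w <- vs]] = vs.
  by rewrite -map_comp -[RHS]map_id; apply/eq_in_map => w wvs; apply: fgv; apply: hvs.
rewrite -[in LHS](fgv v hv) -[in LHS]fgvs -(morph_brace fM (gh v hv) ghs).
exact: gf (ops_brace opsX (gh v hv) ghs).
Qed.

(** [chain_values] below is a map of complexes that does not respect products; this
    is the part of a morphism that it keeps. *)
Record cochain_map (K : fieldType) (X Y : bdga_data K) (f : X -> Y) : Prop := CochainMap {
  cmap_graded : forall (n : int) x, graded n x -> graded n (f x);
  cmap_linear : forall (n : int) (k : K) x y, graded n x -> graded n y ->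
    f (k *: x + y) = k *: f x + f y;
  cmap_dif : forall v, homog v -> f (dif v) = dif (on_vec f v)
}.

Lemma morphism_cochain_map (K : fieldType) (X Y : bdga_data K) (f : X -> Y) :
  bdga_morphism f -> cochain_map f.
Proof. by case=> ? ? ?; split. Qed.

Section Coboundaries.
Variables (K : fieldType) (X : bdga_data K).
Hypothesis bX : is_bdga (normalize X).

(** The normalized differential differs from the original one by a sign depending
    only on the degree, so the axioms on the former pass to the latter. *)
Lemma dif_linear_of_bdga (n : int) (k : K) (x y : X) : graded n x -> graded n y ->
  dif (n, k *: x + y) = k *: dif (n, x) + dif (n, y).
Proof.
move=> gx gy; set c := sgn K (n + 1).
have E : c *: dif (n, k *: x + y) = k *: (c *: dif (n, x)) + c *: dif (n, y).
  exact: (dif_linear bX k gx gy).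
have cc (z : X) : c *: (c *: z) = z by rewrite scalerA sgn_sq scale1r.
by rewrite -[LHS]cc E scalerDr (scaler_swap c k) !cc.
Qed.

Lemma dif_homog_of_bdga (v : int * X) : homog v -> homog (hdif v).
Proof.
move=> hv; set c := sgn K (v.1 + 1).
have : graded (v.1 + 1) (c *: dif v) by exact: (dif_homog bX hv).
move=> /(gradedP bX c)/(_ (graded0 bX (v.1 + 1))).
by rewrite addr0 [_ *: _](_ : _ = dif v) // scalerA sgn_sq scale1r.
Qed.

Lemma dif_dif_of_bdga (v : int * X) : homog v -> dif (hdif v) = 0.
Proof.
move=> hv; set c := sgn K (v.1 + 1); set c' := sgn K (v.1 + 1 + 1).
have E : c' *: dif (v.1 + 1, c *: dif v) = 0 by exact: (dif_dif bX hv).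
have g0 := graded0 bX (v.1 + 1).
have d0 : dif (v.1 + 1, 0 : X) = 0.
  by have := dif_linear_of_bdga (-1) g0 g0; rewrite scaler0 addr0 scaleN1r addNr.
move: E; rewrite -[c *: dif v]addr0 (dif_linear_of_bdga c (dif_homog_of_bdga hv) g0) d0 addr0.
move=> /(congr1 ( *:%R (c * c'))); rewrite !scaler0 !scalerA => <-.
by rewrite -[c * c' * c']mulrA sgn_sq mulr1 sgn_sq scale1r.
Qed.

Lemma coboundaryP n k (x y : X) : coboundary n x -> coboundary n y -> coboundary n (k *: x + y).
Proof.
move=> [x' gx ->] [y' gy ->]; exists (k *: x' + y'); first exact: (gradedP bX).
by rewrite dif_linear_of_bdga.
Qed.

Lemma coboundary0 n : @coboundary K X n 0.
Proof.
have g0 := graded0 bX (n - 1); exists 0 => //.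
by have := dif_linear_of_bdga (-1) g0 g0; rewrite scaler0 addr0 scaleN1r addNr.
Qed.

Lemma coboundaryN n (x : X) : coboundary n x -> coboundary n (- x).
Proof.
by move=> cx; rewrite -scaleN1r -[_ *: _]addr0; apply: coboundaryP => //; apply: coboundary0.
Qed.

Lemma coboundaryD n (x y : X) : coboundary n x -> coboundary n y -> coboundary n (x + y).
Proof. by move=> cx cy; rewrite -[x]scale1r; apply: coboundaryP. Qed.

Lemma coh_class_refl n (z : X) : cocycle n z -> coh_class n z z.
Proof. by split=> //; rewrite subrr; apply: coboundary0. Qed.

Lemma eq_coh_class n (x y : X) : coboundary n (x - y) -> coh_class n x = coh_class n y.
Proof.
move=> cxy; apply/predeqP => z; split=> -[cz cb]; split=> //.
  by rewrite -[z](subrK x) -addrA; apply: coboundaryD.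
by rewrite -[z](subrK y) -addrA -[y - x]opprB; apply: coboundaryD => //; apply: coboundaryN.
Qed.
End Coboundaries.

Section InducedMap.
Variables (K : fieldType) (X Y : bdga_data K) (f : X -> Y).
Hypothesis bX : is_bdga (normalize X).
Hypothesis bY : is_bdga (normalize Y).
Hypothesis fC : cochain_map f.

Lemma cmap_cocycle n z : cocycle n z -> cocycle n (f z).
Proof.
move=> [gz dz]; split; first exact: cmap_graded gz.
have /= <- := cmap_dif fC (gz : homog (n, z)); rewrite dz.
have g0 := graded0 bX n.
by have := cmap_linear fC (-1) g0 g0; rewrite scaler0 addr0 scaleN1r addNr.
Qed.

Lemma cmapB n x y : graded n x -> graded n y -> f (x - y) = f x - f y.
Proof. by move=> gx gy; rewrite addrC -scaleN1r (cmap_linear fC _ gy gx) scaleN1r addrC. Qed.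

Lemma cmap_coboundary n x : coboundary n x -> coboundary n (f x).
Proof.
move=> [y gy ->]; exists (f y); first exact: cmap_graded gy.
exact: (cmap_dif fC (gy : homog (n - 1, y))).
Qed.

(** A cohomology class is a set of cocycles, so the image class is obtained by
    choosing a representative; the choice does not matter. *)
Lemma induced_map n : exists phi : cohomology X n -> cohomology Y n,
  forall c z, cocycle n z -> sval c = coh_class n z -> sval (phi c) = coh_class n (f z).
Proof.
have rep (c : cohomology X n) : {z : X | cocycle n z & sval c = coh_class n z}.
  by case: c => c /= /cid2.
have phiP (c : cohomology X n) : exists2 z : Y, cocycle n z
    & coh_class n (f (s2val (rep c))) = coh_class n z.
  by exists (f (s2val (rep c))) => //; apply: cmap_cocycle; apply: s2valP.
exists (fun c => exist (fun C => exists2 z : Y, cocycle n z & C = coh_class n z) _ (phiP c)).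
move=> c z cz cE /=.
case: (rep c) => w /= cw cE'; apply: eq_coh_class => //.
rewrite -(cmapB cw.1 cz.1); apply: cmap_coboundary.
suff [] : coh_class n z w by [].
by rewrite -cE cE'; apply: coh_class_refl.
Qed.
End InducedMap.

Lemma eq_cohomology (K : fieldType) (X : bdga_data K) n (c d : cohomology X n) :
  sval c = sval d -> c = d.
Proof. by case: c d => [c cP] [d dP] /= cd; apply: eq_exist. Qed.

(** On cohomology g is a left inverse of f by the first condition on g, and a
    right inverse by the second one. *)
Lemma retract_quasi_iso (K : fieldType) (X Y : bdga_data K) (f : X -> Y) (g : Y -> X) :
  is_bdga (normalize X) -> is_bdga (normalize Y) ->
  cochain_map f -> cochain_map g ->
  (forall (n : int) x, graded n x -> g (f x) = x) ->
  (forall (n : int) y, cocycle n y -> coboundary n (f (g y) - y)) ->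
  quasi_iso f.
Proof.
move=> bX bY fC gC gf fg; split=> [||n]; [exact: cmap_graded|exact: cmap_dif|].
have [phi phiE] := induced_map bX bY fC n; have [psi psiE] := induced_map bY bX gC n.
exists phi => //; exists psi => [c|d]; apply: eq_cohomology.
  have [z cz cE] := svalP c.
  rewrite (psiE _ _ (cmap_cocycle bX fC cz) (phiE _ _ cz cE)) (gf n) //; exact: cz.1.
have [z cz dE] := svalP d.
rewrite (phiE _ _ (cmap_cocycle bY gC cz) (psiE _ _ cz dE)) dE.
by apply: eq_coh_class => //; apply: fg.
Qed.

(** * Coefficients in the incidence algebra *)

Section IncidenceCoefficients.
Variables (K : fieldType) (T : finType) (Sigma : {set {set T}}).
Local Notation A := (incidence K Sigma).
Local Notation face := (face Sigma).
Local Notation e := (basis_elt K).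
Implicit Types (b d : A) (s t u v : face).

Lemma inc_coefN (x : A) s t : coef (- x) s t = - coef x s t.
Proof. by rewrite -scaleN1r Defs.coefZ mulN1r. Qed.

Lemma inc_coef_sum (I : Type) (r : seq I) (P : pred I) (F : I -> A) s t :
  coef (\sum_(i <- r | P i) F i) s t = \sum_(i <- r | P i) coef (F i) s t.
Proof.
apply: (big_morph (fun x : A => coef x s t)) => [x y|].
  exact: Defs.coefD.
exact: Defs.coef0.
Qed.

Lemma in_S_basis s : in_S (e s s : A).
Proof. by move=> P _ _ _; apply. Qed.

(** The matrices with vanishing off-diagonal coefficients form a subalgebra
    containing the idempotents (s, s). *)
Lemma in_S_diag (d : A) : in_S d -> forall s t, s != t -> coef d s t = 0.
Proof.
move=> dS; apply: (dS (fun d => forall s t, s != t -> coef d s t = 0))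
  => [s t st|k b c Pb Pc s t st|b c Pb Pc s t st|u s t st].
- by rewrite -[1]/(inc_one K Sigma) coef_one (negbTE st).
- by rewrite Defs.coefD Defs.coefZ Pb ?Pc // mulr0 addr0.
- rewrite coef_mul (bigD1 s) //= Pc // mulr0 add0r big1 // => u us.
  by rewrite Pb ?mul0r // eq_sym.
rewrite coef_basis; case: eqP => [su|]; case: eqP => // tu.
by rewrite su tu eqxx in st.
Qed.

Lemma coef_mulS (d b : A) s t : in_S d -> coef (d * b) s t = coef d s s * coef b s t.
Proof.
move=> dS; rewrite coef_mul (bigD1 s) //= big1 ?addr0 // => u us.
by rewrite (in_S_diag dS) ?mul0r // eq_sym.
Qed.

Lemma coef_mulrS (d b : A) s t : in_S d -> coef (b * d) s t = coef b s t * coef d t t.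
Proof.
move=> dS; rewrite coef_mul (bigD1 t) //= big1 ?addr0 // => u ut.
by rewrite (in_S_diag dS) ?mulr0.
Qed.

Lemma coef_basisS s t : coef (e s s : A) t t = (t == s)%:R.
Proof. by rewrite coef_basis face_le_refl andbT andbb. Qed.

Lemma coef_idemr u (b : A) s t : coef (b * e u u) s t = coef b s t * (t == u)%:R.
Proof. by rewrite (coef_mulrS _ _ _ (in_S_basis u)); congr (_ * _); apply: coef_basisS. Qed.

Lemma coef_ideml u (b : A) s t : coef (e u u * b) s t = (s == u)%:R * coef b s t.
Proof. by rewrite (coef_mulS _ _ _ (in_S_basis u)); congr (_ * _); apply: coef_basisS. Qed.

Lemma basis_mul_id v u : e v u * e u u = e v u :> A.
Proof.
apply: incidenceP => s t _; rewrite coef_idemr.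
have [->|tu] := eqVneq t u; rewrite ?mulr1 // mulr0.
by rewrite coef_basis (negbTE tu) andbF.
Qed.

Lemma basis_mul_expand u (b : A) : e u u * b = \sum_w coef b u w *: e u w.
Proof.
apply: incidenceP => s t st; rewrite coef_ideml.
rewrite (big_morph (fun x : A => coef x s t) (id1 := 0) (op1 := +%R)) => [|c d|]; last first.
- exact: Defs.coef0.
- exact: Defs.coefD.
under eq_bigr => w _ do rewrite Defs.coefZ coef_basis.
have [su|su] := eqVneq s u; last by rewrite mul0r big1 // => w _; rewrite mulr0.
rewrite mul1r (bigD1 t) //= eqxx -su st mulr1 big1 ?addr0 // => w wu.
by rewrite eq_sym (negbTE wu) mulr0.
Qed.

Lemma mul_basis_expand b u : b * e u u = \sum_s coef b s u *: e s u.
Proof.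
apply: incidenceP => s t st; rewrite coef_idemr inc_coef_sum.
under eq_bigr => w _ do rewrite Defs.coefZ coef_basis.
have [tu|tu] := eqVneq t u; last first.
  by rewrite mulr0 big1 // => w _; rewrite andbF mulr0.
rewrite mulr1 (bigD1 s) //= eqxx -tu st mulr1 big1 ?addr0 // => w ws.
by rewrite eq_sym (negbTE ws) mulr0.
Qed.

End IncidenceCoefficients.

(** An identity between linear combinations with sign coefficients is checked
    coefficientwise, where it lives in a field, for each parity of the degrees. *)
Ltac coef_ring :=
  apply: incidenceP => ? ? _;
  rewrite ?(Defs.coefD, Defs.coefZ, inc_coefN, Defs.coef0) ?sgn_oddz ?oddzE;
  repeat match goal with |- context [oddz ?x] => case: (oddz x) end;
  rewrite /= ?expr0 ?expr1; ring.

(** * Hochschild cochains as functions of words *)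

Section WordCochains.
Variables (K : fieldType) (T : finType) (Sigma : {set {set T}}).
Local Notation A := (incidence K Sigma).
Local Notation E := (int * (seq A -> A))%type.
Implicit Types (v w : E) (vs ws : seq E) (f g : seq A -> A) (a : seq A).

(** The degree of a cochain as an operation on words whose letters have degree -1. *)
Definition shifted v : int := v.1 - 1.
Definition evaluate v a : A := v.2 a.
Local Notation wl := (fun _ : A => (-1) : int).
(** The degree of a single letter: a cochain consumes exactly the factors whose
    length is its number of arguments. *)
Definition fits : pred int := pred1 (-1).
Local Notation insA := (insert shifted wl fits evaluate).

Definition plug f vs : seq A -> A := fun a => insA vs a f.
Definition plugged v vs : E := (v.1 + weight shifted vs, plug v.2 vs).
Definition cup f g : seq A -> A := fun a => cutsum a (fun l r => f l * g r).
Definition id_cochain : seq A -> A := fun a => if a is [:: b] then b else 0.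
Definition mult_cochain : seq A -> A := fun a => if a is [:: b; c] then b * c else 0.
(** The multiplication mu with its degree. *)
Definition mult_arg : E := (2, mult_cochain).

(** The alternating sum over the products of two adjacent letters, that is, the
    inner part of the Hochschild coboundary. *)
Fixpoint contract (V : zmodType) a (F : seq A -> V) : V :=
  if a is b :: a' then
    if a' is c :: r then F (b * c :: r) - contract a' (fun l => F (b :: l)) else 0
  else 0.

Lemma evaluate_weight v a : fits (shifted v + weight wl a) -> wl (evaluate v a) = shifted v + weight wl a.
Proof. by move=> /eqP->. Qed.

Lemma fits_size v a : fits (shifted v + weight wl a) = ((size a)%:Z == v.1).
Proof. rewrite /fits /= weight_const /shifted; lia. Qed.

Lemma graded_size n f a : hoch_graded n f -> (size a)%:Z != n -> f a = 0.
Proof. by case=> f0 _ /eqP; apply: f0. Qed.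

Lemma graded_multilinear n f : hoch_graded n f -> multilinear f.
Proof. by case. Qed.

(** All words in the insertion have the length prescribed by the degrees. *)
Lemma eq_plug_size vs f g a :
  (forall b, (size b)%:Z + weight shifted vs = (size a)%:Z -> (size vs <= size b)%N -> f b = g b) ->
  plug f vs a = plug g vs a.
Proof.
move=> fg; apply: eq_insert_weight; first exact: evaluate_weight.
by move=> b; rewrite !weight_const => sb; apply: fg; lia.
Qed.

Lemma hoch_graded_plug n f vs : hoch_graded n f ->
  (forall v, List.In v vs -> multilinear v.2) -> hoch_graded (n + weight shifted vs) (plug f vs).
Proof.
move=> fn vsl; split=> [a sa|].
  rewrite (@eq_plug_size _ _ (fun=> 0)) => [|b sb _]; first exact: insert0.
  by apply: (graded_size fn); apply/eqP => bn; apply: sa; rewrite -sb bn.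
apply: insert_multilinear (graded_multilinear fn) _ => k kvs x0; apply: vsl.
elim: vs k kvs => //= v vs IH [|k] kvs; [by left|right; exact: IH].
Qed.

(** Words of the wrong length need no separate test, since x vanishes on the words
    that the insertion produces from them.  The signs agree because every letter
    has degree -1. *)
Lemma hoch_braceE v vs : hoch_graded v.1 v.2 -> hoch_brace v vs = plug v.2 vs.
Proof.
move=> hv; apply/funext => a; rewrite /hoch_brace; case: eqP => sa; last first.
  rewrite (@eq_plug_size _ _ (fun=> 0)) => [|b sb _]; first by rewrite /plug insert0.
  by apply: (graded_size hv); apply/eqP => bn; apply: sa; rewrite -sb bn.
rewrite /plug -(sum_cuts_insert shifted wl fits evaluate 0 vs a); apply: eq_sum_cuts => i j ij.
have -> : [forall k : 'I_(size vs), fits (shifted vs`_k + weight wl (slice a (i k) (j k)))]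
    = [forall k : 'I_(size vs), (j k)%:Z == (i k)%:Z + (vs`_k).1].
  apply: eq_forallb => k; rewrite fits_size /slice size_drop.
  have [_ ijk jk] := ij k (ltn_ord k); rewrite size_takel //.
  by rewrite -subzn // subr_eq addrC.
case: ifP => // _; congr (_ *: _); apply: eq_sgn.
rewrite -[RHS]oddzN -sumrN; congr oddz; apply: eq_bigr => k _.
have [_ ijk jk] := ij k (ltn_ord k).
rewrite weight_const size_takel; last exact: leq_trans jk.
by rewrite /shifted; ring.
Qed.

(** Of all the cuts of a word only the one after |v| letters contributes. *)
Lemma hoch_mulE v w : hoch_graded v.1 v.2 -> hoch_graded w.1 w.2 ->
  hoch_mul v w = cup v.2 w.2.
Proof.
move=> hv hw; apply/funext => a; rewrite /hoch_mul /cup.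
have [v0|v0] := boolP (v.1 < 0).
  have vE l : v.2 l = 0 by apply: (graded_size hv); lia.
  rewrite vE mul0r if_same -[LHS](cutsum0 _ a).
  by apply: eq_cutsum => l r _; rewrite vE mul0r.
rewrite (@cutsum_size _ _ a `|v.1|%N) => [|p q sp]; last first.
  by rewrite (graded_size hv) ?mul0r //; lia.
case: leqP => va; last first.
  by rewrite take_oversize 1?ltnW // (graded_size hv) ?mul0r ?if_same //; lia.
case: eqP => // sa; rewrite (graded_size hw) ?mulr0 // size_drop; lia.
Qed.

Lemma cup_size m n f g a : hoch_graded m f -> hoch_graded n g ->
  (size a)%:Z != m + n -> cup f g a = 0.
Proof.
move=> fm gn sa; rewrite -[RHS](cutsum0 _ a); apply: eq_cutsum => l r aE.
have [lm|/(graded_size fm)->] := eqVneq (size l)%:Z m; last by rewrite mul0r.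
rewrite (graded_size gn) ?mulr0 //; move: sa; rewrite aE size_cat; lia.
Qed.

Lemma hoch_graded_cup m n f g : hoch_graded m f -> hoch_graded n g ->
  hoch_graded (m + n) (cup f g).
Proof.
move=> fm gn; split=> [a /eqP sa|l r k b c]; first exact: cup_size sa.
rewrite /cup !cutsum_cat scalerDr addrACA -!cutsumZ -!cutsumD; congr (_ + _).
  apply: eq_cutsum => p q _.
  by rewrite (graded_multilinear gn) mulrDr -inc_scaleAr.
apply: eq_cutsum => p q _.
by rewrite (graded_multilinear fm) mulrDl -inc_scaleAl.
Qed.

Lemma cupA f g h : cup f (cup g h) = cup (cup f g) h.
Proof.
apply/funext => a; rewrite /cup.
transitivity (cutsum a (fun l r => cutsum r (fun p q => f l * (g p * h q)))).
  by apply: eq_cutsum => l r _; rewrite !cutsumE mulr_sumr.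
rewrite (cutsum_cut a (fun l p q => f l * (g p * h q))).
apply: eq_cutsum => l r _.
rewrite !cutsumE mulr_suml; apply: eq_bigr => k _; exact: mulrA.
Qed.

Lemma cupDl f g h : cup (f + g) h = cup f h + cup g h.
Proof.
apply/funext => a; rewrite -[RHS]/(cup f h a + cup g h a) -cutsumD.
by apply: eq_cutsum => l r _; rewrite mulrDl.
Qed.

Lemma cupDr f g h : cup h (f + g) = cup h f + cup h g.
Proof.
apply/funext => a; rewrite -[RHS]/(cup h f a + cup h g a) -cutsumD.
by apply: eq_cutsum => l r _; rewrite mulrDr.
Qed.

Lemma cupZl k f g : cup (k *: f) g = k *: cup f g.
Proof.
apply/funext => a; rewrite -[RHS]cutsumZ; apply: eq_cutsum => l r _.
by rewrite inc_scaleAl.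
Qed.

Lemma cupZr k f g : cup g (k *: f) = k *: cup g f.
Proof.
apply/funext => a; rewrite -[RHS]cutsumZ; apply: eq_cutsum => l r _.
by rewrite inc_scaleAr.
Qed.

Lemma insert_mulr ws a f (c : A) : insA ws a f * c = insA ws a (fun b => f b * c).
Proof.
have [ts tsE] := insert_terms (K := K) shifted wl fits evaluate ws a.
by rewrite !tsE mulr_suml; apply: eq_bigr => t _; rewrite inc_scaleAl.
Qed.

Lemma insert_mull ws a f (c : A) : c * insA ws a f = insA ws a (fun b => c * f b).
Proof.
have [ts tsE] := insert_terms (K := K) shifted wl fits evaluate ws a.
by rewrite !tsE mulr_sumr; apply: eq_bigr => t _; rewrite inc_scaleAr.
Qed.

(** Insertion followed by deconcatenation, evaluated with f on the first factor
    and g on the second one. *)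
Lemma plug_cup f g vs a : plug (cup f g) vs a
  = cutsum vs (fun vs0 vs1 => cutsum a (fun a0 a1 =>
      sgn K ((size a0)%:Z * weight shifted vs1) *: (plug f vs0 a0 * plug g vs1 a1))).
Proof.
rewrite /plug /cup insert_comult.
apply: eq_cutsum => vs0 vs1 _; apply: eq_cutsum => a0 a1 _.
rewrite insert_mulr; congr (_ *: _).
  by apply: eq_sgn; rewrite weight_const mulN1r mulNr oddzN.
by apply: eq_insert => b0; rewrite insert_mull.
Qed.

Lemma hoch_graded_id_cochain : hoch_graded 1 id_cochain.
Proof.
split=> [[|b [|]] //|[|x [|y l]] [|z r] k b c] /=; by rewrite ?scaler0 ?addr0.
Qed.

(** Writing mu as a cup product reduces the braces on mu to [plug_cup]. *)
Lemma mult_cochain_cup : mult_cochain = cup id_cochain id_cochain.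
Proof.
apply/funext => -[|b [|c [|d a]]]; rewrite /cup /=.
- by rewrite ?(mul0r, mulr0, add0r, addr0).
- by rewrite ?(mul0r, mulr0, add0r, addr0).
- by rewrite ?(mul0r, mulr0, add0r, addr0).
- rewrite ?(mul0r, mulr0, add0r) -[LHS](cutsum0 _ a); apply: eq_cutsum => p q _.
  by rewrite mul0r.
Qed.

Lemma hoch_graded_mult_cochain : hoch_graded 2 mult_cochain.
Proof. rewrite mult_cochain_cup; exact: hoch_graded_cup hoch_graded_id_cochain hoch_graded_id_cochain. Qed.

Lemma id_plug1 v : hoch_graded v.1 v.2 -> plug id_cochain [:: v] = v.2.
Proof.
move=> hv; apply/funext => a; rewrite /plug /= cutsum_first => [|b p q].
  rewrite cutsum_last => [|b p q].
    rewrite fits_size !weightE mul0r mulr0 addr0 scale1r /=.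
    by case: eqP => // /eqP sa; rewrite (graded_size hv).
  by case: ifP; rewrite ?scaler0.
rewrite -[RHS](cutsum0 _ q); apply: eq_cutsum => l r _; case: ifP => //.
by case: p => [|? p]; rewrite ?scaler0.
Qed.

Lemma plug_small f vs n a : hoch_graded n f -> n < (size vs)%:Z -> plug f vs a = 0.
Proof.
move=> fn nvs.
rewrite (@eq_plug_size _ _ (fun=> 0)) => [|b _ sb]; first by rewrite /plug insert0.
by apply: (graded_size fn); lia.
Qed.

Lemma cup_signl (s : int) n f g : hoch_graded n f -> forall a,
  cutsum a (fun l r => sgn K ((size l)%:Z * s) *: (f l * g r)) = sgn K (n * s) *: cup f g a.
Proof.
move=> fn a; rewrite -cutsumZ; apply: eq_cutsum => l r _.
have [->//|/(graded_size fn)->] := eqVneq (size l)%:Z n.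
by rewrite mul0r !scaler0.
Qed.

(** The terms in which mu multiplies v by a letter on the left or on the right are
    the outer terms of the Hochschild coboundary of v. *)
Lemma mult_plug1 v : hoch_graded v.1 v.2 ->
  plug mult_cochain [:: v] = sgn K (v.1 - 1) *: cup id_cochain v.2 + cup v.2 id_cochain.
Proof.
move=> hv; apply/funext => a; rewrite mult_cochain_cup plug_cup /= addr0; congr (_ + _).
  rewrite (cup_signl _ _ hoch_graded_id_cochain) id_plug1 // mul1r.
  by rewrite !weightE addr0.
rewrite id_plug1 // /cup; apply: eq_cutsum => l r _.
by rewrite weightE mulr0 scale1r.
Qed.

Lemma mult_plug2 v w : hoch_graded v.1 v.2 -> hoch_graded w.1 w.2 ->
  plug mult_cochain [:: v; w] = sgn K (v.1 * (w.1 - 1)) *: cup v.2 w.2.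
Proof.
move=> hv hw; apply/funext => a; rewrite mult_cochain_cup plug_cup /= addr0.
rewrite !id_plug1 //.
rewrite -[RHS]add0r -[RHS]addr0 -addrA; congr (_ + (_ + _)).
- by rewrite -[RHS](cutsum0 _ a); apply: eq_cutsum => l r _; rewrite (@plug_small id_cochain [:: v; w] _ _ hoch_graded_id_cochain) // mulr0 scaler0.
- by rewrite (cup_signl _ _ hv) !weightE addr0.
- by rewrite -[RHS](cutsum0 _ a); apply: eq_cutsum => l r _; rewrite (@plug_small id_cochain [:: v; w] _ _ hoch_graded_id_cochain) // mul0r scaler0.
Qed.

Lemma fits_mult_arg a : fits (shifted mult_arg + weight wl a) = (size a == 2)%N.
Proof. by rewrite fits_size -[mult_arg.1]/(2%N%:Z) eqz_nat. Qed.

(** Inserting mu multiplies two adjacent letters, with sign (-1)^i after i letters;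
    these are the inner terms of the Hochschild coboundary. *)
Lemma plug_mult f a : plug f [:: mult_arg] a = contract a f.
Proof.
rewrite /plug; elim: a f => [|b a IH] f.
  by rewrite /= fits_mult_arg /= !addr0.
rewrite insert_cons IH weight_nil addr0 (@eq_sgn K _ 1) // -[sgn K 1]/(-1) scaleN1r.
rewrite (@cutsum_size _ _ (b :: a) 2) => [|a1 a2]; last by rewrite fits_mult_arg => /negbTE->.
rewrite fits_mult_arg mulr0 scale1r.
case: a {IH} => [|c a] /=; first by rewrite subr0.
by rewrite /evaluate /= take0 drop0.
Qed.

Lemma contractE (V : lmodType K) a (F : seq A -> V) :
  contract a F = \sum_(i < (size a).-1)
    (-1) ^+ i *: F (take i a ++ a`_i * a`_i.+1 :: drop i.+2 a).
Proof.
elim: a F => [|b [|c a] IH] F; rewrite ?big_ord0 //.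
rewrite -[LHS]/(F (b * c :: a) - contract (c :: a) (fun l => F (b :: l))) IH.
rewrite [RHS]big_ord_recl /= drop0 scale1r; congr (_ + _).
rewrite -sumrN; apply: eq_bigr => i _ /=.
by rewrite exprS mulN1r scaleNr.
Qed.

Lemma cup_idl f b r : cup id_cochain f (b :: r) = b * f r.
Proof.
rewrite /cup /= mul0r add0r cutsum_first // => c p q; by rewrite mul0r.
Qed.

Lemma cup_idr f l b : cup f id_cochain (rcons l b) = f l * b.
Proof.
rewrite /cup cutsum_rcons mulr0 addr0 cutsum_last // => c p q.
by case: q => [|d q]; rewrite mulr0.
Qed.

Lemma hoch_difE v : hoch_graded v.1 v.2 ->
  hoch_dif v = cup id_cochain v.2 + sgn K (v.1 + 1) *: cup v.2 id_cochain - plug v.2 [:: mult_arg].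
Proof.
move=> hv; apply/funext => a; rewrite /hoch_dif; case: eqP => sa; last first.
  have brg : hoch_graded (v.1 + 1) (plug v.2 [:: mult_arg]).
    have := @hoch_graded_plug v.1 v.2 [:: mult_arg] hv; rewrite weight_cons weight_nil addr0; apply.
    by move=> u [<-|//]; apply: graded_multilinear hoch_graded_mult_cochain.
  have sa1 : (size a)%:Z != 1 + v.1 by rewrite addrC; exact/eqP.
  rewrite !fctE (cup_size hoch_graded_id_cochain hv sa1).
  have sa2 : (size a)%:Z != v.1 + 1 by exact/eqP.
  by rewrite (cup_size hv hoch_graded_id_cochain sa2) (graded_size brg sa2) scaler0 addr0 subr0.
rewrite !fctE plug_mult.
have [v0|v0] := boolP (v.1 < 0).
  have vE l : v.2 l = 0 by apply: (graded_size hv); lia.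
  have aE : a = [::] by apply/size0nil; lia.
  rewrite aE /cup /= !addr0 !mulr0 !vE mul0r scaler0 !add0r.
  by rewrite big1 => [|i _]; rewrite ?vE ?mul0r ?scaler0 ?addr0 ?oppr0.
have {}sa : size a = `|v.1|.+1 by lia.
case: a sa => // b r /= [sr]; rewrite cup_idl.
rewrite -!addrA; congr (_ + _); rewrite -[X in _ - X]/(contract (b :: r) v.2).
have -> : cup v.2 id_cochain (b :: r) = v.2 (take `|v.1| (b :: r)) * (b :: r)`_`|v.1|.
  have -> : take `|v.1| (b :: r) = belast b r.
    by rewrite lastI -sr -(size_belast b r) -cats1 take_size_cat.
  by rewrite {1}lastI cup_idr -sr -[size r in RHS]/((size (b :: r)).-1) nth_last.
rewrite addrC; congr (_ + _).
  by congr (_ *: _); rewrite sgn_oddz -signr_odd; congr ((-1) ^+ _); rewrite /oddz; lia.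
rewrite contractE /= sr -sumrN big_add1 big_mkord /=.
by apply: eq_bigr => i _; rewrite exprS mulN1r scaleNr.
Qed.

End WordCochains.

(** * The identities of Hochschild cochains *)

Section HochschildBDGA.
Variables (K : fieldType) (T : finType) (Sigma : {set {set T}}).
Local Notation A := (incidence K Sigma).
Local Notation CH := (hochschild K Sigma).
Local Notation NH := (normalize CH).
Local Notation E := (int * (seq A -> A))%type.
Local Notation star :=
  (insert (@shifted K T Sigma) (@shifted K T Sigma) xpredT (@plugged K T Sigma)).
Local Notation sd := (weight (@shifted K T Sigma)).
Local Notation mult_arg := (mult_arg K Sigma).
Local Notation mult_cochain := (@mult_cochain K T Sigma).
Local Notation id_cochain := (@id_cochain K T Sigma).
Implicit Types (v w x y : int * CH) (vs ws : seq (int * CH)).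
Implicit Types (f g h : seq A -> A) (a : seq A).

Lemma all_homog_multilinear vs : all_homog vs -> forall v, List.In v vs -> multilinear (v.2 : seq A -> A).
Proof.
move=> hvs v vvs; suff /hvs[] : v \in vs by [].
elim: vs vvs {hvs} => //= w vs IH [->|/IH]; rewrite inE ?eqxx // => ->.
by rewrite orbT.
Qed.

(** The brace identity in terms of words: [insert_comp] for operations acting on
    letters. *)
Lemma plug_comp f vs ws a : multilinear f ->
  plug (plug f vs) ws a = star vs ws (fun xs => plug f xs a).
Proof.
move=> flin; apply: insert_comp => //; first exact: evaluate_weight.
by move=> v us; rewrite {1 2}/shifted /plugged /= addrAC.
Qed.

Lemma hbraceE v vs : homog v -> hbrace v vs = plugged v vs.
Proof. by move=> hv; rewrite /hbrace /plugged /= hoch_braceE. Qed.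

Lemma homog_plugged v vs : homog v -> all_homog vs -> homog (plugged v vs : int * CH).
Proof. by move=> hv hvs; apply: hoch_graded_plug => //; apply: all_homog_multilinear. Qed.

Lemma hochschild_brace_brace v vs ws : homog v -> all_homog vs -> all_homog ws ->
  brace (hbrace v vs) ws
    = sum_cuts (size vs) (size ws) (fun i j =>
        sgn K (\sum_(k < size vs) ((vs`_k).1 - 1) * sdeg (take (i k) ws))
        *: brace v (splice ws (size vs) i j
                      (fun k => hbrace vs`_k (slice ws (i k) (j k))))).
Proof.
move=> hv hvs hws; rewrite hbraceE // -[LHS]/(hoch_brace (plugged v vs) ws).
rewrite hoch_braceE; last exact: homog_plugged.
apply/funext => a; rewrite sum_cuts_fct [LHS]plug_comp; last exact: graded_multilinear hv.
rewrite -(sum_cuts_insert _ _ _ _ 0); apply: eq_sum_cuts => i j _.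
rewrite ifT; last by apply/forallP.
rewrite -[RHS]/(_ *: hoch_brace v _ a) hoch_braceE //.
congr (_ *: plug _ _ a); apply: eq_splice => k kvs; rewrite hbraceE //.
by apply: hvs; apply: mem_nth.
Qed.

(** The factor (-1)^(|v||w|) of the normalized product absorbs the signs that appear
    when the inserted operations pass the letters consumed by v. *)
Lemma hochschild_brace_mul v w vs : homog v -> homog w -> all_homog vs ->
  brace (@hmul K (normalize CH) v w : int * CH) vs
    = \sum_(k < (size vs).+1)
        sgn K (w.1 * sdeg (take k vs))
        *: @Defs.mul K (normalize CH) (hbrace v (take k vs)) (hbrace w (drop k vs)).
Proof.
move=> hv hw hvs; rewrite -[LHS]/(hoch_brace (v.1 + w.1, sgn K (v.1 * w.1) *: hoch_mul v w) vs).
have hvw : hoch_graded (v.1 + w.1) (sgn K (v.1 * w.1) *: hoch_mul v w).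
  rewrite hoch_mulE // -cupZl; apply: hoch_graded_cup => //.
  split=> [a sa|l r k b c]; rewrite !fctE; first by rewrite (graded_size hv) ?scaler0 //; apply/eqP.
  by rewrite (graded_multilinear hv) scalerDr scaler_swap.
rewrite hoch_braceE // hoch_mulE // -cupZl; apply/funext => a.
rewrite plug_cup cutsumE fct_sumE; apply: eq_bigr => k _.
set vs0 := take k vs; set vs1 := drop k vs.
rewrite !hbraceE // -[RHS]/(_ *: (sgn K ((plugged v vs0).1 * (plugged w vs1).1) *: hoch_mul (plugged v vs0) (plugged w vs1) a)).
have hv0 : homog (plugged v vs0 : int * CH) by apply: homog_plugged => //; apply: all_homog_take.
have hw1 : homog (plugged w vs1 : int * CH) by apply: homog_plugged => //; apply: all_homog_drop.
rewrite hoch_mulE // scalerA /cup -[RHS]cutsumZ; apply: eq_cutsum => l r _.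
have -> : plug (sgn K (v.1 * w.1) *: v.2) vs0 l = sgn K (v.1 * w.1) *: plug v.2 vs0 l.
  by rewrite /plug -insertZ.
have [sl|/(graded_size hv0) /= ->] := eqVneq (size l)%:Z (plugged v vs0).1; last first.
  by rewrite scaler0 mul0r !scaler0.
rewrite -inc_scaleAl scalerA -!sgnD sl /=; congr (_ *: _); apply: eq_sgn.
rewrite -[sdeg vs0]/(weight (@shifted K T Sigma) vs0).
by move: (weight _ vs0) (weight _ vs1) v.1 w.1 => d0 d1 n m; parity_tac.
Qed.

Lemma hoch_graded0 n : @hoch_graded K T Sigma n 0.
Proof. by split=> // l r k b c; rewrite scaler0 addr0. Qed.

Lemma hoch_gradedP n k f g : hoch_graded n f -> hoch_graded n g -> hoch_graded n (k *: f + g).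
Proof.
move=> [f0 fl] [g0 gl]; split=> [a sa|l r k' b c]; rewrite !fctE.
  by rewrite f0 // g0 // scaler0 addr0.
by rewrite fl gl !scalerDr scaler_swap addrACA.
Qed.

Lemma hoch_gradedZ n k f : hoch_graded n f -> hoch_graded n (k *: f).
Proof. by move=> fn; rewrite -[_ *: _]addr0; apply: hoch_gradedP => //; apply: hoch_graded0. Qed.

Lemma hoch_gradedD n f g : hoch_graded n f -> hoch_graded n g -> hoch_graded n (f + g).
Proof. by move=> fn gn; rewrite -[f]scale1r; apply: hoch_gradedP. Qed.

Lemma plugD f g vs : plug (f + g) vs = plug f vs + plug g vs.
Proof. by apply/funext => a; apply: insertD. Qed.

Lemma plugZ k f vs : plug (k *: f) vs = k *: plug f vs.
Proof. by apply/funext => a; apply: insertZ. Qed.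

Lemma plug_cup_mult n f g : hoch_graded n f ->
  plug (cup f g) [:: mult_arg] = cup (plug f [:: mult_arg]) g + sgn K n *: cup f (plug g [:: mult_arg]).
Proof.
move=> fn; apply/funext => a; rewrite plug_cup /= addr0 addrC; congr (_ + _).
  by apply: eq_cutsum => l r _; rewrite weight_nil mulr0 scale1r.
rewrite -[RHS]/(sgn K n *: cup f _ a) -[n in RHS]mulr1 -(cup_signl _ _ fn).
by apply: eq_cutsum => l r _; rewrite weight_cons weight_nil.
Qed.

Lemma eq_contract (V : zmodType) b a (F G : seq A -> V) :
  (forall c l, F (c :: l) = G (c :: l)) -> contract (b :: a) F = contract (b :: a) G.
Proof.
elim: a b F G => // c a IH b F G FG.
rewrite -[LHS]/(F (b * c :: a) - contract (c :: a) (fun l => F (b :: l))) FG.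
by congr (_ - _); apply: (IH c (fun l => F (b :: l)) (fun l => G (b :: l))).
Qed.

Lemma contract_cons (V : zmodType) b c a (F : seq A -> V) :
  contract (b :: c :: a) F = F (b * c :: a) - contract (c :: a) (fun l => F (b :: l)).
Proof. by []. Qed.

Lemma contractB (V : zmodType) a (F G : seq A -> V) :
  contract a (fun l => F l - G l) = contract a F - contract a G.
Proof.
elim: a F G => [|b [|c a] IH] F G; rewrite ?subr0 // !contract_cons IH.
rewrite !opprB addrACA [RHS]addrACA; congr (_ + _); exact: addrC.
Qed.

(** Contracting twice at disjoint places occurs in both orders with opposite signs,
    and the two ways of contracting three adjacent letters cancel by
    associativity. *)
Lemma contract_contract (V : zmodType) a (F : seq A -> V) : contract a (fun l => contract l F) = 0.
Proof.
elim: a F => [|b [|c a] IH] F //; rewrite contract_cons.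
case: a IH => [|d a] IH; first by rewrite subr0.
(* The words l are contractions of c :: d :: a, hence not empty. *)
have -> : contract [:: c, d & a] (fun l => contract (b :: l) F)
    = contract [:: c, d & a] (fun l => F (b * head 0 l :: behead l)
        - contract l (fun m => F (b :: m))).
  exact: eq_contract.
rewrite contractB IH subr0 !contract_cons -mulrA; exact: subrr.
Qed.

Lemma plug_mult_mult f : plug (plug f [:: mult_arg]) [:: mult_arg] = 0.
Proof.
apply/funext => a; rewrite plug_mult -[RHS](contract_contract a f).
by congr contract; apply/funext => b; rewrite plug_mult.
Qed.

Lemma ndifE v : homog v ->
  @dif K NH v = sgn K (v.1 - 1) *: cup id_cochain v.2 + cup v.2 id_cochain
                + sgn K v.1 *: plug v.2 [:: mult_arg].
Proof.
move=> hv; rewrite -[LHS]/(sgn K (v.1 + 1) *: hoch_dif v) hoch_difE //.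
rewrite scalerBr scalerDr scalerA sgn_sq scale1r -scaleNr.
congr (_ *: _ + _ + _ *: _); first by apply: eq_sgn; parity_tac.
by rewrite sgnD -[sgn K 1]/(-1) mulrN1 opprK.
Qed.

(** The normalized differential as a bracket with mu; with [nmul_bracket] this
    expresses all operations through braces. *)
Lemma ndif_bracket v : homog v ->
  @dif K NH v = plug mult_cochain [:: v] + sgn K v.1 *: plug v.2 [:: mult_arg].
Proof. by move=> hv; rewrite ndifE // mult_plug1. Qed.

Lemma nmulE v w : homog v -> homog w -> @Defs.mul K NH v w = sgn K (v.1 * w.1) *: cup v.2 w.2.
Proof. by move=> hv hw; rewrite -[LHS]/(_ *: hoch_mul v w) hoch_mulE. Qed.

Lemma nmul_bracket v w : homog v -> homog w ->
  @Defs.mul K NH v w = sgn K v.1 *: plug mult_cochain [:: v; w].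
Proof.
move=> hv hw; rewrite nmulE // mult_plug2 // scalerA -sgnD; congr (_ *: _).
by apply: eq_sgn; parity_tac.
Qed.

Lemma homog_nmul v w : homog v -> homog w -> homog (@hmul K NH v w : int * CH).
Proof.
move=> hv hw; change (hoch_graded (v.1 + w.1) (@Defs.mul K NH v w)); rewrite nmulE //.
by apply: hoch_gradedZ; apply: hoch_graded_cup.
Qed.

Lemma hoch_graded_plug_mult n f : hoch_graded n f -> hoch_graded (n + 1) (plug f [:: mult_arg]).
Proof.
move=> fn; have := @hoch_graded_plug K T Sigma n f [:: mult_arg] fn.
rewrite weight_cons weight_nil addr0; apply=> u [<-|//]; exact: graded_multilinear (hoch_graded_mult_cochain _ _).
Qed.

Lemma homog_ndif v : homog v -> homog (@hdif K NH v : int * CH).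
Proof.
move=> hv; change (hoch_graded (v.1 + 1) (@dif K NH v)); rewrite ndifE //.
apply: hoch_gradedD; last exact/hoch_gradedZ/hoch_graded_plug_mult.
apply: hoch_gradedP; last exact: hoch_graded_cup hv (hoch_graded_id_cochain _ _).
rewrite addrC; exact: hoch_graded_cup (hoch_graded_id_cochain _ _) hv.
Qed.

Lemma ndif_ndif v : homog v -> @dif K NH (@hdif K NH v) = 0.
Proof.
move=> hv; rewrite ndifE; last exact: homog_ndif.
rewrite -[(@hdif K NH v).1]/(v.1 + 1) -[(@hdif K NH v).2]/(@dif K NH v) ndifE //.
rewrite !(cupDl, cupDr, cupZl, cupZr, plugD, plugZ).
rewrite plug_mult_mult (plug_cup_mult _ hv) (plug_cup_mult _ (hoch_graded_id_cochain K Sigma)).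
rewrite (id_plug1 (hoch_graded_mult_cochain K Sigma : hoch_graded mult_arg.1 mult_arg.2)).
rewrite -[(mult_arg).2]/mult_cochain mult_cochain_cup !cupA scaler0.
move: v.1 (v.2 : seq A -> A) hv => n f hv.
move: (cup (cup id_cochain id_cochain) f) (cup (cup id_cochain f) id_cochain) (cup id_cochain (plug f [:: mult_arg]))
  (cup (cup f id_cochain) id_cochain) (cup (plug f [:: mult_arg]) id_cochain) => x1 x2 x3 x4 x5.
by apply/funext => a; rewrite !fctE; coef_ring.
Qed.

Lemma ndif_nmul v w : homog v -> homog w ->
  @dif K NH (@hmul K NH v w) = @Defs.mul K NH (@hdif K NH v) w
    + sgn K v.1 *: @Defs.mul K NH v (@hdif K NH w).
Proof.
move=> hv hw; rewrite ndifE; last exact: homog_nmul.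
rewrite nmulE; [|exact: homog_ndif|by []].
rewrite nmulE; [|by []|exact: homog_ndif].
rewrite -[(@hdif K NH v).1]/(v.1 + 1) -[(@hdif K NH v).2]/(@dif K NH v).
rewrite -[(@hdif K NH w).1]/(w.1 + 1) -[(@hdif K NH w).2]/(@dif K NH w).
rewrite -[(@hmul K NH v w).1]/(v.1 + w.1) -[(@hmul K NH v w).2]/(@Defs.mul K NH v w) nmulE // !ndifE //.
rewrite !(cupDl, cupDr, cupZl, cupZr, plugD, plugZ) (plug_cup_mult _ hv) !cupA.
move: v.1 (v.2 : seq A -> A) w.1 (w.2 : seq A -> A) hv hw => n f m g hv hw.
move: (cup (cup id_cochain f) g) (cup (cup f id_cochain) g) (cup (cup f g) id_cochain)
  (cup (plug f [:: mult_arg]) g) (cup f (plug g [:: mult_arg])) => x1 x2 x3 x4 x5.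
by apply/funext => a; rewrite !fctE; coef_ring.
Qed.

Lemma nmul_assoc u v w : homog u -> homog v -> homog w ->
  @Defs.mul K NH (@hmul K NH u v) w = @Defs.mul K NH u (@hmul K NH v w).
Proof.
move=> hu hv hw; rewrite nmulE; [|exact: homog_nmul|by []].
rewrite nmulE; [|by []|exact: homog_nmul].
rewrite -[(@hmul K NH u v).1]/(u.1 + v.1) -[(@hmul K NH u v).2]/(@Defs.mul K NH u v).
rewrite -[(@hmul K NH v w).1]/(v.1 + w.1) -[(@hmul K NH v w).2]/(@Defs.mul K NH v w) !nmulE //.
rewrite !(cupZl, cupZr) !scalerA -!sgnD cupA; congr (_ *: _); apply: eq_sgn.
by move: u.1 v.1 w.1 => n m p; parity_tac.
Qed.

Lemma plugged_nil v : plugged v [::] = v.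
Proof. by case: v => n f; rewrite /plugged weight_nil addr0. Qed.

Lemma shifted_mult_arg : shifted mult_arg = 1. Proof. by []. Qed.

(** A single operation v consumes any consecutive factor p of the entries vs,
    which yields v{p}; [star] is the sum on the right of the brace identity. *)
Lemma star_single v vs (G : seq E -> A) :
  star [:: v] vs G = cutsum vs (fun l r => cutsum r (fun p q =>
    sgn K (sd l * shifted v) *: G (l ++ plugged v p :: q))).
Proof.
rewrite /=; apply: eq_cutsum => l r _; apply: eq_cutsum => p q _.
by rewrite weight_nil addr0 mulr0 addr0.
Qed.

Lemma star_nil vs (G : seq E -> A) : star vs [::] G = G vs.
Proof.
elim: vs G => [|x vs IH] G //=.
by rewrite !addr0 weight_nil !mul0r addr0 scale1r plugged_nil IH.
Qed.

(** One mu inserted into the entries stands between two of them or is consumed by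
    one of them. *)
Lemma star_mult_arg vs (G : seq E -> A) :
  star vs [:: mult_arg] G
  = cutsum vs (fun l r => sgn K (sd r) *: G (l ++ mult_arg :: r))
  + cutsum vs (fun l r => if r is x :: r' then
      sgn K (sd r') *: G (l ++ plugged x [:: mult_arg] :: r') else 0).
Proof.
elim: vs G => [|x vs IH] G.
  by rewrite /= weight_nil scale1r !addr0.
have -> : star (x :: vs) [:: mult_arg] G
    = star vs [:: mult_arg] (fun l => G (x :: l))
      + sgn K (sd vs) *: G (plugged x [:: mult_arg] :: vs) + sgn K (sd (x :: vs)) *: G (mult_arg :: x :: vs).
  rewrite /= !addr0 !weightE !plugged_nil !addr0 !mul0r !addr0 !scale1r shifted_mult_arg !mul1r add0r.
  by rewrite !star_nil.
rewrite IH /=.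
rewrite [LHS]addrC -[RHS]addrA; congr (_ + _).
by rewrite -addrA; congr (_ + _); exact: addrC.
Qed.

(** Having two arguments, mu consumes at most two consecutive entries. *)
Lemma star_single_mult_arg f vs a : multilinear f ->
  star [:: mult_arg] vs (fun xs => plug f xs a)
  = cutsum vs (fun l r => sgn K (sd l) *: plug f (l ++ mult_arg :: r) a)
  + cutsum vs (fun l r => if r is x :: r' then
      sgn K (sd l) *: plug f (l ++ plugged mult_arg [:: x] :: r') a else 0)
  + cutsum vs (fun l r => if r is x :: y :: r' then
      sgn K (sd l) *: plug f (l ++ plugged mult_arg [:: x; y] :: r') a else 0).
Proof.
move=> flin; rewrite star_single -!cutsumD; apply: eq_cutsum => l r _.
rewrite shifted_mult_arg mulr1 cutsumZ.
have z us p ws : (2 < size p)%N -> plug f (us ++ plugged mult_arg p :: ws) a = 0.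
  move=> sp; apply: insert_act0 => // b; apply: plug_small (hoch_graded_mult_cochain K Sigma) _.
  by lia.
case: r => [|x [|y r]] /=; rewrite plugged_nil ?addr0 //.
  by rewrite scalerDr.
rewrite !scalerDr addrA; congr (_ + _ + _ *: _).
by rewrite cutsum_first // => b p q; apply: z.
Qed.

(** Only words of at most two letters can be arguments of mu, so v consumes all
    entries, all but the last one, or all but the first one. *)
Lemma star_mult_cochain v us x vs ws y a : us = x :: vs -> us = rcons ws y ->
  star [:: v] us (fun xs => plug mult_cochain xs a)
  = plug mult_cochain [:: plugged v us] a + plug mult_cochain [:: plugged v ws; y] a
    + sgn K (shifted x * shifted v) *: plug mult_cochain [:: x; plugged v vs] a.
Proof.
move=> usE usE'.
have z xs : (2 < size xs)%N -> plug mult_cochain xs a = 0.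
  by move=> sp; apply: plug_small (hoch_graded_mult_cochain K Sigma) _; lia.
rewrite star_single.
pose H l r : A := cutsum r (fun p q =>
  sgn K (sd l * shifted v) *: plug mult_cochain (l ++ plugged v p :: q) a).
rewrite -[LHS]/(cutsum us H) [in LHS]usE.
rewrite -[LHS]/(H [::] (x :: vs) + cutsum vs (fun l r => H (x :: l) r)) -usE.
congr (_ + _).
  rewrite /H [in LHS]usE' cutsum_rcons -usE' weight_nil mul0r scale1r addrC; congr (_ + _).
  rewrite cutsum_last ?scale1r // => b p q; by rewrite z ?scaler0 //= size_rcons.
rewrite cutsum_first => [|b p q].
  rewrite /H cutsum_last => [|b p q]; last by rewrite z ?scaler0.
  by rewrite weight_cons weight_nil addr0.
rewrite /H -[RHS](cutsum0 _ q); apply: eq_cutsum => l r _.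
by rewrite z ?scaler0 //= size_cat /=; lia.
Qed.

Lemma plug_entryD f us k (x y z : E) ws : multilinear f -> x.1 = y.1 -> x.1 = z.1 ->
  x.2 = k *: y.2 + z.2 ->
  plug f (us ++ x :: ws) = k *: plug f (us ++ y :: ws) + plug f (us ++ z :: ws).
Proof.
move=> flin xy xz xE; apply/funext => a.
rewrite -[RHS]/(k *: plug f (us ++ y :: ws) a + plug f (us ++ z :: ws) a).
apply: insert_evaluate_linear => //; [by rewrite /shifted xy|by rewrite /shifted xz|] => b.
by rewrite -[LHS]/(x.2 b) xE.
Qed.

Lemma plug_entryZ f us k (x y : E) ws : multilinear f -> x.1 = y.1 -> x.2 = k *: y.2 ->
  plug f (us ++ x :: ws) = k *: plug f (us ++ y :: ws).
Proof.
move=> flin xy xE; rewrite (@plug_entryD f us k x y (x.1, 0)) ?addr0 //.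
have -> : plug f (us ++ (x.1, 0) :: ws) = 0 by apply/funext => a; exact: insert_act0.
by rewrite addr0.
Qed.

(** Each term is written with braces only and expanded by the brace identity.  The
    expansions of (v{vs}){mu} and (v{mu}){vs} contain the words in which mu stands
    between two entries, consumes one or two of them, or is consumed by one.  The
    first kind cancels; mu{v_k} and v_k{mu} make up the differential of v_k and
    mu{v_k, v_(k+1)} is the product of two entries.  In the expansion of
    (mu{v}){vs} the entry v consumes all entries, which belongs to the
    differential of v{vs}, or leaves out the first or the last one, which gives
    the two outer products. *)
Lemma hochschild_brace_dif v vs : homog v -> all_homog vs -> (0 < size vs)%N ->
    @dif K NH (@hbrace K NH v vs) - @brace K NH (@hdif K NH v) vs
    + \sum_(k < size vs)
        sgn K (v.1 + sdeg (take k vs))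
        *: @brace K NH v (take k vs ++ @hdif K NH vs`_k :: drop k.+1 vs)
    = sgn K (v.1 * ((vs`_0).1 - 1)) *: @Defs.mul K NH vs`_0 (@hbrace K NH v (behead vs))
      - \sum_(k < (size vs).-1)
          sgn K (v.1 + sdeg (take k.+1 vs) - 1)
          *: @brace K NH v (take k vs ++ @hmul K NH vs`_k vs`_k.+1 :: drop k.+2 vs)
      + sgn K (v.1 + sdeg (take (size vs).-1 vs) - 1)
        *: @Defs.mul K NH (@hbrace K NH v (take (size vs).-1 vs)) vs`_(size vs).-1.
Proof.
move=> hv hvs; case: (lastP vs) hvs => // ws y; set us := rcons ws y => hus _.
have [x [vs' usE]] : exists x vs', us = x :: vs' by rewrite /us headI; eexists; eexists.
have flin : multilinear (v.2 : seq A -> A) := graded_multilinear hv.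
have hus_k k : (k < size us)%N -> homog us`_k by move=> ku; apply: hus; apply: mem_nth.
have [hx hvs'] : homog x /\ all_homog vs' by apply/all_homog_cons; rewrite -usE.
have hws : all_homog ws by move: hus; rewrite /us -cats1 all_homog_cat => -[].
have hy : homog y by apply: hus; rewrite mem_rcons inE eqxx.
have takeE : take (size us).-1 us = ws by rewrite /us size_rcons /= -cats1 take_size_cat.
have nthE : us`_(size us).-1 = y by rewrite nth_last /us last_rcons.
have hbE us' : @hbrace K NH v us' = plugged v us' by exact: hbraceE.
have e1 : @dif K NH (@hbrace K NH v us) = plug mult_cochain [:: plugged v us]
    + sgn K (v.1 + sd us) *: plug (plug v.2 us) [:: mult_arg].
  by rewrite hbE; exact: (ndif_bracket (homog_plugged hv hus)).
have e2 : @brace K NH (@hdif K NH v) us = plug (plug mult_cochain [:: v]) us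
    + sgn K v.1 *: plug (plug v.2 [:: mult_arg]) us.
  rewrite -[LHS]/(hoch_brace (@hdif K NH v) us) hoch_braceE; last exact: homog_ndif.
  by rewrite -[(@hdif K NH v).2]/(@dif K NH v) ndif_bracket // plugD plugZ.
have e3 (k : 'I_(size us)) : @brace K NH v (take k us ++ @hdif K NH us`_k :: drop k.+1 us)
    = sgn K (us`_k).1 *: plug v.2 (take k us ++ plugged us`_k [:: mult_arg] :: drop k.+1 us)
      + plug v.2 (take k us ++ plugged mult_arg [:: us`_k] :: drop k.+1 us).
  rewrite -[LHS]/(hoch_brace v _) hoch_braceE //; apply: plug_entryD => //.
  - by rewrite /= weight_cons weight_nil addr0.
  - by rewrite /= weight_cons weight_nil addr0 /shifted; ring.
  - by rewrite -[LHS]/(@dif K NH us`_k) ndif_bracket 1?addrC //; apply: hus_k.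
have e4 : @Defs.mul K NH us`_0 (@hbrace K NH v (behead us))
    = sgn K x.1 *: plug mult_cochain [:: x; plugged v vs'].
  rewrite usE -[behead (x :: vs')]/vs' -[(x :: vs')`_0]/x hbE.
  exact: (nmul_bracket hx (homog_plugged hv hvs')).
have e5 (k : 'I_(size us).-1) :
    @brace K NH v (take k us ++ @hmul K NH us`_k us`_k.+1 :: drop k.+2 us)
    = sgn K (us`_k).1 *: plug v.2 (take k us ++ plugged mult_arg [:: us`_k; us`_k.+1] :: drop k.+2 us).
  rewrite -[LHS]/(hoch_brace v _) (hoch_braceE _ hv); apply: plug_entryZ; first exact: flin.
    by rewrite /= !weight_cons weight_nil addr0 /shifted; ring.
  have kr : (k.+1 < size us)%N by have := ltn_ord k; lia.
  exact: (nmul_bracket (hus_k k (ltnW kr)) (hus_k k.+1 kr)).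
have e6 : @Defs.mul K NH (@hbrace K NH v ws) y
    = sgn K (v.1 + sd ws) *: plug mult_cochain [:: plugged v ws; y].
  by rewrite hbE; exact: (nmul_bracket (homog_plugged hv hws) hy).
rewrite takeE nthE e1 e2 e4 e6.
under eq_bigr do rewrite e3.
under [in RHS]eq_bigr do rewrite e5.
have -> : (us`_0).1 = x.1 by rewrite usE.
apply/funext => a; rewrite !fctE !fct_sumE.
rewrite (plug_comp us [:: mult_arg] a flin) (plug_comp [:: mult_arg] us a flin).
rewrite (plug_comp [:: v] us a (graded_multilinear (hoch_graded_mult_cochain K Sigma))).
rewrite (star_mult_cochain v a usE erefl) star_mult_arg (star_single_mult_arg us a flin).
set G := fun xs => plug v.2 xs a.
set S1 := \sum_(k < size us) _; set S2 := \sum_(k < (size us).-1) _.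
have S1E : S1 = cutsum us (fun l r => if r is z :: r' then sgn K (v.1 + sd l)
    *: (sgn K z.1 *: G (l ++ plugged z [:: mult_arg] :: r') + G (l ++ plugged mult_arg [:: z] :: r')) else 0).
  by rewrite (cutsum_pick us 0 (fun l z r' => sgn K (v.1 + sd l)
    *: (sgn K z.1 *: G (l ++ plugged z [:: mult_arg] :: r') + G (l ++ plugged mult_arg [:: z] :: r')))).
have S2E : S2 = cutsum us (fun l r => if r is z :: z' :: r' then
    sgn K (v.1 + (sd l + shifted z) - 1) *: (sgn K z.1 *: G (l ++ plugged mult_arg [:: z; z'] :: r')) else 0).
  rewrite (cutsum_pick2 us 0 (fun l z z' r' => sgn K (v.1 + (sd l + shifted z) - 1)
    *: (sgn K z.1 *: G (l ++ plugged mult_arg [:: z; z'] :: r')))).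
  apply: eq_bigr => k _; rewrite (take_nth 0); last exact: leq_trans (ltn_ord k) (leq_pred _).
  by rewrite -cats1 /sdeg big_cat big_seq1.
set X1 := sgn K (v.1 + sd us) *: _; set X2 := sgn K v.1 *: _.
(* The braces on v alone cancel cut by cut; those on mu are compared at the end. *)
have claim : X1 + (-1) *: X2 + S1 + S2 = 0.
  rewrite /X1 /X2 S1E S2E -!cutsumD -!cutsumZ -!cutsumD -[RHS](cutsum0 _ us).
  apply: eq_cutsum => l r usE'; move: v.1 => V; rewrite usE'.
  have weE z : shifted z = z.1 - 1 by [].
  case: r {usE'} => [|z r]; rewrite weight_cat ?weight_cons ?weight_nil ?weE -!/(G _).
    by move: (sd l) (G _) => dl g0; coef_ring.
  move: (sd l) (sd r) z.1 => dl dr dz; case: r => [|z' r].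
    by move: (G _) (G _) (G _) => g0 g1 g2; coef_ring.
  by rewrite -!/(G _); move: (G _) (G _) (G _) (G _) => g0 g1 g2 g3; coef_ring.
have X1E : X1 = X2 - S1 - S2.
  rewrite -[RHS]add0r -claim.
  clear claim.
  by move: X1 X2 (S1 : A) (S2 : A) => x1 x2 s1 s2; coef_ring.
rewrite X1E; clear claim X1E.
have -> : sdeg ws = sd ws by [].
have -> : shifted x * shifted v = (x.1 - 1) * (v.1 - 1) by [].
move: (plug mult_cochain [:: plugged v us] a) (plug mult_cochain [:: x; plugged v vs'] a) (plug mult_cochain [:: plugged v ws; y] a).
move: (sd ws) v.1 x.1 X2 (S1 : A) (S2 : A) => dw V dx x2 s1 s2 m1 m2 m3.
by coef_ring.
Qed.

Theorem hochschild_is_bdga : is_bdga NH.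
Proof.
split.
- exact: hoch_graded0.
- exact: hoch_gradedP.
- exact: homog_ndif.
- move=> n k x y hx hy.
  rewrite (@ndifE (n, k *: x + y)); last exact: hoch_gradedP.
  rewrite (@ndifE (n, x)) // (@ndifE (n, y)) //=.
  rewrite !(cupDl, cupDr, cupZl, cupZr, plugD, plugZ) !scalerDr.
  move: (cup _ x) (cup _ y) (cup x _) (cup y _) (plug x _) (plug y _) => x1 y1 x2 y2 x3 y3.
  by apply/funext => a; rewrite !fctE; coef_ring.
- exact: ndif_ndif.
- exact: homog_nmul.
- move=> n k x y w hx hy hw.
  rewrite (@nmulE (n, k *: x + y)) //; last exact: hoch_gradedP.
  rewrite (@nmulE (n, x)) // (@nmulE (n, y)) //=.
  by rewrite cupDl cupZl scalerDr (scaler_swap k).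
- move=> v n k x y hv hx hy.
  rewrite (@nmulE v (n, k *: x + y)) //; last exact: hoch_gradedP.
  rewrite (@nmulE v (n, x)) // (@nmulE v (n, y)) //=.
  by rewrite cupDr cupZr scalerDr (scaler_swap k).
- exact: nmul_assoc.
- exact: ndif_nmul.
- by move=> v vs hv hvs; rewrite -[hbrace v vs]/(@hbrace K CH v vs) hbraceE //; apply: homog_plugged.
- move=> n k x y vs hx hy hvs.
  rewrite -[LHS]/(hoch_brace (n, k *: x + y) vs) hoch_braceE; last exact: hoch_gradedP.
  rewrite -[brace (n, x) vs]/(hoch_brace (n, x) vs) -[brace (n, y) vs]/(hoch_brace (n, y) vs).
  by rewrite !hoch_braceE // plugD plugZ.
- move=> v us n k x y ws hv hus hx hy hws.
  rewrite -[LHS]/(hoch_brace v _) -[X in _ = _ *: X + _]/(hoch_brace v _).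
  rewrite -[X in _ = _ + X]/(hoch_brace v _) !hoch_braceE //.
  by apply: plug_entryD => //; apply: graded_multilinear hv.
- by move=> v hv; rewrite -[LHS]/(hoch_brace v _) hoch_braceE //; apply/funext.
- exact: hochschild_brace_brace.
- exact: hochschild_brace_mul.
- exact: hochschild_brace_dif.
Qed.

End HochschildBDGA.

(** * Path sums *)

Section PathSums.
Variables (K : fieldType) (T : finType) (Sigma : {set {set T}}).
Local Notation A := (incidence K Sigma).
Local Notation face := (face Sigma).
Local Notation le := (@face_le T Sigma).
Local Notation E := (int * (seq A -> A))%type.
Local Notation S := (int * (seq face -> K^o))%type.
Local Notation wl := (fun _ : A => (-1) : int).
Local Notation insA := (insert (@shifted K T Sigma) wl fits (@evaluate K T Sigma)).

(** The sum of G over all paths p starting at s, with one step for each letter of a,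
    weighted by the coefficients of the letters on the steps.  For G the indicator
    of the last face this is a coefficient of the product of the letters. *)
Fixpoint path_sum (V : lmodType K) (s : face) (a : seq A) (G : seq face -> V) : V :=
  if a is b :: a' then \sum_(u : face) coef b s u *: path_sum u a' (fun p => G (u :: p))
  else G [::].

(** The explicit weights; as for [insert_terms], linearity and the exchange of sums
    are immediate from this form. *)
Lemma path_sum_tuple (V : lmodType K) s a (G : seq face -> V) :
  path_sum s a G = \sum_(p : (size a).-tuple face)
    (\prod_(z <- zip a (zip (s :: p) p)) coef z.1 z.2.1 z.2.2) *: G p.
Proof.
elim: a s G => [|b a IH] s G /=.
  rewrite (big_pred1 [tuple]) /= => [|p]; first by rewrite big_nil scale1r.
  by apply/esym/eqP; rewrite (tuple0 p).
rewrite (reindex (fun p : face * (size a).-tuple face => cons_tuple p.1 p.2)) /=; last first.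
  exists (fun t => (thead t, behead_tuple t)) => [[x t] _|t _] /=.
    by congr (_, _); apply: val_inj.
  by rewrite [RHS]tuple_eta; apply: val_inj.
rewrite -(pair_bigA _ (fun u (p : (size a).-tuple face) =>
  (\prod_(z <- zip (b :: a) (zip (s :: u :: p) (u :: p))) coef z.1 z.2.1 z.2.2) *: G (u :: p))) /=.
apply: eq_bigr => u _; rewrite IH scaler_sumr; apply: eq_bigr => p _.
by rewrite big_cons scalerA.
Qed.

(** Coefficients vanish outside intervals, so only increasing paths contribute. *)
Lemma eq_path_sum (V : lmodType K) s a (F G : seq face -> V) :
  (forall p, size p = size a -> path le s p -> F p = G p) -> path_sum s a F = path_sum s a G.
Proof.
elim: a s F G => [|b a IH] s F G FG /=; first exact: FG.
apply: eq_bigr => u _; have [su|su] := boolP (le s u).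
  by congr (_ *: _); apply: IH => p sp up; apply: FG; rewrite /= ?sp ?su.
by rewrite coef_out // !scale0r.
Qed.

Lemma path_sum_linearP (V : lmodType K) s a k (F G : seq face -> V) :
  path_sum s a (fun p => k *: F p + G p) = k *: path_sum s a F + path_sum s a G.
Proof.
rewrite !path_sum_tuple scaler_sumr -big_split; apply: eq_bigr => p _ /=.
by rewrite scalerDr scaler_swap.
Qed.

Lemma path_sumZ (V : lmodType K) s a k (F : seq face -> V) :
  path_sum s a (fun p => k *: F p) = k *: path_sum s a F.
Proof.
by rewrite !path_sum_tuple scaler_sumr; apply: eq_bigr => p _ /=; rewrite scaler_swap.
Qed.

Lemma path_sum0 (V : lmodType K) s a : path_sum s a (fun _ => 0 : V) = 0.
Proof. by rewrite path_sum_tuple big1 // => p _; rewrite scaler0. Qed.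

Lemma path_sumD (V : lmodType K) s a (F G : seq face -> V) :
  path_sum s a (fun p => F p + G p) = path_sum s a F + path_sum s a G.
Proof.
by rewrite !path_sum_tuple -big_split; apply: eq_bigr => p _ /=; rewrite scalerDr.
Qed.

Lemma path_sum_sum (V : lmodType K) (I : Type) (r : seq I) (P : pred I) s a
    (F : I -> seq face -> V) :
  path_sum s a (fun p => \sum_(i <- r | P i) F i p) = \sum_(i <- r | P i) path_sum s a (F i).
Proof.
rewrite path_sum_tuple; under eq_bigr do rewrite scaler_sumr.
by rewrite exchange_big; apply: eq_bigr => i _; rewrite path_sum_tuple.
Qed.

Lemma path_sum_cutsumr (V : lmodType K) (I : Type) (c : seq I) s a
    (F : seq face -> seq I -> seq I -> V) :
  path_sum s a (fun p => cutsum c (F p)) = cutsum c (fun l r => path_sum s a (fun p => F p l r)).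
Proof.
under eq_path_sum => p _ _ do rewrite cutsumE.
by rewrite path_sum_sum cutsumE.
Qed.

Lemma path_sum_scalel (V : lmodType K) s a (F : seq face -> K^o) (x : V) :
  path_sum s a F *: x = path_sum s a (fun p => (F p : K) *: x).
Proof.
rewrite !path_sum_tuple scaler_suml; apply: eq_bigr => p _.
by rewrite scalerA.
Qed.

Lemma path_sum_insert_exch (V : lmodType K) s a xs b (H : seq face -> seq A -> V) :
  path_sum s a (fun p => insA xs b (H p)) = insA xs b (fun l => path_sum s a (fun p => H p l)).
Proof.
under [RHS]eq_insert do rewrite path_sum_tuple.
by rewrite path_sum_tuple insert_sum; apply: eq_bigr => p _; rewrite insertZ.
Qed.

Lemma path_sum_cat (V : lmodType K) s a b (G : seq face -> V) :
  path_sum s (a ++ b) G = path_sum s a (fun p => path_sum (last s p) b (fun q => G (p ++ q))).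
Proof. by elim: a s G => //= c a IH s G; apply: eq_bigr => u _; rewrite IH. Qed.

(** Deconcatenation of paths corresponds to deconcatenation of words, the second
    path starting where the first one ends. *)
Lemma path_sum_cutsum (V : lmodType K) s a (H : seq face -> seq face -> V) :
  path_sum s a (fun p => cutsum p H)
  = cutsum a (fun a0 a1 => path_sum s a0 (fun p0 => path_sum (last s p0) a1 (H p0))).
Proof.
elim: a s H => [|b a IH] s H /=; first by rewrite !addr0.
under eq_bigr => u _ do rewrite path_sumD scalerDr IH.
rewrite big_split /=; congr (_ + _).
by under eq_bigr => u _ do rewrite -cutsumZ; rewrite -cutsum_sum.
Qed.

(** The multilinear extension of f; its coefficient on (s, t) only involves the
    paths from s to t. *)
Definition cochain_ext (f : seq face -> K^o) : seq A -> A := fun a =>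
  [ffun p : Defs.interval Sigma => path_sum (val p).1 a
     (fun q => f ((val p).1 :: q) * (last (val p).1 q == (val p).2)%:R : K^o)].
Local Notation J := cochain_ext.

Lemma path_last_le s p : path le s p -> le s (last s p).
Proof.
elim: p s => [|u p IH] s /=; first by rewrite face_le_refl.
by move=> /andP [su /IH]; apply: face_le_trans.
Qed.

Lemma coef_ext f a s t :
  coef (J f a) s t = path_sum s a (fun q => f (s :: q) * (last s q == t)%:R : K^o).
Proof.
have [st|st] := boolP (le s t).
  exact: (coef_ffun (fun s t => path_sum s a (fun q => f (s :: q) * (last s q == t)%:R : K^o))).
rewrite coef_out //; apply/esym.
rewrite (@eq_path_sum K^o s a _ (fun=> 0)) ?path_sum0 // => q _ /path_last_le; case: eqP => [->|_ _]; last by rewrite mulr0.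
by rewrite (negbTE st).
Qed.

(** A letter that is itself a value of an extension is one step from s to a face t,
    weighted by f on all paths from s to t: the step is replaced by a sub-path, of
    which G sees only the last face. *)
Lemma path_sum_ext (V : lmodType K) s f a b (G : seq face -> V) :
  path_sum s (J f a :: b) G
  = path_sum s a (fun p => (f (s :: p) : K) *: path_sum (last s p) b (fun q => G (last s p :: q))).
Proof.
rewrite /=; under eq_bigr => u _ do rewrite coef_ext path_sum_scalel.
rewrite -path_sum_sum; apply: eq_path_sum => p _ _.
rewrite (bigD1 (last s p)) //= eqxx mulr1 big1 ?addr0 // => u us.
by rewrite eq_sym (negbTE us) mulr0 scale0r.
Qed.

Definition ext_arg (x : S) : E := (x.1, J x.2).

Definition shifted_simp (x : S) : int := x.1 - 1.

Lemma weight_ext xs : weight (@shifted K T Sigma) (map ext_arg xs) = weight shifted_simp xs.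
Proof. by rewrite /weight big_map. Qed.

(** Insertion for paths: the sub-path p1, consumed by x and weighted by the value of
    x on it, is replaced by the single step to its last face.  The base point s,
    from which the path p starts, is needed for a cochain x of degree 0: it
    consumes no step, is evaluated at the current face and repeats that face. *)
Fixpoint simp_insert (xs : seq S) (s : face) (p : seq face) (G : seq face -> K^o) : K^o :=
  if xs is x :: xs' then
    cutsum p (fun p0 r => cutsum r (fun p1 p2 =>
      if (size p1)%:Z == x.1 then
        sgn K (- (size p0)%:Z * (shifted_simp x + weight shifted_simp xs') + - (size p1)%:Z * weight shifted_simp xs')
        * x.2 (last s p0 :: p1)
        * simp_insert xs' (last (last s p0) p1) p2 (fun q => G (p0 ++ last (last s p0) p1 :: q))
      else 0))
  else G p.

(** By [path_sum_cutsum] the cuts of the word become cuts of the path, and by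
    [path_sum_ext] the letters that the inserted cochains produce become single
    steps. *)
Lemma path_sum_simp_insert xs s a (G : seq face -> K^o) :
  insA (map ext_arg xs) a (fun b => path_sum s b G) = path_sum s a (fun p => simp_insert xs s p G).
Proof.
elim: xs s a G => [|x xs IH] s a G //=.
rewrite path_sum_cutsum; apply: eq_cutsum => a0 r _.
pose X p0 p1 p2 : K^o := if (size p1)%:Z == x.1 then
    sgn K (- (size p0)%:Z * (shifted_simp x + weight shifted_simp xs) + - (size p1)%:Z * weight shifted_simp xs)
    * x.2 (last s p0 :: p1)
    * simp_insert xs (last (last s p0) p1) p2 (fun q => G (p0 ++ last (last s p0) p1 :: q))
  else 0.
transitivity (path_sum s a0 (fun p0 => cutsum r (fun a1 a2 => path_sum (last s p0) a1 (fun p1 =>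
    path_sum (last (last s p0) p1) a2 (X p0 p1))))); last first.
  by apply: eq_path_sum => p0 _ _; rewrite path_sum_cutsum.
rewrite path_sum_cutsumr; apply: eq_cutsum => a1 a2 _.
rewrite fits_size /=; case: eqP => sa1; last first.
  apply/esym; rewrite -[RHS](path_sum0 K^o s a0); apply: eq_path_sum => p0 _ _.
  rewrite -[RHS](path_sum0 _ (last s p0) a1); apply: eq_path_sum => p1 sp1 _.
  rewrite -[RHS](path_sum0 _ (last (last s p0) p1) a2); apply: eq_path_sum => p2 _ _.
  by rewrite /X sp1; case: eqP.
rewrite weight_ext !weight_const !mulN1r.
set c := sgn K _.
transitivity (c *: path_sum s a0 (fun p0 => path_sum (last s p0) a1 (fun p1 =>
    (x.2 (last s p0 :: p1) : K) *: path_sum (last (last s p0) p1) a2 (fun p2 =>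
      simp_insert xs (last (last s p0) p1) p2 (fun q => G (p0 ++ last (last s p0) p1 :: q)))))).
  congr (_ *: _).
  under eq_insert => l do rewrite path_sum_cat; rewrite -path_sum_insert_exch.
  apply: eq_path_sum => p0 _ _.
  under eq_insert => l do rewrite path_sum_ext; rewrite -path_sum_insert_exch.
  apply: eq_path_sum => p1 _ _; rewrite insertZ; congr (_ *: _); exact: IH.
rewrite -path_sumZ; apply: eq_path_sum => p0 sp0 _; rewrite -path_sumZ; apply: eq_path_sum => p1 sp1 _.
rewrite scalerA -path_sumZ; apply: eq_path_sum => p2 _ _.
by rewrite /X sp0 sp1; case: eqP.
Qed.

Lemma eq_simp_insert xs s p (F G : seq face -> K^o) : (forall q, F q = G q) ->
  simp_insert xs s p F = simp_insert xs s p G.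
Proof. by move=> /funext ->. Qed.

(** Insertion does not move the end point of a path. *)
Lemma simp_insert_last xs s p t (G : seq face -> K^o) :
  simp_insert xs s p (fun q => G q * (last s q == t)%:R) = simp_insert xs s p G * (last s p == t)%:R.
Proof.
elim: xs s p G => [|x xs IH] s p G //=.
rewrite [in RHS]cutsumE mulr_suml cutsumE; apply: eq_bigr => i _.
set p0 := take i p; set r := drop i p.
rewrite [in RHS]cutsumE mulr_suml cutsumE; apply: eq_bigr => d _.
set p1 := take d r; set p2 := drop d r.
case: eqP => _; last by rewrite mul0r.
rewrite -[RHS](mulrA (_ * _)); congr (_ * _).
under eq_simp_insert => q do rewrite last_cat /=.
rewrite IH; congr (_ * (_ == _)%:R).
by rewrite -[p in RHS](cat_take_drop i) -/p0 -/r last_cat -[r](cat_take_drop d) -/p1 -/p2 last_cat.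
Qed.

End PathSums.

(** * Simplicial braces as insertions *)

Definition scons (x : nat) (f : nat -> nat) (k : nat) : nat := if k is k'.+1 then f k' else x.

(** The cut points after the first pair are translates of those of the remaining
    sequence, which starts at i + d. *)
Lemma sum_cuts_rec (V : nmodType) r n (F : (nat -> nat) -> (nat -> nat) -> V) :
  (forall i j i' j', (forall k, (k < r.+1)%N -> i k = i' k /\ j k = j' k) -> F i j = F i' j') ->
  sum_cuts r.+1 n F
  = \sum_(i < n.+1) \sum_(d < (n - i).+1) sum_cuts r (n - i - d) (fun i' j' =>
      F (scons i (fun k => (i + d + i' k)%N)) (scons (i + d) (fun k => (i + d + j' k)%N))).
Proof.
move=> Fext; rewrite sum_cutsE [LHS]/=; apply: eq_bigr => i _; apply: eq_bigr => d _.
rewrite sum_cutsE; apply: eq_cuts => u su _ _; apply: Fext => -[|k] //= kr.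
by rewrite !(nth_map 0%N) ?size_map ?addnA //; lia.
Qed.

Section SimpBrace.
Variables (K : fieldType) (T : finType) (Sigma : {set {set T}}).
Local Notation A := (incidence K Sigma).
Local Notation face := (face Sigma).
Local Notation le := (@face_le T Sigma).
Local Notation E := (int * (seq A -> A))%type.
Local Notation S := (int * (seq face -> K^o))%type.

(** The argument of f in a simplicial brace: unlike in [splice], both end points of
    each consumed stretch are kept, and nothing is put between them. *)
Definition joint (U : Type) (c : seq U) r (i j : nat -> nat) : seq U :=
  flatten [seq slice c (prev_cut j k) (i k).+1 | k <- iota 0 r] ++ drop (prev_cut j r) c.

Lemma joint_rec (U : Type) (c : seq U) r i j i' j' m :
  j 0%N = m -> (forall k, (k < r)%N -> i k.+1 = (m + i' k)%N) ->
  (forall k, (k < r)%N -> j k.+1 = (m + j' k)%N) ->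
  joint c r.+1 i j = take (i 0%N).+1 c ++ joint (drop m c) r i' j'.
Proof.
move=> j0 iE jE; rewrite /joint /= {1}/slice drop0 -catA; congr (_ ++ (_ ++ _)).
  have pE k : (k < r)%N -> prev_cut j k.+1 = (m + prev_cut j' k)%N.
    by case: k => [|k] kr /=; rewrite ?j0 ?addn0 // jE // ltnW.
  rewrite -[1%N]add1n iotaDl -map_comp; congr flatten.
  apply/eq_in_map => k; rewrite mem_iota add0n /= => kr.
  by rewrite add1n -[j k]/(prev_cut j k.+1) pE // iE // -addnS slice_addl.
rewrite drop_drop; congr drop.
by case: r jE {iE} => [|r] jE /=; rewrite ?j0 // jE // addnC.
Qed.

Definition sterm (fs : seq S) (c : seq face) (G : seq face -> K^o) (i j : nat -> nat) : K^o :=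
  if [forall k : 'I_(size fs), (j k)%:Z - (i k)%:Z == (fs`_k).1] then
    sgn K (\sum_(k < size fs) ((j k)%:Z - (i k)%:Z - 1) * (i k)%:Z)
    * G (joint c (size fs) i j)
    * \prod_(k < size fs) (fs`_k).2 (slice c (i k) (j k).+1)
  else 0.

Lemma eq_prev_cut r (j j' : nat -> nat) k : (forall k, (k < r)%N -> j k = j' k) -> (k <= r)%N ->
  prev_cut j k = prev_cut j' k.
Proof. by case: k => //= k jj' kr; apply: jj'. Qed.

Lemma sterm_ext fs c G i j i' j' :
  (forall k, (k < size fs)%N -> i k = i' k /\ j k = j' k) ->
  sterm fs c G i j = sterm fs c G i' j'.
Proof.
move=> ij; have ii k : (k < size fs)%N -> i k = i' k by case/ij.
have jj k : (k < size fs)%N -> j k = j' k by case/ij.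
rewrite /sterm.
have -> : [forall k : 'I_(size fs), (j k)%:Z - (i k)%:Z == (fs`_k).1]
    = [forall k : 'I_(size fs), (j' k)%:Z - (i' k)%:Z == (fs`_k).1].
  by apply: eq_forallb => k; rewrite ii // jj.
case: ifP => // _; congr (sgn K _ * G _ * _).
- by apply: eq_bigr => k _; rewrite ii // jj.
- rewrite /joint (eq_prev_cut jj) //; congr (flatten _ ++ _); apply/eq_in_map => k.
  rewrite mem_iota add0n /= => kr.
  by rewrite ii // (eq_prev_cut jj) // ltnW.
- by apply: eq_bigr => k _; rewrite ii // jj.
Qed.

Lemma drop_cons_last (s : face) p i : (i <= size p)%N ->
  drop i (s :: p) = last s (take i p) :: drop i p.
Proof.
elim: i s p => [|i IH] s [|u p] //= ip; by rewrite -IH.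
Qed.

(** As for [sum_cuts_insert], the recursion uses increments and the sum uses
    positions.  Removing the first operation leaves the path p2 with base point s',
    the face where the consumed stretch ends. *)
Lemma sum_cuts_simp_insert fs s p (G : seq face -> K^o) :
  sum_cuts (size fs) (size p) (sterm fs (s :: p) G) = simp_insert fs s p (fun q => G (s :: q)).
Proof.
elim: fs s p G => [|x fs IH] s p G.
  rewrite sum_cutsE /= /sterm /joint /= ifT; last by apply/forallP => -[].
  by rewrite !big_ord0 mul1r mulr1.
rewrite -[size (x :: fs)]/((size fs).+1) sum_cuts_rec => [|i j i' j' ij]; last first.
  by refine (@sterm_ext (x :: fs) _ _ _ _ _ _ ij).
rewrite [RHS]/= cutsumE; apply: eq_bigr => i _.
rewrite cutsumE size_drop; apply: eq_bigr => d _.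
have ip : (i <= size p)%N by rewrite -ltnS.
have dp : (d <= size (drop i p))%N by rewrite size_drop -ltnS.
set p0 := take i p; set p1 := take d _; set p2 := drop d _.
have sp0 : size p0 = i by rewrite size_takel.
have sp1 : size p1 = d by rewrite size_takel.
set s' := last (last s p0) p1.
have cE : drop (i + d) (s :: p) = s' :: p2.
  by rewrite addnC -drop_drop drop_cons_last // drop_cons_last.
have <- : size p2 = (size p - i - d)%N by rewrite !size_drop.
have flag (i' j' : nat -> nat) : [forall k : 'I_(size (x :: fs)),
      (scons (i + d) (fun k => (i + d + j' k)%N) k)%:Z
      - (scons i (fun k => (i + d + i' k)%N) k)%:Z == ((x :: fs)`_k).1]
    = (d%:Z == x.1) && [forall k : 'I_(size fs), (j' k)%:Z - (i' k)%:Z == (fs`_k).1].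
  rewrite (forall_ordS _ (fun k => (scons (i + d) (fun k => (i + d + j' k)%N) k)%:Z
      - (scons i (fun k => (i + d + i' k)%N) k)%:Z == ((x :: fs)`_k).1)) /=.
  rewrite PoszD addrAC subrr add0r; congr (_ && _); apply: eq_forallb => k.
  by rewrite [(_ + j' k)%N%:Z]PoszD [(_ + i' k)%N%:Z]PoszD opprD addrACA subrr add0r.
rewrite sp0 sp1; case: eqP => dx; last first.
  transitivity (sum_cuts (size fs) (size p2) (fun _ _ => 0 : K^o)).
    by apply: eq_sum_cuts => i' j' _; rewrite /sterm flag; case: eqP.
  by rewrite /sum_cuts big1.
rewrite -(IH s' p2 (fun l => G (s :: p0 ++ l))).
rewrite /sum_cuts mulr_sumr; apply: eq_bigr => t _.
set i' := fun k => nth 0%N _ k.*2; set j' := fun k => nth 0%N _ k.*2.+1.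
rewrite /sterm flag (introT eqP dx) /=.
case: ifP => [/forallP fl|_]; last by rewrite mulr0.
rewrite (@joint_rec _ (s :: p) (size fs) _ _ i' j' (i + d)%N) //.
rewrite -[take _ _]/(s :: p0) cE !big_ord_recl /=.
have -> : slice (s :: p) i (i + d).+1 = last s p0 :: p1.
  by rewrite -addnS -[X in slice _ X _]addn0 slice_addl drop_cons_last // /slice drop0.
have -> : \prod_(k < size fs) (fs`_k).2 (slice (s :: p) (i + d + i' k) (i + d + j' k).+1)
    = \prod_(k < size fs) (fs`_k).2 (slice (s' :: p2) (i' k) (j' k).+1).
  by apply: eq_bigr => k _; rewrite -addnS slice_addl cE.
set S1 := sgn K _; set S2 := sgn K _; set S3 := sgn K _.
have -> : S1 = S2 * S3.
  rewrite /S1 /S2 /S3 -sgnD.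
  have -> : \sum_(k < size fs) ((i + d + j' k)%N%:Z - (i + d + i' k)%N%:Z - 1)
        * (i + d + i' k)%N%:Z
      = weight (@shifted_simp K T Sigma) fs * (i + d)%N%:Z
        + \sum_(k < size fs) ((j' k)%:Z - (i' k)%:Z - 1) * (i' k)%:Z.
    rewrite (weight_nth _ 0) mulr_suml -big_split; apply: eq_bigr => k _ /=.
    by rewrite /shifted_simp -(eqP (fl k)) !PoszD; ring.
  rewrite /shifted_simp -dx; apply: eq_sgn.
  move: (\sum_(k < size fs) _) (weight _ fs) (sp0) => Z W _; rewrite !PoszD.
  by move: (Posz i) (Posz d) => I D; parity_tac.
move: {S1} S2 S3 (G _) (x.2 _) (\prod_(k < size fs) _) => c1 c2 g y P.
rewrite -!mulrA; congr (c1 * _); rewrite [RHS]mulrCA; congr (c2 * _); exact: mulrCA.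
Qed.

End SimpBrace.

(** * The extension of simplicial cochains to Hochschild cochains *)

Section Extension.
Variables (K : fieldType) (T : finType) (Sigma : {set {set T}}).
Local Notation A := (incidence K Sigma).
Local Notation face := (face Sigma).
Local Notation le := (@face_le T Sigma).
Local Notation C := (simplicial_cochains K Sigma).
Local Notation CH := (hochschild K Sigma).
Local Notation J := (@cochain_ext K T Sigma).
Local Notation S := (int * (seq face -> K^o))%type.
Local Notation eq_psumK := (@eq_path_sum K T Sigma K^o).
Implicit Types (f g : seq face -> K^o) (a : seq A).

Lemma simp_graded_size n f c : simp_graded n f -> (size c)%:Z != n + 1 -> f c = 0.
Proof. by move=> fn sc; apply: fn; rewrite negb_and sc orbT. Qed.

Lemma simplicial_homogeneous_ops : homogeneous_ops C.
Proof.
split=> [n c //|n k f g fn gn c nc|f fn c nc|f g fn gn c nc|f fs fn fsn c nc].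
- by rewrite !fctE fn // gn // scaler0 addr0.
- rewrite /= /simp_dif ifF //; apply/negbTE; apply: contra nc => /andP [-> /eqP->] /=.
  by rewrite -addrA.
- by rewrite /= /simp_mul ifF //; apply/negbTE.
- by rewrite /= /simp_brace ifF //; apply/negbTE.
Qed.

Lemma ext_linear k f g : J (k *: f + g) = k *: J f + J g.
Proof.
apply/funext => a; rewrite !fctE; apply: incidenceP => s t _.
rewrite Defs.coefD Defs.coefZ !coef_ext.
refine (etrans _ (@path_sum_linearP K T Sigma K^o s a k _ _)).
apply: eq_path_sum => p _ _; rewrite -[LHS]/((k * f (s :: p) + g (s :: p)) * _).
by rewrite mulrDl -mulrA.
Qed.

Lemma ext_graded n f : simp_graded n f -> hoch_graded n (J f).
Proof.
move=> fn; split=> [a sa|l r k b c].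
  apply: incidenceP => s t _; rewrite coef_ext Defs.coef0 -[RHS](path_sum0 K^o s a).
  rewrite (@eq_path_sum _ _ _ K^o s a _ (fun=> 0)) // => p sp _.
  rewrite (simp_graded_size fn) ?mul0r //= sp -addn1 PoszD.
  by apply/eqP => /addIr.
apply: incidenceP => s t _; rewrite Defs.coefD Defs.coefZ !coef_ext !path_sum_cat.
refine (etrans _ (@path_sum_linearP K T Sigma K^o s l k _ _)); apply: eq_path_sum => p _ _ /=.
rewrite scaler_sumr -big_split; apply: eq_bigr => u _ /=.
by rewrite Defs.coefD Defs.coefZ scalerDl scalerA.
Qed.

(** Along a chain of basis elements exactly one path has a nonzero weight. *)
Lemma path_sum_chain (V : lmodType K) s p (G : seq face -> V) : path le s p ->
  path_sum s (pairmap (basis_elt K) s p) G = G p.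
Proof.
elim: p s G => //= u p IH s G /andP [su up].
rewrite (bigD1 u) //= coef_basis !eqxx su scale1r IH // big1 ?addr0 // => v vu.
by rewrite coef_basis (negbTE vu) andbF scale0r.
Qed.

(** The values of f on simplices can be recovered from its extension. *)
Lemma coef_ext_chain f s p : path le s p ->
  coef (J f (pairmap (basis_elt K) s p)) s (last s p) = f (s :: p).
Proof. by move=> sp; rewrite coef_ext path_sum_chain // eqxx mulr1. Qed.

(** A subspace containing the cochains of all degrees, on which the extension is
    injective. *)
Definition on_simplices f : Prop := forall c, ~~ simplex c -> f c = 0.

Lemma simp_graded_on_simplices n f : simp_graded n f -> on_simplices f.
Proof. by move=> fn c nc; apply: fn; rewrite negb_and nc. Qed.

Lemma ext_inj f g : on_simplices f -> on_simplices g -> J f = J g -> f = g.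
Proof.
move=> f0 g0 fg; apply/funext => c.
have [|nc] := boolP (simplex c); last by rewrite f0 ?g0.
by case: c => // s p sp; rewrite -!coef_ext_chain // fg.
Qed.

(** A cut of a path of faces corresponds to a factor s .. u in the first cochain and
    u .. t in the second one; summing over u is multiplying in the incidence
    algebra. *)
Lemma ext_mul (f g : S) : simp_graded f.1 f.2 -> simp_graded g.1 g.2 ->
  J (simp_mul f g) = cup (J f.2) (J g.2).
Proof.
move=> fn gn; apply/funext => a; apply: incidenceP => s t _; rewrite coef_ext.
transitivity (path_sum s a (fun p => cutsum p (fun p0 p1 =>
    f.2 (s :: p0) * (g.2 (last s p0 :: p1) * (last (last s p0) p1 == t)%:R) : K^o)) : K).
  apply: eq_psumK => p _ sp.
  have -> : simp_mul f g (s :: p) = cutsum p (fun p0 p1 => f.2 (s :: p0) * g.2 (last s p0 :: p1)).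
    rewrite (@cutsum_size _ _ p `|f.1|%N) => [|p0 p1 s0]; last first.
      by rewrite (simp_graded_size fn) ?mul0r //=; lia.
    rewrite /simp_mul /simplex /= sp /=.
    have [f0|f0] := boolP (f.1 < 0).
      have fE c : f.2 c = 0.
        have [|c0] := eqVneq (size c) 0%N; last by apply: (simp_graded_size fn); lia.
        by move=> /size0nil ->; apply: fn.
      by rewrite !fE !mul0r !if_same.
    case: leqP => fp; last first.
      case: eqP => // sE; rewrite [X in f.2 (s :: X)]take_oversize ?(ltnW fp) //.
      by rewrite (simp_graded_size fn) ?mul0r //=; lia.
    rewrite drop_cons_last //.
    case: eqP => // sE; rewrite (simp_graded_size gn) ?mulr0 //= size_drop.
    by apply/eqP => e; apply: sE; lia.
  rewrite !cutsumE mulr_suml; apply: eq_bigr => i _.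
  by rewrite -mulrA -last_cat cat_take_drop.
rewrite path_sum_cutsum /cup.
have -> : coef (cutsum a (fun l r => J f.2 l * J g.2 r)) s t
    = cutsum a (fun l r => coef (J f.2 l * J g.2 r) s t : K^o).
  rewrite !cutsumE; apply: (big_morph (fun x => coef x s t)).
    by move=> x y; apply: Defs.coefD.
  exact: Defs.coef0.
apply: eq_cutsum => l r _; rewrite coef_mul.
transitivity (path_sum s (J f.2 l :: r) (fun q => g.2 q * (last s q == t)%:R : K^o) : K).
  rewrite path_sum_ext; apply: eq_psumK => p _ _; rewrite -[RHS]path_sumZ; apply: eq_psumK => q _ _.
  by [].
by under [RHS]eq_bigr => u _ do rewrite (coef_ext g.2).
Qed.

Lemma ext_brace (f : S) fs : simp_graded f.1 f.2 ->
  J (simp_brace f fs) = plug (J f.2) (map (@ext_arg K T Sigma) fs).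
Proof.
move=> fn; apply/funext => a; apply: incidenceP => s t _.
set m := f.1 + weight (@shifted_simp K T Sigma) fs.
have [sa|sa] := eqVneq (size a)%:Z m; last first.
  rewrite (@eq_plug_size _ _ _ _ _ (fun=> 0)) => [|b sb _]; last first.
    apply: (graded_size (ext_graded fn)); apply: contra sa => /eqP fb.
    by rewrite -sb fb weight_ext.
  rewrite /plug insert0 coef_ext Defs.coef0.
  rewrite (@eq_path_sum _ _ _ K^o s a _ (fun=> 0)) ?path_sum0 // => p sp _.
  rewrite /simp_brace ifF ?mul0r //; apply/negbTE; rewrite negb_and; apply/orP; right.
  rewrite /= sp -addn1 PoszD; apply: contra sa => /eqP /addIr ->; exact: eqxx.
have -> : coef (plug (J f.2) (map (@ext_arg K T Sigma) fs) a) s t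
    = insert (@shifted K T Sigma) (fun=> -1) fits (@evaluate K T Sigma) (map (@ext_arg K T Sigma) fs) a
        (fun b => coef (J f.2 b) s t : K^o).
  have [ts tsE] := insert_terms (K := K) (@shifted K T Sigma) (fun=> -1) fits (@evaluate K T Sigma)
    (map (@ext_arg K T Sigma) fs) a.
  rewrite /plug !tsE (big_morph (fun x : A => coef x s t) (id1 := 0) (op1 := +%R)).
  - by apply: eq_bigr => k _; rewrite Defs.coefZ.
  - by move=> x y; apply: Defs.coefD.
  - exact: Defs.coef0.
under [RHS]eq_insert => b do rewrite coef_ext.
rewrite path_sum_simp_insert coef_ext; apply: eq_psumK => p sp path_p.
rewrite simp_insert_last; congr (_ * _); rewrite -sum_cuts_simp_insert.
rewrite /simp_brace /simplex /= path_p /= -[_.+1%:Z]/((size p).+1%:Z) -addn1 PoszD sp sa.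
by rewrite eqxx.
Qed.

(** The alternating sum over the faces omitting a vertex that is neither the base
    point, which is not in the list p, nor the last vertex. *)
Fixpoint inner_faces (V : zmodType) (p : seq face) (G : seq face -> V) : V :=
  if p is t :: q then
    if q is u :: p' then G (u :: p') - inner_faces q (fun l => G (t :: l)) else 0
  else 0.

Lemma inner_facesE (V : lmodType K) p (G : seq face -> V) :
  inner_faces p G = \sum_(i < (size p).-1) (-1) ^+ i *: G (take i p ++ drop i.+1 p).
Proof.
elim: p G => [|t [|u p] IH] G; rewrite ?big_ord0 //.
rewrite -[LHS]/(G (u :: p) - inner_faces (u :: p) (fun l => G (t :: l))) IH.
rewrite [RHS]big_ord_recl /= ?drop0 scale1r; congr (_ + _).
by rewrite -sumrN; apply: eq_bigr => i _ /=; rewrite exprS mulN1r scaleNr.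
Qed.

(** The coefficient of b * c on a step sums over the intermediate faces, so a path
    through a contracted word is a path through the word with one inner vertex
    omitted. *)
Lemma contract_path_sum (V : lmodType K) s a (G : seq face -> V) :
  contract a (fun b => path_sum s b G) = path_sum s a (fun p => inner_faces p G).
Proof.
elim: a s G => [|b [|c a] IH] s G //=; first by rewrite big1 // => u _; rewrite scaler0.
rewrite -[X in _ - X]/(contract (c :: a) (fun l => path_sum s (b :: l) G)).
have -> : contract (c :: a) (fun l => path_sum s (b :: l) G)
    = \sum_t coef b s t *: contract (c :: a) (fun l => path_sum t l (fun p => G (t :: p))).
  rewrite contractE; under eq_bigr => i _ do rewrite [path_sum s (b :: _) G]/= scaler_sumr.
  rewrite exchange_big; apply: eq_bigr => t _; rewrite contractE /= scaler_sumr.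
  by apply: eq_bigr => i _; rewrite scaler_swap.
under [X in _ - X]eq_bigr do rewrite IH.
transitivity (\sum_t coef b s t *: path_sum t (c :: a) (fun p => G p) -
  \sum_t coef b s t *: path_sum t (c :: a) (fun p => inner_faces p (fun l => G (t :: l)))).
  congr (_ - _); rewrite /=; under [RHS]eq_bigr do rewrite scaler_sumr.
  rewrite exchange_big; apply: eq_bigr => u _; rewrite coef_mul scaler_suml.
  by apply: eq_bigr => t _; rewrite scalerA.
rewrite -sumrB; apply: eq_bigr => t _; rewrite -scalerBr; congr (_ *: _).
rewrite /= -sumrB; apply: eq_bigr => u _; rewrite -scalerBr; congr (_ *: _).
by rewrite -scaleN1r addrC -path_sum_linearP; apply: eq_path_sum => p _ _; rewrite scaleN1r addrC.
Qed.

Lemma inner_faces_last p s t (G : seq face -> K^o) :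
  inner_faces p (fun q => G q * (last s q == t)%:R) = inner_faces p G * (last s p == t)%:R.
Proof.
elim: p s G => [|u [|v p] IH] s G; rewrite ?mul0r //.
rewrite -[LHS]/(G (v :: p) * (last s (v :: p) == t)%:R
  - inner_faces (v :: p) (fun l => G (u :: l) * (last u l == t)%:R)) IH.
by rewrite -mulrBl.
Qed.

Lemma coef_contract a (F : seq A -> A) s t :
  coef (contract a F) s t = contract a (fun l => coef (F l) s t : K^o).
Proof.
elim: a F => [|b [|c a] IH] F; rewrite ?Defs.coef0 //.
rewrite -[contract _ F]/(F (b * c :: a) - contract (c :: a) (fun l => F (b :: l))).
by rewrite Defs.coefD inc_coefN IH.
Qed.

Lemma simp_dif_chain n f s u p : simp_graded n f -> path le s (u :: p) ->
    (size (u :: p))%:Z = n + 1 ->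
  simp_dif (n, f) (s :: u :: p)
  = f (u :: p) - inner_faces (u :: p) (fun q => f (s :: q)) + sgn K (n + 1) * f (belast s (u :: p)).
Proof.
move=> fn sp sz; rewrite /simp_dif /simplex -[sorted _ _]/(path le s (u :: p)) sp -[size (s :: _)]/((size (u :: p)).+1).
have -> : ((size (u :: p)).+1%:Z == (n, f).1 + 2) by rewrite -addn1 PoszD sz -addrA.
rewrite (inner_facesE (u :: p) (fun q => f (s :: q) : K^o)) -sumrN.
rewrite big_ord_recl expr0 mul1r big_ord_recr /= addrA; congr (_ + _ + _).
  by refine (eq_bigr _ _) => i _; rewrite /= exprS mulN1r mulNr.
rewrite -[LHS]/((-1) ^+ (size p).+1 * f (s :: take (size p) (u :: p) ++ drop (size p) p)).
rewrite drop_size cats0 -sz -[sgn K _]/((-1) ^+ (size p).+1); congr (_ * f (_ :: _)).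
by rewrite lastI -(size_belast u p) -cats1 take_size_cat.
Qed.

(** The inner faces come from [contract_path_sum]; the face omitting the first vertex
    comes from multiplying by the first letter, and the face omitting the last
    vertex from multiplying by the last letter. *)
Lemma ext_dif n f : simp_graded n f -> J (simp_dif (n, f)) = hoch_dif (n, J f).
Proof.
move=> fn; apply/funext => a; apply: incidenceP => s t _.
have [sa|sa] := eqVneq (size a)%:Z (n + 1); last first.
  rewrite /hoch_dif (negbTE sa) Defs.coef0 coef_ext.
  rewrite (@eq_psumK s a _ (fun=> 0)) ?path_sum0 // => p sp _.
  rewrite /simp_dif ifF ?mul0r //; apply/negbTE; rewrite negb_and; apply/orP; right.
  by rewrite /= sp -addn1 PoszD -[2]/(1 + 1 : int) addrA; apply: contra sa => /eqP /addIr ->.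
case: a sa => [|b a] sa.
  have n1 : n = -1 by move: sa => /=; lia.
  have fE c : f c = 0.
    have [|c0] := eqVneq (size c) 0%N; last by apply: (simp_graded_size fn); rewrite n1; lia.
    by move=> /size0nil ->; apply: fn.
  rewrite coef_ext /= [simp_dif _ _](_ : _ = 0) ?mul0r; last first.
    rewrite /simp_dif; case: ifP => // _; rewrite big1 // => i _.
    by rewrite -[(n, f).2 _]/(f _) fE mulr0.
  rewrite (hoch_difE (v := (n, J f))); last exact: ext_graded.
  rewrite !fctE plug_mult /cup /= !addr0 mul0r mulr0 scaler0 addr0 subr0.
  by rewrite Defs.coef0.
rewrite (hoch_difE (v := (n, J f))); last exact: ext_graded.
have -> : (cup (@id_cochain K T Sigma) (J f) + sgn K (n + 1) *: cup (J f) (@id_cochain K T Sigma)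
           - plug (J f) [:: mult_arg K Sigma]) (b :: a)
    = b * J f a + sgn K (n + 1) *: (J f (belast b a) * last b a) - contract (b :: a) (J f).
  rewrite !fctE plug_mult cup_idl; congr (_ + _ *: _ - _).
  by rewrite {1}lastI cup_idr.
rewrite !Defs.coefD inc_coefN Defs.coefZ coef_ext.
pose d q : K^o := (last s q == t)%:R.
have e1 : coef (b * J f a) s t = path_sum s (b :: a) (fun p => f p * d p).
  rewrite coef_mul; refine (eq_bigr _ _) => u _; rewrite coef_ext; congr (_ * _).
have e2 : coef (J f (belast b a) * last b a) s t
    = path_sum s (b :: a) (fun p => f (belast s p) * d p).
  rewrite coef_mul [in RHS]lastI -cats1 path_sum_cat.
  under eq_bigr => u _ do rewrite coef_ext.
  transitivity (path_sum s (belast b a) (fun p => \sum_u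
     (f (s :: p) * (last s p == u)%:R * coef (last b a) u t) : K^o) : K).
    rewrite path_sum_sum; refine (eq_bigr _ _) => u _.
    exact: (path_sum_scalel s (belast b a) (fun p => f (s :: p) * (last s p == u)%:R) (_ : K^o)).
  apply: eq_psumK => p _ _.
  rewrite (bigD1 (last s p)) //= eqxx mulr1 big1 ?addr0 => [|u us]; last first.
    by rewrite eq_sym (negbTE us) mulr0 mul0r.
  rewrite (bigD1 t) //= big1 ?addr0 => [|u ut]; last first.
    by rewrite /d last_cat /= (negbTE ut) mulr0 scaler0.
  rewrite /d last_cat /= eqxx mulr1 cats1 belast_rcons mulrC; congr (_ * f _).
have e3 : coef (contract (b :: a) (J f)) s t
    = path_sum s (b :: a) (fun p => inner_faces p (fun q => f (s :: q)) * d p).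
  rewrite coef_contract (_ : (fun l => _) = (fun l => path_sum s l (fun q => f (s :: q) * d q))).
    by rewrite contract_path_sum; apply: eq_psumK => p _ _; rewrite inner_faces_last.
  by apply/funext => l; rewrite coef_ext.
rewrite e1 e2 e3; symmetry.
transitivity (path_sum s (b :: a) (fun p => (-1) *: (inner_faces p (fun q => f (s :: q)) * d p : K^o)
   + (sgn K (n + 1) *: (f (belast s p) * d p : K^o) + f p * d p)) : K).
  have addE (x y z : K) : - x + (y + z) = z + y - x by ring.
  rewrite !path_sum_linearP scaleN1r; exact: esym (addE _ _ _).
apply: eq_psumK => -[|u p] // sp path_p; rewrite (simp_dif_chain fn path_p); last first.
  by rewrite sp.
have addE (x y z e c : K) : (-1) * (x * e) + (c * (y * e) + z * e) = (z - x + c * y) * e.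
  by ring.
exact: addE.
Qed.

End Extension.

(** * The relative complex *)

Section Relative.
Variables (K : fieldType) (T : finType) (Sigma : {set {set T}}).
Local Notation A := (incidence K Sigma).
Local Notation face := (face Sigma).
Local Notation le := (@face_le T Sigma).
Local Notation C := (simplicial_cochains K Sigma).
Local Notation CS := (relative_hochschild K Sigma).
Local Notation CH := (hochschild K Sigma).
Local Notation J := (@cochain_ext K T Sigma).
Local Notation embed := (@rel_embed K T Sigma).
Local Notation lift := (@rel_lift K T Sigma).
Local Notation e := (basis_elt K).
Implicit Types (f g : seq face -> K^o) (a : seq A) (x y : seq A -> A) (s t u v : face).

Lemma ext_morphism : bdga_morphism (J : C -> CH).
Proof.
split=> [n f|n k f g _ _|[n f] fn|v w hv hw|v vs hv hvs].
- exact: ext_graded.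
- exact: ext_linear.
- exact: ext_dif.
- rewrite -[LHS]/(J (simp_mul v w)) ext_mul // -[RHS]/(hoch_mul (v.1, J v.2) (w.1, J w.2)).
  by rewrite hoch_mulE //=; apply: ext_graded.
- rewrite -[LHS]/(J (simp_brace v vs)) ext_brace //.
  rewrite -[RHS]/(hoch_brace (v.1, J v.2) _) hoch_braceE //=; exact: ext_graded.
Qed.

(** An element of S acts on a basis element through the coefficient at its source
    or target face; at an interior place this face is the same vertex of the path
    whether the element multiplies the letter before or the letter after it. *)
Lemma ext_balanced f : bimodule_balanced (J f).
Proof.
split=> [d b r dS|d l b dS|d l b c r dS]; apply: incidenceP => s t _.
- rewrite coef_mulS // !coef_ext /= mulr_sumr; refine (eq_bigr _ _) => u _.
  by rewrite coef_mulS // -scalerA.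
- rewrite coef_mulrS // !coef_ext -!cats1 !path_sum_cat.
  rewrite -[RHS]mulrC -[RHS]/(coef d t t *: (path_sum s l _ : K^o)) -path_sumZ.
  apply: (@eq_path_sum _ _ _ K^o) => p _ _ /=; rewrite scaler_sumr; refine (eq_bigr _ _) => u _.
  rewrite coef_mulrS // -scalerA [RHS]scaler_swap; congr (_ *: _).
  rewrite last_cat /=; case: eqP => [->|_]; first by [].
  by rewrite mulr0 !scaler0.
rewrite !coef_ext !path_sum_cat; apply: (@eq_path_sum _ _ _ K^o) => p _ _ /=.
refine (eq_bigr _ _) => u _; rewrite !scaler_sumr; refine (eq_bigr _ _) => w _.
by rewrite coef_mulrS // coef_mulS // !scalerA mulrA.
Qed.

Lemma rel_liftK x : embed (lift x) = x.
Proof. by apply/funext => -[|b a] //; rewrite /rel_embed /= mul1r. Qed.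

Lemma rel_embed_linear k (x y : CS) : embed (k *: x + y) = k *: embed x + embed y.
Proof. by apply/funext => -[|b a]. Qed.

Lemma rel_lift_linear k x y : lift (k *: x + y) = k *: lift x + lift y :> CS.
Proof.
rewrite -[RHS]/(k *: (lift x).1 + (lift y).1, k *: (lift x).2 + (lift y).2).
rewrite /rel_lift; congr (_, _); apply/funext.
  by move=> d; rewrite !fctE mulrDr inc_scaleAr.
by case=> [|b a] //; rewrite !fctE scaler0 addr0.
Qed.

(** In degree 0, a bimodule morphism on S is determined by its value at 1. *)
Lemma rel_embedK n (x : CS) : graded n x -> lift (embed x) = x.
Proof.
rewrite /graded /= /rel_graded; case: x => x1 x2; case: eqP => [_|n0] /= [].
  move=> [x1l x1m] ->; congr (_, _); apply/funext; last by case.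
  move=> d /=; have /= [|<-] // := x1m d d (exist _ 1 (@in_S1 K T Sigma)).
  by rewrite mulr1.
move=> -> [x20 x2l] _; congr (_, _); apply/funext; first by move=> d; rewrite /= mulr0.
by case=> [|b a] //=; rewrite x20 // => n0'; apply: n0; rewrite -n0'.
Qed.

(** In degree 0 the extension is a diagonal matrix, so it commutes with S. *)
Lemma ext_lift_graded n f : simp_graded n f -> graded n (lift (J f) : CS).
Proof.
move=> fn; have Jn := ext_graded fn; rewrite /graded /= /rel_graded; case: eqP => n0.
  rewrite n0 in Jn; split; last first.
    by apply/funext => -[|b a] //=; rewrite (graded_size Jn).
  have Jdiag (d : A) : in_S d -> J f [::] * d = d * J f [::].
    move=> dS; apply: incidenceP => s t _; rewrite (coef_mulrS _ _ _ dS) (coef_mulS _ _ _ dS) coef_ext /=.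
    by case: eqP => [->|_]; rewrite ?mulr0 ?mul0r // mulrC.
  split=> [k r s t /= ->|r s t /= ->]; first by rewrite mulrDl inc_scaleAl.
  by split; rewrite -!mulrA // (Jdiag _ (svalP t)).
have J0 : J f [::] = 0.
  by apply: (graded_size Jn); apply/eqP => n0'; apply: n0; rewrite -n0'.
have -> : (lift (J f)).2 = J f by apply/funext => -[|b a].
split=> //; last exact: ext_balanced.
by apply/funext => d; rewrite /= J0 mulr0.
Qed.

(** The restriction of a cochain to chains of basis elements (s_0, s_1), ...,
    (s_(n-1), s_n), keeping the coefficient on (s_0, s_n); a left inverse of the
    extension. *)
Definition chain_values x : seq face -> K^o := fun c =>
  if c is s :: p then
    if path le s p then coef (x (pairmap e s p)) s (last s p) else 0
  else 0.

Lemma chain_values_linear k x y : chain_values (k *: x + y) = k *: chain_values x + chain_values y.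
Proof.
apply/funext => -[|s p]; rewrite ?fctE /=; first by rewrite scaler0 addr0.
case: ifP => _; last by rewrite scaler0 addr0.
by rewrite Defs.coefD Defs.coefZ.
Qed.

Lemma chain_values_graded n x : hoch_graded n x -> simp_graded n (chain_values x).
Proof.
move=> xn [|s p] //= nc; case: ifP => // sp.
rewrite (graded_size xn) ?Defs.coef0 // size_pairmap; apply: contra nc => /eqP <-.
by rewrite /simplex /= sp -addn1 PoszD eqxx.
Qed.

Lemma chain_values_ext n f : simp_graded n f -> chain_values (J f) = f.
Proof.
move=> fn; apply/funext => -[|s p] /=; first by rewrite fn.
by case: ifP => sp; [rewrite coef_ext_chain|rewrite fn // /simplex /= sp].
Qed.

(** A basis element (v, u) can be multiplied by the idempotent (u, u) on the right,
    which moves to the next letter and leaves there only the basis elements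
    starting at u.  Iterating, the word is replaced by chains of basis elements. *)
Lemma balanced_expand x l v u a : multilinear x -> bimodule_balanced x ->
  x (l ++ e v u :: a) = path_sum u a (fun p => x (l ++ e v u :: pairmap e u p)).
Proof.
move=> xl [_ _ xb]; elim: a l v u => [|b a IH] l v u //=.
rewrite -{1}basis_mul_id xb; last exact: in_S_basis.
rewrite basis_mul_expand -cat_rcons (multilinear_sum xl); apply: eq_bigr => w _.
by rewrite (multilinearZ xl) IH; congr (_ *: _); apply: eq_path_sum => p _ _; rewrite cat_rcons.
Qed.

Lemma coef_path_sum s t u a (G : seq face -> A) :
  coef (path_sum u a G) s t = path_sum u a (fun p => coef (G p) s t : K^o).
Proof.
rewrite !path_sum_tuple (big_morph (fun x : A => coef x s t) (id1 := 0) (op1 := +%R)).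
- by apply: eq_bigr => p _; rewrite Defs.coefZ.
- by move=> c d; apply: Defs.coefD.
- exact: Defs.coef0.
Qed.

(** The idempotent (s, s) extracts the coefficients on (s, t), and moves into the
    first letter; [balanced_expand] then reduces to chains of basis elements.  The
    idempotent at the end of a chain moves out, so that the value on a chain has
    coefficients only at its last face. *)
Lemma ext_chain_values_balanced n x : hoch_graded n x -> n <> 0 -> bimodule_balanced x ->
  J (chain_values x) = x.
Proof.
move=> xn n0 xb; have xl := graded_multilinear xn.
apply/funext => -[|b a].
  have x0 : x [::] = 0 by apply: (graded_size xn); apply/eqP => n0'; apply: n0; rewrite -n0'.
  apply: incidenceP => s t _; rewrite coef_ext /= x0 !Defs.coef0; exact: mul0r.
apply: incidenceP => s t _; rewrite coef_ext.
have -> : coef (x (b :: a)) s t = coef (e s s * x (b :: a)) s t.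
  by rewrite coef_ideml eqxx mul1r.
have -> : e s s * x (b :: a) = path_sum s (b :: a) (fun p => x (pairmap e s p)).
  case: (xb) => xbl _ _; rewrite -xbl; last exact: in_S_basis.
  rewrite basis_mul_expand (multilinear_sum xl _ _ [::]) /=; apply: eq_bigr => w _.
  by rewrite (multilinearZ xl [::]) /= (balanced_expand [::] s w a xl xb).
rewrite coef_path_sum; apply: (@eq_path_sum _ _ _ K^o) => p sp path_p.
rewrite /= path_p; case: eqP => [<-|st]; first by rewrite mulr1.
rewrite mulr0; case: (lastP p) sp path_p st => // p' u _ _; rewrite last_rcons => ut.
case: (xb) => _ xbr _; rewrite -cats1 pairmap_cat /= cats1 -basis_mul_id xbr.
  by rewrite coef_idemr; case: eqP => [tu|_]; rewrite ?mulr0 //; case: ut.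
exact: in_S_basis.
Qed.

(** In degree 0, commuting with the idempotents makes the value at 1 diagonal; this
    replaces the argument for words, which needs a first letter. *)
Lemma ext_chain_values_rel n (x : CS) : graded n x -> J (chain_values (embed x)) = embed x.
Proof.
have [n0|/eqP n0] := eqVneq n 0; rewrite /graded /= /rel_graded; last first.
  case: eqP => // _ [x1 x2n x2b].
  have -> : embed x = x.2.
    apply/funext => -[|b a] //=; rewrite x1; case: x2n => x20 _; rewrite x20 // => n0'.
    by apply: n0; rewrite -n0'.
  exact: ext_chain_values_balanced x2n n0 x2b.
rewrite n0 eqxx => -[[x1l x1m] x2]; apply/funext => -[|b a]; last first.
  rewrite /= x2; apply: incidenceP => s t _; rewrite coef_ext Defs.coef0.
  rewrite (@eq_path_sum _ _ _ K^o s (b :: a) _ (fun=> 0)) ?path_sum0 // => -[|u p] // _ path_p.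
  by rewrite /chain_values path_p -[embed x _]/(x.2 _) x2 Defs.coef0 mul0r.
apply: incidenceP => s t _; rewrite coef_ext /=.
set c := x.1 _.
have ce : c * e s s = e s s * c.
  pose es : {s : A | in_S s} := exist _ (e s s) (in_S_basis s).
  pose i1 : {s : A | in_S s} := exist _ 1 (@in_S1 K T Sigma).
  have /= [|_ <-] := x1m es i1 es; first by rewrite mul1r.
  by have /= [|<- _] := x1m es es i1; first by rewrite mulr1.
have := congr1 (fun z : A => coef z s t) ce.
rewrite coef_ideml coef_idemr eqxx mul1r.
by move=> <-; rewrite eq_sym; case: eqP => [->|_]; rewrite ?mulr0.
Qed.

End Relative.

Section Comparison.
Variables (K : fieldType) (T : finType) (Sigma : {set {set T}}).
Local Notation A := (incidence K Sigma).
Local Notation face := (face Sigma).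
Local Notation le := (@face_le T Sigma).
Local Notation C := (simplicial_cochains K Sigma).
Local Notation CS := (relative_hochschild K Sigma).
Local Notation CH := (hochschild K Sigma).
Local Notation J := (@cochain_ext K T Sigma).
Local Notation embed := (@rel_embed K T Sigma).
Local Notation lift := (@rel_lift K T Sigma).
Local Notation iota := (@iota_map K T Sigma).
Local Notation e := (basis_elt K).
Local Notation chain_values := (@chain_values K T Sigma).
Implicit Types (f g : C) (a : seq A) (s t u : face) (v w : int * CS) (vs : seq (int * CS)).

Lemma weight_npath s p a : size p = size a -> ~~ path le s p ->
  \prod_(z <- zip a (zip (s :: p) p)) coef z.1 z.2.1 z.2.2 = 0.
Proof.
elim: p a s => [|u q IH] [|c d] s //= [sq]; rewrite big_cons /=.
case: (boolP (le s u)) => su /= nq; last by rewrite coef_out ?mul0r.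
by rewrite [X in _ * X](IH d u sq nq) mulr0.
Qed.

(** The explicit sum that defines iota consists of the increasing paths; the other
    ones have weight 0. *)
Lemma iotaE f : iota f = lift (J f).
Proof.
congr (_, _); apply/funext.
  move=> x; apply: incidenceP => s t st; rewrite inc_coef_sum (coef_mulS _ _ _ (svalP x)) coef_ext /=.
  under eq_bigr => u _ do rewrite Defs.coefZ (coef_basis _ u u) face_le_refl andbT.
  rewrite (bigD1 s) //= eqxx big1 ?addr0 => [|u us]; last first.
    by rewrite eq_sym (negbTE us) mulr0.
  by rewrite eq_sym mulrAC mulrC.
case=> [|b a] //; apply: incidenceP => s t st; rewrite [in RHS]/= coef_ext path_sum_tuple.
rewrite inc_coef_sum (bigD1 s) //= [X in _ + X]big1 ?addr0 => [|u us]; last first.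
  rewrite inc_coef_sum big1 // => p _.
  by rewrite Defs.coefZ (coef_basis _ u) eq_sym (negbTE us) mulr0.
rewrite inc_coef_sum [RHS](bigID (fun p : (size a).+1.-tuple face => path le s p)) /=.
rewrite [X in _ = _ + X]big1 ?addr0 => [|p np]; last first.
  by rewrite (weight_npath _ np) ?scale0r // size_tuple.
refine (eq_bigr _ _) => p sp; rewrite Defs.coefZ (coef_basis _ s) eqxx /=.
have -> : le s (last s p) by apply: path_last_le.
by rewrite andbT eq_sym -[RHS]/(_ * _ : K) mulrCA mulrA mulrAC.
Qed.

Lemma rel_embed_graded n (x : CS) : graded n x -> hoch_graded n (embed x).
Proof.
rewrite /graded /= /rel_graded; case: eqP => [->|n0] => [[_ x2]|[x1 x2n _]].
  split=> [[|b a] //= _|l r k b c]; first by rewrite x2.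
  have x2E d l' : embed x (l' ++ d :: r) = 0.
    by rewrite /rel_embed x2; case: l'.
  by rewrite !x2E scaler0 addr0.
have -> : embed x = x.2.
  apply/funext => -[|b a] //=; rewrite x1 (graded_size x2n) //.
  by apply/eqP => n0'; apply: n0; rewrite -n0'.
exact: x2n.
Qed.

Lemma rel_ext n (x : CS) : graded n x ->
  simp_graded n (chain_values (embed x)) /\ x = lift (J (chain_values (embed x))).
Proof.
move=> xn; split; last by rewrite (ext_chain_values_rel xn) (rel_embedK xn).
exact: chain_values_graded (rel_embed_graded xn).
Qed.

Definition chain_values_arg (v : int * CS) : int * C := (v.1, chain_values (embed v.2)).

Lemma chain_values_arg_homog v : homog v -> homog (chain_values_arg v).
Proof. by move=> hv; case: (rel_ext hv). Qed.

Lemma rel_arg_ext v : homog v -> rel_arg v = (v.1, J (chain_values_arg v).2).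
Proof. by move=> hv; rewrite /rel_arg -(ext_chain_values_rel hv). Qed.

(** Every relative cochain is an extension, so that the operations on relative
    cochains are extensions of those on simplicial cochains, and hence balanced. *)
Lemma relative_homogeneous_ops : homogeneous_ops CS.
Proof.
have ra v : homog v -> rel_arg v = on_vec (J : C -> CH) (chain_values_arg v) by exact: rel_arg_ext.
split=> [n|n k x y xn yn|v hv|v w hv hw|v vs hv hvs].
- rewrite (_ : 0 = lift (J 0)); first exact/ext_lift_graded/(ops_graded0 (simplicial_homogeneous_ops K Sigma)).
  have J0 : J 0 = 0.
    by have := ext_linear (-1) (0 : C) (0 : C); rewrite scaler0 addr0 scaleN1r addNr.
  have l0 : lift 0 = 0.
    by have := rel_lift_linear (-1) (0 : seq A -> A) 0; rewrite scaler0 addr0 scaleN1r addNr.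
  by rewrite J0 l0.
- have [fn ->] := rel_ext xn; have [gn ->] := rel_ext yn.
  rewrite -rel_lift_linear -ext_linear; apply: ext_lift_graded.
  exact: (ops_gradedP (simplicial_homogeneous_ops K Sigma)).
- have rv := chain_values_arg_homog hv.
  have E : J (simp_dif (chain_values_arg v)) = hoch_dif (rel_arg v).
    by rewrite ra //; exact: (morph_dif (ext_morphism K Sigma) rv).
  rewrite /homog /= -E; apply: ext_lift_graded.
  exact: (ops_dif (simplicial_homogeneous_ops K Sigma) rv).
- have rv := chain_values_arg_homog hv; have rw := chain_values_arg_homog hw.
  have E : J (simp_mul (chain_values_arg v) (chain_values_arg w))
      = hoch_mul (rel_arg v) (rel_arg w).
    by rewrite !ra //; exact: (morph_mul (ext_morphism K Sigma) rv rw).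
  rewrite /homog /= -E; apply: ext_lift_graded.
  exact: (ops_mul (simplicial_homogeneous_ops K Sigma) rv rw).
have rv := chain_values_arg_homog hv.
have rvs : all_homog (map chain_values_arg vs).
  by move=> _ /mapP [w wvs ->]; apply: chain_values_arg_homog; apply: hvs.
have vsE : [seq rel_arg y | y <- vs] = map (on_vec (J : C -> CH)) (map chain_values_arg vs).
  by rewrite -map_comp; apply/eq_in_map => w wvs; apply: ra; apply: hvs.
have E : J (simp_brace (chain_values_arg v) (map chain_values_arg vs))
    = hoch_brace (rel_arg v) [seq rel_arg y | y <- vs].
  by rewrite ra // vsE; exact: (morph_brace (ext_morphism K Sigma) rv rvs).
rewrite /homog /= -E; apply: ext_lift_graded.
have := ops_brace (simplicial_homogeneous_ops K Sigma) rv rvs.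
by rewrite /homog /= /sdeg big_map.
Qed.

(** The operations of the relative complex are defined by transport along the
    embedding, which is inverse to the lifting on all functions. *)
Lemma embed_morphism : bdga_morphism (embed : CS -> CH).
Proof.
split=> [n x|n k x y _ _|v hv|v w hv hw|v vs hv hvs].
- exact: rel_embed_graded.
- exact: rel_embed_linear.
- exact: rel_liftK.
- exact: rel_liftK.
- exact: rel_liftK.
Qed.

Lemma iota_morphism : bdga_morphism (iota : C -> CS).
Proof.
have JM := ext_morphism K Sigma.
have io (v : int * C) : rel_arg (on_vec (iota : C -> CS) v) = on_vec (J : C -> CH) v.
  by case: v => n f; rewrite /rel_arg /on_vec /= iotaE rel_liftK.
split=> [n f fn|n k f g fn gn|v hv|v w hv hw|v vs hv hvs]; rewrite !iotaE.
- exact: ext_lift_graded.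
- by rewrite ext_linear rel_lift_linear.
- by rewrite /= io (morph_dif JM hv).
- by rewrite /= !io (morph_mul JM hv hw).
rewrite /= io (morph_brace JM hv hvs) -map_comp; congr (lift (hoch_brace _ _)).
by apply: eq_map => w /=; rewrite io.
Qed.

Lemma chain_values_embed_iota n f : graded n f -> chain_values (embed (iota f)) = f.
Proof. by move=> fn; rewrite iotaE rel_liftK (chain_values_ext fn). Qed.

Lemma iota_chain_values_embed n (x : CS) : graded n x -> iota (chain_values (embed x)) = x.
Proof. by move=> xn; rewrite iotaE (ext_chain_values_rel xn) (rel_embedK xn). Qed.

Lemma iota_iso : bdga_iso (iota : C -> CS).
Proof.
split; first exact: iota_morphism.
exists (chain_values \o embed : CS -> C).
  apply: inverse_morphism (simplicial_homogeneous_ops K Sigma) iota_morphism _ _ _.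
  - by move=> n x xn; case: (rel_ext xn).
  - exact: chain_values_embed_iota.
  - exact: iota_chain_values_embed.
split; [exact: chain_values_embed_iota|exact: iota_chain_values_embed].
Qed.

Lemma relative_is_bdga : is_bdga (normalize CS).
Proof.
apply: (@pullback_bdga K CS CH embed (fun x => lift (embed x) = x)).
- exact: rel_embed_linear.
- by rewrite -{2}(rel_embedK (ops_graded0 relative_homogeneous_ops 0)).
- by move=> k x y xE yE; rewrite rel_embed_linear rel_lift_linear xE yE.
- exact: rel_embedK.
- by move=> x y {2}<- {2}<- ->.
- exact: relative_homogeneous_ops.
- exact: embed_morphism.
- exact: hochschild_is_bdga.
Qed.

(** The extension of cochains embeds the simplicial cochains into the Hochschild
    cochains, so the identities are inherited. *)
Lemma simplicial_is_bdga : is_bdga (normalize C).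
Proof.
apply: (@pullback_bdga K C CH J (@on_simplices K T Sigma)).
- exact: ext_linear.
- by [].
- by move=> k f g f0 g0 c nc; rewrite !fctE f0 // g0 // scaler0 addr0.
- exact: simp_graded_on_simplices.
- exact: ext_inj.
- exact: simplicial_homogeneous_ops.
- exact: ext_morphism.
- exact: hochschild_is_bdga.
Qed.

Lemma embed_inj (n : int) (x y : CS) : graded n x -> graded n y -> embed x = embed y -> x = y.
Proof. by move=> xn yn xy; rewrite -(rel_embedK xn) xy (rel_embedK yn). Qed.

Lemma iota_degree0 f s x : sval x = e s s -> (iota f).1 x = f [:: s] *: e s s.
Proof.
rewrite iotaE /= => ->; apply: incidenceP => u t _.
rewrite coef_ideml coef_ext /= Defs.coefZ (coef_basis _ s) face_le_refl andbT.
case: eqP => [->|_]; last by rewrite mul0r mulr0.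
by rewrite mul1r eq_sym.
Qed.

Lemma iota_chain f s p : path le s p -> (0 < size p)%N ->
  (iota f).2 (pairmap e s p) = f (s :: p) *: e s (last s p).
Proof.
move=> sp; rewrite iotaE; case: p sp => // u p sp _.
rewrite -[(lift _).2 _]/(J f (pairmap e s (u :: p))).
apply: incidenceP => t w _; rewrite Defs.coefZ coef_ext (coef_basis _ s) (path_last_le sp) andbT.
have [->|ts] := eqVneq t s.
  by rewrite (path_sum_chain (V := K^o)) //= eq_sym.
rewrite mulr0 [LHS]/= big1 // => v _.
by rewrite coef_basis (negbTE ts) scale0r.
Qed.

End Comparison.

(** * The homotopy onto chains of basis elements *)

Section Homotopy.
Variables (K : fieldType) (T : finType) (Sigma : {set {set T}}).
Local Notation A := (incidence K Sigma).
Local Notation face := (face Sigma).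
Local Notation le := (@face_le T Sigma).
Local Notation e := (basis_elt K).
Implicit Types (F G : seq A -> A) (a : seq A) (b c : A) (s t u v : face).

(** The factor on the right retains only the last face of the path; the values on
    chains need not be concentrated there when F is not balanced. *)
Definition chains_from s F : seq face -> A :=
  fun p => F (pairmap e s p) * e (last s p) (last s p).

(** The first letter (s, s) makes room for a chain starting at an arbitrary face s,
    independently of the letters that precede it. *)
Definition chain_sum a F : A :=
  \sum_s path_sum s a (chains_from s (fun w => F (e s s :: w))).

(** The homotopy between a cochain and the extension of its chain values, as an
    analogue of the subdivision of a prism: the letters l are kept, the letters r
    are replaced by chains of basis elements, and (s, s) marks the place where one
    passes from the former to the latter. *)
Definition prism a F : A :=
  cutsum a (fun l r => sgn K (size l)%:Z *: chain_sum r (fun w => F (l ++ w))).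

Lemma eq_chain_sum a F G : (forall x w, F (x :: w) = G (x :: w)) ->
  chain_sum a F = chain_sum a G.
Proof.
by move=> FG; apply: eq_bigr => s _; apply: eq_path_sum => p _ _; rewrite /chains_from FG.
Qed.

Lemma eq_prism a F G : (forall x w, F (x :: w) = G (x :: w)) -> prism a F = prism a G.
Proof.
move=> FG; apply: eq_cutsum => l r _; congr (_ *: _).
by apply: eq_chain_sum => x w; case: l => [|c l]; rewrite FG.
Qed.

Lemma prism_cons b a F : prism (b :: a) F = chain_sum (b :: a) F - prism a (fun w => F (b :: w)).
Proof.
rewrite /prism /=; congr (_ + _); first by rewrite scale1r.
rewrite -scaleN1r -cutsumZ; apply: eq_cutsum => l r _.
by rewrite scalerA; congr (_ *: _); rewrite -[-1]/(sgn K 1) -sgnD.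
Qed.

Lemma chain_sumB a F G :
  chain_sum a (fun w => F w - G w) = chain_sum a F - chain_sum a G.
Proof.
rewrite /chain_sum -sumrB; apply: eq_bigr => s _; rewrite -[- path_sum _ _ _]scaleN1r addrC.
rewrite -path_sum_linearP; apply: eq_path_sum => p _ _.
by rewrite /chains_from mulrBl scaleN1r addrC.
Qed.

Lemma prismB a F G : prism a (fun w => F w - G w) = prism a F - prism a G.
Proof.
rewrite /prism -[- cutsum _ _]scaleN1r -cutsumZ -cutsumD; apply: eq_cutsum => l r _.
by rewrite chain_sumB scalerBr scaleN1r.
Qed.

(** Multiplying two adjacent basis elements of a chain omits the face between them. *)
Lemma contract_chain s p F : path le s p ->
  contract (pairmap e s p) F * e (last s p) (last s p) = inner_faces p (chains_from s F).
Proof.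
elim: p s F => [|t [|u p] IH] s F //= sp; rewrite ?mul0r //.
rewrite -[X in F _ - X]/(contract (pairmap e t (u :: p)) (fun l => F (e s t :: l))).
case/andP: sp => st tup; rewrite mulrBl -[last u p]/(last t (u :: p)) IH //.
case/andP: tup => tu up.
by rewrite basis_elt_mul // eqxx.
Qed.

Lemma contract_sum (V : lmodType K) (I : Type) (r : seq I) (P : pred I) a (X : I -> seq A -> V) :
  contract a (fun l => \sum_(i <- r | P i) X i l) = \sum_(i <- r | P i) contract a (X i).
Proof.
rewrite contractE; under eq_bigr do rewrite scaler_sumr.
by rewrite exchange_big; apply: eq_bigr => i _; rewrite contractE.
Qed.

(** The contraction that involves the preceding letter b and the idempotent (s, s)
    yields b * (s, s), which expands into basis elements ending at s: it turns the
    chain from s into a chain starting one step earlier.  This term recurs, as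
    the contraction of (s, s) with the first basis element of a longer chain. *)
Lemma chain_sum_contract b a F : multilinear F ->
  chain_sum (b :: a) (fun w => contract w F)
  = chain_sum a (fun w => F (b * head 0 w :: behead w))
    - contract (b :: a) (fun l => chain_sum l F).
Proof.
move=> Fl; rewrite contract_sum.
have -> : \sum_s contract (b :: a) (fun l => path_sum s l (chains_from s (fun w => F (e s s :: w))))
    = \sum_s path_sum s (b :: a) (chains_from s (fun w => contract w (fun l => F (e s s :: l)))).
  apply: eq_bigr => s _; rewrite contract_path_sum; apply: eq_path_sum => p _ sp.
  by rewrite /chains_from (contract_chain (fun l => F (e s s :: l)) sp).
have -> : chain_sum a (fun w => F (b * head 0 w :: behead w))
    = \sum_s path_sum s (b :: a) (fun p => F (pairmap e s p) * e (last s p) (last s p)).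
  transitivity (\sum_u \sum_s coef b s u *: path_sum u a (fun p =>
      F (e s u :: pairmap e u p) * e (last u p) (last u p))).
    apply: eq_bigr => u _; under [RHS]eq_bigr do rewrite -path_sumZ.
    rewrite -path_sum_sum; apply: eq_path_sum => p _ _.
    rewrite /chains_from /= (mul_basis_expand b u) (multilinear_sum Fl _ _ [::]) mulr_suml.
    by apply: eq_bigr => s _; rewrite (multilinearZ Fl [::]) inc_scaleAl.
  rewrite [LHS]exchange_big; apply: eq_bigr => s _; reflexivity.
rewrite -sumrB; apply: eq_bigr => s _; rewrite -[- path_sum _ _ _]scaleN1r addrC -path_sum_linearP.
apply: eq_path_sum => -[|u p] // _ /andP [su up].
rewrite /chains_from [pairmap _ _ _]/= contract_cons mulrBl scaleN1r addrC.
rewrite basis_elt_mul ?face_le_refl // eqxx.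
by [].
Qed.

(** The inner faces of the prism.  Contractions within l or within r commute with
    the operator up to sign, and the two contractions at the marked place cancel between
    consecutive cuts by [chain_sum_contract].  The induction on the word peels off
    its first letter, which is kept or starts the chain. *)
Lemma prism_contract a F : multilinear F ->
  prism a (fun w => contract w F) = - contract a (fun l => prism l F).
Proof.
elim: a F => [|b a IH] F Fl.
  rewrite /prism /= addr0 oppr0 scale1r /chain_sum big1 // => s _.
  by rewrite /= /chains_from /= mul0r.
rewrite prism_cons (chain_sum_contract _ _ Fl).
have -> : prism a (fun w => contract (b :: w) F)
    = prism a (fun w => F (b * head 0 w :: behead w))
      - prism a (fun w => contract w (fun l => F (b :: l))).
  by rewrite -prismB; apply: eq_prism.
rewrite IH ?opprK; last exact: multilinear_cons.
case: a {IH} => [|c a].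
  rewrite /prism /= !addr0 !scale1r subr0 oppr0 subrr //.
rewrite !contract_cons (prism_cons c a (fun w => F (b * head 0 w :: behead w))).
rewrite -[prism a _]/(prism a (fun w => F (b * c :: w))).
rewrite (prism_cons (b * c) a F).
have -> : contract (c :: a) (fun l => prism (b :: l) F)
    = contract (c :: a) (fun l => chain_sum (b :: l) F)
      - contract (c :: a) (fun l => prism l (fun w => F (b :: w))).
  by rewrite -contractB; congr contract; apply/funext => l; rewrite prism_cons.
(* What remains is linear in these terms. *)
move: (chain_sum (c :: a) _) (chain_sum (b * c :: a) F) (prism a _)
  (contract (c :: a) (fun l => chain_sum (b :: l) F)) (contract (c :: a) _) => x1 x2 x3 x4 x5.
by coef_ring.
Qed.

End Homotopy.

Section QuasiIso.
Variables (K : fieldType) (T : finType) (Sigma : {set {set T}}).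
Local Notation A := (incidence K Sigma).
Local Notation face := (face Sigma).
Local Notation le := (@face_le T Sigma).
Local Notation C := (simplicial_cochains K Sigma).
Local Notation CS := (relative_hochschild K Sigma).
Local Notation CH := (hochschild K Sigma).
Local Notation J := (@cochain_ext K T Sigma).
Local Notation e := (basis_elt K).
Local Notation cv := (@chain_values K T Sigma).
Local Notation id_cochain := (@id_cochain K T Sigma).
Local Notation embed := (@rel_embed K T Sigma).
Local Notation iota := (@iota_map K T Sigma).
Implicit Types (F G : seq A -> A) (a : seq A) (b c : A) (s t u v : face).

Lemma chain_sum_linearP k a F G :
  chain_sum a (fun w => k *: F w + G w) = k *: chain_sum a F + chain_sum a G.
Proof.
rewrite /chain_sum scaler_sumr -big_split; apply: eq_bigr => s _ /=.
rewrite -path_sum_linearP; apply: eq_path_sum => p _ _.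
by rewrite /chains_from mulrDl inc_scaleAl.
Qed.

Lemma prism_linearP k a F G :
  prism a (fun w => k *: F w + G w) = k *: prism a F + prism a G.
Proof.
rewrite /prism -cutsumZ -cutsumD; apply: eq_cutsum => l r _.
by rewrite chain_sum_linearP scalerDr scaler_swap.
Qed.

Lemma chain_sum_mull b a F : chain_sum a (fun w => b * F w) = b * chain_sum a F.
Proof.
rewrite /chain_sum mulr_sumr; apply: eq_bigr => s _; rewrite !path_sum_tuple mulr_sumr.
by apply: eq_bigr => p _; rewrite -inc_scaleAr /chains_from mulrA.
Qed.

Lemma prism_mull b a F : prism a (fun w => b * F w) = b * prism a F.
Proof.
rewrite /prism [in RHS]cutsumE mulr_sumr cutsumE; apply: eq_bigr => k _.
by rewrite chain_sum_mull inc_scaleAr.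
Qed.

(** The first outer face: when no letter is kept, the first letter of the argument is
    (s, s), and multiplying by it leaves the coefficients on the intervals from s,
    which are those of the extension of the chain values. *)
Lemma prism_idl a F : prism a (cup id_cochain F) = J (cv F) a - cup id_cochain (fun l => prism l F) a.
Proof.
have cE : chain_sum a (cup id_cochain F) = J (cv F) a.
  apply: incidenceP => s t _; rewrite inc_coef_sum coef_ext.
  transitivity (\sum_u (path_sum u a (fun p =>
      (s == u)%:R * cv F (u :: p) * (last u p == t)%:R : K^o) : K)).
    apply: eq_bigr => u _; rewrite coef_path_sum; apply: (@eq_path_sum _ _ _ K^o) => p _ up.
    rewrite /chains_from cup_idl coef_idemr coef_ideml /= up eq_sym.
    have [<-|_] := eqVneq (last u p) t; last by rewrite !mulr0.
    by have [->|_] := eqVneq s u; rewrite ?mul0r.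
  rewrite (bigD1 s) //= big1 ?addr0 => [|u us]; last first.
    rewrite (@eq_path_sum _ _ _ K^o u a _ (fun=> 0)) ?path_sum0 // => p _ _.
    by rewrite eq_sym (negbTE us) !mul0r.
  by apply: (@eq_path_sum _ _ _ K^o) => p _ _; rewrite eqxx mul1r.
case: a cE => [|b a] cE.
  by rewrite /prism /= addr0 scale1r cE /cup /= mul0r addr0 subr0.
rewrite prism_cons cE cup_idl -prism_mull; congr (_ - _).
by apply: eq_prism => x w; rewrite cup_idl.
Qed.

Lemma sum_basis_idem : \sum_s e s s = 1 :> A.
Proof. by []. Qed.

Lemma pairmap_rcons s p u : pairmap e s (rcons p u) = rcons (pairmap e s p) (e (last s p) u).
Proof. by rewrite -cats1 pairmap_cat /= cats1. Qed.

Lemma chain_sum_nil F : chain_sum [::] F = \sum_s F [:: e s s] * e s s.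
Proof. by []. Qed.

Lemma basis_idem s : e s s * e s s = e s s :> A.
Proof. exact: basis_mul_id. Qed.

Lemma chain_sum_nil_idr l F : chain_sum [::] (fun w => cup F id_cochain (l ++ w)) = F l.
Proof.
rewrite chain_sum_nil -[RHS]mulr1 -sum_basis_idem mulr_sumr; apply: eq_bigr => s _.
by rewrite cats1 cup_idr -mulrA basis_idem.
Qed.

Lemma chain_sum_rcons_idr l q c F :
  chain_sum (rcons q c) (fun w => cup F id_cochain (l ++ w)) = chain_sum q (fun w => F (l ++ w)) * c.
Proof.
rewrite /chain_sum mulr_suml; apply: eq_bigr => s _.
rewrite -cats1 path_sum_cat !path_sum_tuple mulr_suml; apply: eq_bigr => p _.
rewrite -inc_scaleAl; congr (_ *: _).
rewrite /chains_from -mulrA (basis_mul_expand (last s p) c) mulr_sumr; apply: eq_bigr => u _.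
rewrite cats1 pairmap_rcons -rcons_cons -rcons_cat cup_idr last_rcons -mulrA.
by rewrite basis_mul_id inc_scaleAr.
Qed.

(** The last outer face: when all letters are kept, the last letter of the argument
    is (s, s), and the sum of F a * (s, s) over s is F a. *)
Lemma prism_idr a F :
  prism a (cup F id_cochain) = sgn K (size a)%:Z *: F a + cup (fun l => prism l F) id_cochain a.
Proof.
case: (lastP a) => [|{}a c].
  rewrite /prism /= addr0 scale1r (chain_sum_nil_idr [::] F) scale1r.
  by rewrite /cup /= mulr0 !addr0.
rewrite {1}/prism cutsum_rcons chain_sum_nil_idr cup_idr addrC; congr (_ + _).
rewrite /prism [in RHS]cutsumE mulr_suml cutsumE; apply: eq_bigr => k _.
by rewrite chain_sum_rcons_idr inc_scaleAl.
Qed.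

Lemma chain_sum_multilinear F : multilinear (fun a => chain_sum a F).
Proof.
move=> l r k b c; rewrite /chain_sum scaler_sumr -big_split; apply: eq_bigr => s _ /=.
rewrite !path_sum_cat -path_sum_linearP; apply: eq_path_sum => p _ _ /=.
rewrite scaler_sumr -big_split; apply: eq_bigr => u _ /=.
by rewrite Defs.coefD Defs.coefZ scalerDl scalerA.
Qed.

Lemma prism_graded n F : hoch_graded n F -> hoch_graded (n - 1) (fun a => prism a F).
Proof.
move=> Fn; have Fl := graded_multilinear Fn; split=> [a sa|l r k b c].
  rewrite /prism -[RHS](cutsum0 _ a); apply: eq_cutsum => l r aE.
  rewrite /chain_sum big1 ?scaler0 // => s _.
  rewrite (@eq_path_sum _ _ _ _ s r _ (fun=> 0)) ?path_sum0 // => p sp _.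
  rewrite /chains_from (graded_size Fn) ?mul0r //; apply/eqP => nE; apply: sa.
  by rewrite -nE aE !size_cat /= size_pairmap sp; lia.
rewrite /prism !cutsum_cat scalerDr addrACA -!cutsumZ -!cutsumD; congr (_ + _).
  apply: eq_cutsum => p q _.
  by rewrite (chain_sum_multilinear (fun w => F (p ++ w))) scalerDr scaler_swap.
apply: eq_cutsum => p q _; rewrite !size_cat /= scaler_swap -scalerDr; congr (_ *: _).
rewrite -chain_sum_linearP; congr chain_sum; apply/funext => w.
by rewrite -!catA !cat_cons Fl.
Qed.

(** Assembles the outer faces [prism_idl], [prism_idr] and the inner ones
    [prism_contract] according to the form [hoch_difE] of the coboundary. *)
Lemma prism_homotopy n F : hoch_graded n F ->
  J (cv F) = F + hoch_dif (n - 1, fun a => prism a F) + (fun a => prism a (hoch_dif (n, F))).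
Proof.
move=> Fn; have Pn := prism_graded Fn.
apply/funext => a; rewrite !fctE.
rewrite (hoch_difE (v := (n, F))) // (hoch_difE (v := (n - 1, fun a => prism a F))) //=.
have -> : prism a (cup id_cochain F + sgn K (n + 1) *: cup F id_cochain - plug F [:: mult_arg K Sigma])
    = prism a (cup id_cochain F) + sgn K (n + 1) *: prism a (cup F id_cochain)
      - prism a (fun w => contract w F).
  rewrite [X in _ = X - _]addrC -prism_linearP -prismB; congr prism; apply/funext => w.
  by rewrite !fctE plug_mult; congr (_ - _); rewrite addrC.
rewrite prism_idl prism_idr (prism_contract _ (graded_multilinear Fn)) !fctE plug_mult subrK.
rewrite opprK scalerDr scalerA.
have -> : (sgn K (n + 1) * sgn K (size a)%:Z) *: F a = - F a.
  have [->|/(graded_size Fn)->] := eqVneq (size a)%:Z n; last by rewrite scaler0 oppr0.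
  by rewrite sgnD mulrAC sgn_sq mul1r scaleN1r.
rewrite sgnD -[sgn K 1]/(-1) mulrN1.
move: (F a) (cup id_cochain _ a) (cup _ id_cochain a) (contract a _) (J _ a) => x1 x2 x3 x4 x5.
by coef_ring.
Qed.

Lemma prism0 a : prism a (0 : seq A -> A) = 0.
Proof.
rewrite /prism -[RHS](cutsum0 _ a); apply: eq_cutsum => l r _.
rewrite /chain_sum big1 ?scaler0 // => s _.
rewrite (@eq_path_sum _ _ _ _ s r _ (fun=> 0)) ?path_sum0 // => p _ _; exact: mul0r.
Qed.

(** The coboundary of the restriction is compared after extension, where both sides
    are the same by applying the homotopy identity to F and to its coboundary. *)
Lemma chain_values_cochain_map : cochain_map (cv : CH -> C).
Proof.
split=> [n F|n k F G _ _|[n F] Fn]; [exact: chain_values_graded|exact: chain_values_linear|].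
have bH := hochschild_is_bdga K Sigma.
have Fg : hoch_graded n F := Fn.
have dFg : hoch_graded (n + 1) (hoch_dif (n, F)) by exact: (dif_homog_of_bdga bH Fn).
have PF := prism_graded Fg; have PdF := prism_graded dFg.
have nK : n + 1 - 1 = n by rewrite addrK.
have nK' : n - 1 + 1 = n by rewrite subrK.
have simp_dF := chain_values_graded dFg.
have simp_F := chain_values_graded Fg.
apply: ext_inj.
- exact: simp_graded_on_simplices simp_dF.
- apply: simp_graded_on_simplices.
  exact: (ops_dif (simplicial_homogeneous_ops K Sigma) (simp_F : homog (n, cv F : C))).
rewrite -[dif (on_vec _ _)]/(simp_dif (n, cv F)) (ext_dif simp_F).
rewrite (prism_homotopy Fg) -[dif (n, F)]/(hoch_dif (n, F)) (prism_homotopy dFg) nK.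
have dPF : hoch_graded n (hoch_dif (n - 1, fun a => prism a F)).
  by rewrite -{1}nK'; exact: (dif_homog_of_bdga bH (PF : homog (_, _ : CH))).
have FdPF : hoch_graded n (F + hoch_dif (n - 1, fun a => prism a F)) by exact: hoch_gradedD.
rewrite nK in PdF.
have difD (x y : seq A -> A) : hoch_graded n x -> hoch_graded n y ->
    hoch_dif (n, x + y) = hoch_dif (n, x) + hoch_dif (n, y).
  move=> xn yn; have := dif_linear_of_bdga bH 1 (xn : @graded K CH n x) yn.
  by rewrite !scale1r.
rewrite !difD //.
have -> : hoch_dif (n, hoch_dif (n - 1, fun a => prism a F)) = 0.
  by rewrite -{1}nK'; exact: (dif_dif_of_bdga bH (PF : homog (_, _ : CH))).
have -> : hoch_dif (n + 1, hoch_dif (n, F)) = 0.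
  exact: (dif_dif_of_bdga bH (Fn : homog (_, _ : CH))).
have -> : (fun a => prism a (0 : seq A -> A)) = 0 by apply/funext => a; exact: prism0.
by rewrite !addr0.
Qed.

Lemma embed_iotaE f : embed (iota f) = J f.
Proof. by rewrite iotaE rel_liftK. Qed.

(** On a cocycle the second term of the homotopy vanishes, and the first one is a
    coboundary. *)
Lemma ext_chain_values_coboundary n (y : CH) : cocycle n y -> coboundary n (J (cv y) - y : CH).
Proof.
move=> [yn dy]; exists (fun a => prism a y : A); first exact: prism_graded yn.
rewrite (prism_homotopy yn) -[hoch_dif (n, y)]/(@dif K CH (n, y)) dy.
have -> : (fun a => prism a (0 : seq A -> A)) = 0 by apply/funext => a; exact: prism0.
by rewrite addr0 addrAC subrr add0r.
Qed.

Lemma embed_iota_quasi_iso : quasi_iso (embed \o iota : C -> CH).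
Proof.
apply: (@retract_quasi_iso _ _ _ _ (cv : CH -> C)).
- exact: simplicial_is_bdga.
- exact: hochschild_is_bdga.
- apply: morphism_cochain_map; apply: comp_morphism; first exact: iota_morphism.
  exact: embed_morphism.
- exact: chain_values_cochain_map.
- by move=> n f fn; rewrite /= embed_iotaE (chain_values_ext fn).
- by move=> n y yc; rewrite /= embed_iotaE; apply: ext_chain_values_coboundary.
Qed.

Lemma embed_quasi_iso : quasi_iso (embed : CS -> CH).
Proof.
apply: (@retract_quasi_iso _ _ _ _ (iota \o cv : CH -> CS)).
- exact: relative_is_bdga.
- exact: hochschild_is_bdga.
- by apply: morphism_cochain_map; exact: embed_morphism.
- have iM := iota_morphism K Sigma; have cC := chain_values_cochain_map.
  split=> [n y yn|n k x y xn yn|v hv] /=.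
  + exact: (morph_graded iM (cmap_graded cC yn)).
  + rewrite (cmap_linear cC k xn yn).
    exact: (morph_linear iM k (cmap_graded cC xn) (cmap_graded cC yn)).
  + rewrite (cmap_dif cC hv).
    exact: (morph_dif iM (cmap_graded cC hv : homog (on_vec (cv : CH -> C) v))).
- by move=> n x xn; rewrite /= (iota_chain_values_embed xn).
- by move=> n y yc; rewrite /= embed_iotaE; apply: ext_chain_values_coboundary.
Qed.

End QuasiIso.

Theorem theorem7p5 (K : fieldType) (T : finType) (Sigma : {set {set T}})
    (T_nonempty : (0 < #|T|)%N) (SigmaP : simplicial_complex Sigma) :
  let C := simplicial_cochains K Sigma in
  let CS := relative_hochschild K Sigma in
  let CH := hochschild K Sigma in
  let iota : C -> CS := @iota_map K T Sigma in
  let embed : CS -> CH := @rel_embed K T Sigma in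
  [/\ is_bdga (normalize C), is_bdga (normalize CS) & is_bdga (normalize CH)] /\
  ((forall (f : C) s x,
      sval x = basis_elt K s s -> (iota f).1 x = f [:: s] *: basis_elt K s s) /\
   (forall (f : C) s p, path (@face_le T Sigma) s p -> (0 < size p)%N ->
      (iota f).2 (pairmap (basis_elt K) s p)
      = f (s :: p) *: basis_elt K s (last s p))) /\
  bdga_iso iota /\
  [/\ bdga_morphism embed,
      forall (n : int) x y, graded n x -> graded n y -> embed x = embed y -> x = y
    & quasi_iso embed] /\
  (bdga_morphism (embed \o iota) /\ quasi_iso (embed \o iota)).
Proof.
split; first by split; [exact: simplicial_is_bdga|exact: relative_is_bdga|exact: hochschild_is_bdga].
split; first by split; [exact: iota_degree0|exact: iota_chain].
split; first exact: iota_iso.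
split; first by split; [exact: embed_morphism|exact: embed_inj|exact: embed_quasi_iso].
split; last exact: embed_iota_quasi_iso.
apply: comp_morphism; [exact: iota_morphism|exact: embed_morphism].
Qed.
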